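(* Let $\mathbf{K}$ be an algebraically closed field of characteristic $p\ge 0$ and let $f\in\mathbf{K}[[x,y]]$ be a plane curve singularity. If $f$ is semi-quasihomogeneous with respect to some weight $\overrightarrow{w}=(n,m)$ with $n,m$ strictly positive integers, then $f$ is tame.
   Context: A plane curve singularity is a nonzero power series of order (lowest degree of a monomial occurring in it) greater than one. For a weight $\overrightarrow{w}=(n,m)$ of strictly positive integers and a nonzero $f=\sum c_{\alpha\beta}x^\alpha y^\beta$, put $\mathrm{ord}_{\overrightarrow{w}}(f)=\inf\{\alpha n+\beta m : c_{\alpha\beta}\ne 0\}$ and $\mathrm{in}_{\overrightarrow{w}}(f)=\sum_{\alpha n+\beta m=\mathrm{ord}_{\overrightarrow{w}}(f)}c_{\alpha\beta}x^\alpha y^\beta$. The series $f$ is semi-quasihomogeneous with respect to $\overrightarrow{w}$ if the system of equations $\frac{\partial}{\partial x}\mathrm{in}_{\overrightarrow{w}}(f)=0$, $\frac{\partial}{\partial y}\mathrm{in}_{\overrightarrow{w}}(f)=0$ has $(x,y)=(0,0)$ as its only solution (in $\mathbf{K}^2$). The Milnor number is $\mu(f)=\dim_{\mathbf{K}}\mathbf{K}[[x,y]]/\left(\frac{\partial f}{\partial x},\frac{\partial f}{\partial y}\right)$. For a reduced power series $f$ (no multiple factors), let $\mathcal{O}_f=\mathbf{K}[[x,y]]/(f)$, let $\overline{\mathcal{O}_f}$ be its integral closure in its total quotient ring, $\delta(f)=\dim_{\mathbf{K}}\overline{\mathcal{O}_f}/\mathcal{O}_f$, and let $r(f)$ be the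 number of irreducible factors of $f$. A plane curve singularity $f$ is tame if it is reduced and $\mu(f)=2\delta(f)-r(f)+1$. *)

(* Defs.v *)
From HB Require Import structures.
From mathcomp Require Import all_boot all_algebra.
From mathcomp Require Import boolp mpoly ring.

Set Implicit Arguments.
Unset Strict Implicit.
Unset Printing Implicit Defensive.

Import GRing.Theory.
Local Open Scope ring_scope.
Local Open Scope quotient_scope.

(* [f a b] is the coefficient of x^a y^b. *)
Record fps2 (R : Type) := Fps2 { fps2_coef :> nat -> nat -> R }.

Notation "{ 'fps2' R }" := (fps2 R) (format "{ 'fps2'  R }") : type_scope.

HB.instance Definition _ (R : Type) := gen_eqMixin {fps2 R}.
HB.instance Definition _ (R : Type) := gen_choiceMixin {fps2 R}.

Lemma fps2P (R : Type) (f g : {fps2 R}) : (forall a b, f a b = g a b) -> f = g.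
Proof.
case: f g => [f] [g] /= e; congr Fps2.
by apply: funext => a; apply: funext => b; exact: e.
Qed.

Section Fps2Ring.
Variable R : comNzRingType.
Implicit Types (f g h : {fps2 R}) (a b n : nat).

Definition fps2C (c : R) : {fps2 R} :=
  Fps2 (fun a b => if (a == 0%N) && (b == 0%N) then c else 0).
Definition fps2_opp f : {fps2 R} := Fps2 (fun a b => - f a b).
Definition fps2_add f g : {fps2 R} := Fps2 (fun a b => f a b + g a b).
Definition fps2_mul f g : {fps2 R} := Fps2 (fun a b =>
  \sum_(i < a.+1) \sum_(j < b.+1) f i j * g (a - i)%N (b - j)%N).
Definition fps2_scale (c : R) f : {fps2 R} := Fps2 (fun a b => c * f a b).

Let addA : associative fps2_add.
Proof. by move=> f g h; apply: fps2P => a b /=; rewrite addrA. Qed.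
Let addC : commutative fps2_add.
Proof. by move=> f g; apply: fps2P => a b /=; rewrite addrC. Qed.
Let add0 : left_id (fps2C 0) fps2_add.
Proof. by move=> f; apply: fps2P => a b /=; case: ifP; rewrite add0r. Qed.
Let addN : left_inverse (fps2C 0) fps2_opp fps2_add.
Proof. by move=> f; apply: fps2P => a b /=; rewrite addNr; case: ifP. Qed.

HB.instance Definition _ :=
  GRing.isZmodule.Build {fps2 R} addA addC add0 addN.

(* The ring axioms are transferred from {poly {poly R}} by truncation. *)
Let rep n f (P : {poly {poly R}}) :=
  forall a b, (a < n)%N -> (b < n)%N -> P`_a`_b = f a b.

Let repE f g :
  (forall n, exists2 P, rep n f P & rep n g P) -> f = g.
Proof.
move=> e; apply: fps2P => a b; have [P Pf Pg] := e (maxn a b).+1.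
by rewrite -Pf ?Pg // ltnS ?leq_maxl ?leq_maxr.
Qed.

Let rep_ex n f : exists P, rep n f P.
Proof.
exists (\poly_(i < n) \poly_(j < n) f i j) => a b an bn.
by rewrite coef_poly an coef_poly bn.
Qed.

Let rep_mul n f g P Q : rep n f P -> rep n g Q -> rep n (fps2_mul f g) (P * Q).
Proof.
move=> Pf Qg a b an bn; rewrite coefM coef_sum; apply: eq_bigr => i _.
rewrite coefM; apply: eq_bigr => j _; rewrite Pf ?Qg //.
- exact: leq_ltn_trans (leq_subr _ _) an.
- exact: leq_ltn_trans (leq_subr _ _) bn.
- exact: leq_trans (ltn_ord i) an.
- exact: leq_trans (ltn_ord j) bn.
Qed.

Let rep_add n f g P Q : rep n f P -> rep n g Q -> rep n (fps2_add f g) (P + Q).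
Proof. by move=> Pf Qg a b an bn; rewrite !coefD Pf ?Qg. Qed.

Let repC n c : rep n (fps2C c) (c%:P)%:P.
Proof.
move=> a b _ _; rewrite coefC /=; case: eqP => /= _; last by rewrite coef0.
by rewrite coefC; case: eqP.
Qed.

Let mulA : associative fps2_mul.
Proof.
move=> f g h; apply: repE => n; have [P Pf] := rep_ex n f.
have [Q Qg] := rep_ex n g; have [S Sh] := rep_ex n h.
exists (P * (Q * S)); first by do 2!apply: rep_mul => //.
by rewrite mulrA; do 2!apply: rep_mul => //.
Qed.

Let mulC : commutative fps2_mul.
Proof.
move=> f g; apply: repE => n; have [P Pf] := rep_ex n f.
have [Q Qg] := rep_ex n g; exists (P * Q); first exact: rep_mul.
by rewrite mulrC; exact: rep_mul.
Qed.

Let mul1 : left_id (fps2C 1) fps2_mul.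
Proof.
move=> f; apply: repE => n; have [P Pf] := rep_ex n f.
by exists P => //; rewrite -[P]mul1r; apply: rep_mul => //; exact: repC.
Qed.

Let mulDl : left_distributive fps2_mul fps2_add.
Proof.
move=> f g h; apply: repE => n; have [P Pf] := rep_ex n f.
have [Q Qg] := rep_ex n g; have [S Sh] := rep_ex n h.
exists ((P + Q) * S); first by apply: rep_mul => //; exact: rep_add.
by rewrite mulrDl; apply: rep_add; exact: rep_mul.
Qed.

Let one_neq0 : fps2C 1 != 0.
Proof.
apply/eqP => /(congr1 (fun f : {fps2 R} => f 0 0)%N) /eqP.
by rewrite /= oner_eq0.
Qed.

HB.instance Definition _ :=
  GRing.Zmodule_isComNzRing.Build {fps2 R} mulA mulC mul1 mulDl one_neq0.

Let unit : pred {fps2 R} := fun f => `[< exists g, g * f = 1 >].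
Let inv f := if pselect (exists g, g * f = 1) is left h then sval (cid h)
  else f.

Let mulV : {in unit, left_inverse 1 inv *%R}.
Proof.
move=> f /asboolP fu; rewrite /inv; case: pselect => // h.
exact: svalP (cid h).
Qed.
Let unitP f g : g * f = 1 -> unit f.
Proof. by move=> gf; apply/asboolP; exists g. Qed.
Let inv_out : {in [predC unit], inv =1 id}.
Proof. by move=> f; rewrite inE /inv => /asboolPn; case: pselect. Qed.

HB.instance Definition _ :=
  GRing.ComNzRing_hasMulInverse.Build {fps2 R} mulV unitP inv_out.

Let scaleA c d f : fps2_scale c (fps2_scale d f) = fps2_scale (c * d) f.
Proof. by apply: fps2P => a b /=; rewrite mulrA. Qed.
Let scale1 : left_id 1 fps2_scale.
Proof. by move=> f; apply: fps2P => a b /=; rewrite mul1r. Qed.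
Let scaleDr : right_distributive fps2_scale +%R.
Proof. by move=> c f g; apply: fps2P => a b /=; rewrite mulrDr. Qed.
Let scaleDl f : {morph fps2_scale^~ f : c d / c + d}.
Proof. by move=> c d; apply: fps2P => a b /=; rewrite mulrDl. Qed.
HB.instance Definition _ :=
  GRing.Zmodule_isLmodule.Build R {fps2 R} scaleA scale1 scaleDr scaleDl.

Let scaleAl (c : R) f g : c *: (f * g) = (c *: f) * g.
Proof.
apply: fps2P => a b /=; rewrite mulr_sumr; apply: eq_bigr => i _.
by rewrite mulr_sumr; apply: eq_bigr => j _; rewrite mulrA.
Qed.
HB.instance Definition _ := GRing.Lmodule_isLalgebra.Build R {fps2 R} scaleAl.
HB.instance Definition _ := GRing.Lalgebra_isComAlgebra.Build R {fps2 R}.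

Definition fps2_dx f : {fps2 R} := Fps2 (fun a b => f a.+1 b *+ a.+1).
Definition fps2_dy f : {fps2 R} := Fps2 (fun a b => f a b.+1 *+ b.+1).

End Fps2Ring.

Section Weight.
Variable K : fieldType.
Implicit Types (f : {fps2 K}) (n m d : nat).

(* The infimum over the empty set (f = 0, where the order is +oo) is
   given the junk value 0. *)
Definition ord_w n m f : nat :=
  if pselect (exists d, `[< exists a b : nat,
      (a * n + b * m)%N = d /\ f a b != 0 >]) is left h then ex_minn h else 0%N.

(* As n and m are positive, a monomial of weight d has both exponents at
   most d. *)
Definition in_w n m f : {mpoly K[2]} :=
  let d := ord_w n m f in
  \sum_(a < d.+1) \sum_(b < d.+1 | (a * n + b * m)%N == d)
    f a b *: ('X_0 ^+ a * 'X_1 ^+ b).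

Definition semi_quasihomogeneous n m f : Prop :=
  forall v : 'I_2 -> K,
    (((in_w n m f)^`M(0)).@[v] = 0 /\ ((in_w n m f)^`M(1)).@[v] = 0)
    <-> (v 0 = 0 /\ v 1 = 0).

Record plane_curve_singularity := PlaneCurveSingularity {
  pcs_val :> {fps2 K};
  pcs_neq0 : pcs_val != 0;
  pcs_ord : (1 < ord_w 1 1 pcs_val)%N }.

End Weight.

Section TotalFractions.
Variable R : comNzRingType.

Definition regular (b : R) : bool := `[< GRing.lreg b >].

Lemma regular1 : regular 1.
Proof. by apply/asboolP; exact: lreg1. Qed.
Lemma regularM a b : regular a -> regular b -> regular (a * b).
Proof. by move=> /asboolP ha /asboolP hb; apply/asboolP; exact: lregM. Qed.

Record prefraction := Prefraction { prefrac :> R * R; _ : regular prefrac.2 }.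
HB.instance Definition _ := [isSub for prefrac].
HB.instance Definition _ := [Choice of prefraction by <:].
Implicit Types x y z : prefraction.

Lemma prefracP x : regular x.2. Proof. by case: x. Qed.

Definition fequiv x y := x.1 * y.2 == y.1 * x.2.

Lemma fequiv_refl : reflexive fequiv.
Proof. by move=> x; rewrite /fequiv. Qed.
Lemma fequiv_sym : ssrbool.symmetric fequiv.
Proof. by move=> x y; rewrite /fequiv eq_sym. Qed.
Lemma fequiv_trans : transitive fequiv.
Proof.
move=> y x z; rewrite /fequiv => /eqP xy /eqP yz; apply/eqP.
have /asboolP ry := prefracP y; apply: ry.
rewrite mulrCA [y.2 * _]mulrC mulrA xy mulrAC yz.
by rewrite mulrAC mulrC.
Qed.

Canonical fequiv_equiv := EquivRel fequiv fequiv_refl fequiv_sym fequiv_trans.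

Definition total_fraction := {eq_quot fequiv}.
HB.instance Definition _ : EqQuotient _ fequiv total_fraction :=
  EqQuotient.on total_fraction.
HB.instance Definition _ := Choice.on total_fraction.

Lemma fracP x y :
  reflect (x.1 * y.2 = y.1 * x.2) (x == y %[mod total_fraction]).
Proof. by rewrite eqmodE; exact: eqP. Qed.

Lemma frac_repr x : x.1 * (repr (\pi_total_fraction x)).2 =
  (repr (\pi_total_fraction x)).1 * x.2.
Proof. by apply/fracP; rewrite reprK. Qed.

Definition Prefrac a b (rb : regular b) := @Prefraction (a, b) rb.
Definition prefracC a := Prefrac a regular1.
Definition tofraction := lift_embed total_fraction prefracC.
Canonical tofraction_pi_morph := PiEmbed tofraction.

Definition prefrac_add x y :=
  Prefrac (x.1 * y.2 + y.1 * x.2) (regularM (prefracP x) (prefracP y)).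
Definition prefrac_opp x := Prefrac (- x.1) (prefracP x).
Definition prefrac_mul x y :=
  Prefrac (x.1 * y.1) (regularM (prefracP x) (prefracP y)).

Definition fraction_add := lift_op2 total_fraction prefrac_add.
Definition fraction_opp := lift_op1 total_fraction prefrac_opp.
Definition fraction_mul := lift_op2 total_fraction prefrac_mul.

Lemma pi_fraction_add :
  {morph \pi : x y / prefrac_add x y >-> fraction_add x y}.
Proof.
move=> x y; unlock fraction_add; apply/eqmodP/eqP => /=.
have ex := frac_repr x; have ey := frac_repr y.
set x' := repr (\pi x) in ex *; set y' := repr (\pi y) in ey *.
transitivity ((x.1 * x'.2) * (y.2 * y'.2) + (y.1 * y'.2) * (x.2 * x'.2)).
  by ring.
by rewrite ex ey; ring.
Qed.
Canonical pi_fraction_add_morph := PiMorph2 pi_fraction_add.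

Lemma pi_fraction_opp : {morph \pi : x / prefrac_opp x >-> fraction_opp x}.
Proof.
move=> x; unlock fraction_opp; apply/eqmodP/eqP => /=.
by rewrite !mulNr frac_repr.
Qed.
Canonical pi_fraction_opp_morph := PiMorph1 pi_fraction_opp.

Lemma pi_fraction_mul :
  {morph \pi : x y / prefrac_mul x y >-> fraction_mul x y}.
Proof.
move=> x y; unlock fraction_mul; apply/eqmodP/eqP => /=.
by rewrite mulrACA !frac_repr mulrACA.
Qed.
Canonical pi_fraction_mul_morph := PiMorph2 pi_fraction_mul.

Let addA : associative fraction_add.
Proof.
elim/quotW=> x; elim/quotW=> y; elim/quotW=> z; rewrite !piE.
by apply/eqmodP/eqP => /=; ring.
Qed.
Let addC : commutative fraction_add.
Proof.
elim/quotW=> x; elim/quotW=> y; rewrite !piE.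
by apply/eqmodP/eqP => /=; ring.
Qed.
Let add0 : left_id (tofraction 0) fraction_add.
Proof.
by elim/quotW=> x; rewrite !piE; apply/eqmodP/eqP => /=; ring.
Qed.
Let addN : left_inverse (tofraction 0) fraction_opp fraction_add.
Proof.
by elim/quotW=> x; rewrite !piE; apply/eqmodP/eqP => /=; ring.
Qed.
HB.instance Definition _ :=
  GRing.isZmodule.Build total_fraction addA addC add0 addN.

Let mulA : associative fraction_mul.
Proof.
elim/quotW=> x; elim/quotW=> y; elim/quotW=> z; rewrite !piE.
by apply/eqmodP/eqP => /=; ring.
Qed.
Let mulC : commutative fraction_mul.
Proof.
elim/quotW=> x; elim/quotW=> y; rewrite !piE.
by apply/eqmodP/eqP => /=; ring.
Qed.
Let mul1 : left_id (tofraction 1) fraction_mul.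
Proof.
by elim/quotW=> x; rewrite !piE; apply/eqmodP/eqP => /=; ring.
Qed.
Let mulDl : left_distributive fraction_mul fraction_add.
Proof.
elim/quotW=> x; elim/quotW=> y; elim/quotW=> z; rewrite !piE.
by apply/eqmodP/eqP => /=; ring.
Qed.
Let one_neq0 : tofraction 1 != tofraction 0.
Proof.
by rewrite !piE /= /fequiv /= !mulr1 oner_eq0.
Qed.
HB.instance Definition _ := GRing.Zmodule_isComNzRing.Build total_fraction
  mulA mulC mul1 mulDl one_neq0.

Let tofraction_is_zmod_morphism : zmod_morphism tofraction.
Proof.
move=> a b; rewrite [LHS]piE /=; apply/esym.
transitivity (fraction_add (tofraction a) (fraction_opp (tofraction b))) => //.
by rewrite !piE; apply/eqmodP/eqP => /=; ring.
Qed.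
HB.instance Definition _ := GRing.isZmodMorphism.Build R total_fraction
  tofraction tofraction_is_zmod_morphism.

Let tofraction_is_monoid_morphism : monoid_morphism tofraction.
Proof.
split=> // a b; apply/esym.
transitivity (fraction_mul (tofraction a) (tofraction b)) => //.
by rewrite !piE; apply/eqmodP/eqP => /=; ring.
Qed.
HB.instance Definition _ := GRing.isMonoidMorphism.Build R total_fraction
  tofraction tofraction_is_monoid_morphism.

End TotalFractions.

Section AlgTotalFractions.
Variables (K : comNzRingType) (R : comAlgType K).
Local Notation Q := (total_fraction R).

Definition fraction_scale (c : K) (z : Q) : Q := tofraction c%:A * z.

Let scaleA c d z :
  fraction_scale c (fraction_scale d z) = fraction_scale (c * d) z.
Proof.
by rewrite /fraction_scale mulrA -rmorphM -scalerAl mul1r scalerA.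
Qed.
Let scale1 : left_id 1 fraction_scale.
Proof. by move=> z; rewrite /fraction_scale scale1r rmorph1 mul1r. Qed.
Let scaleDr : right_distributive fraction_scale +%R.
Proof. by move=> c z t; rewrite /fraction_scale mulrDr. Qed.
Let scaleDl z : {morph fraction_scale^~ z : c d / c + d}.
Proof. by move=> c d; rewrite /fraction_scale scalerDl rmorphD mulrDl. Qed.
HB.instance Definition _ :=
  GRing.Zmodule_isLmodule.Build K Q scaleA scale1 scaleDr scaleDl.

Let scaleAl (c : K) (z t : Q) : c *: (z * t) = (c *: z) * t.
Proof. by rewrite /GRing.scale /= /fraction_scale mulrA. Qed.
HB.instance Definition _ := GRing.Lmodule_isLalgebra.Build K Q scaleAl.
HB.instance Definition _ := GRing.Lalgebra_isComAlgebra.Build K Q.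

End AlgTotalFractions.

Section LocalRing.
Variables (K : fieldType) (f : plane_curve_singularity K).
Local Notation P := {fps2 K}.

Definition principal_ideal : pred P := fun g => `[< exists h : P, g = h * f >].

Lemma pcs_coef00 : f 0%N 0%N = 0.
Proof.
apply/eqP/negPn/negP => f00; have := pcs_ord f; rewrite /ord_w.
case: pselect => // h; case: ex_minnP => d _ /(_ 0%N) le_d.
by rewrite ltnNge (leq_trans (le_d _)) //; apply/asboolP; exists 0%N, 0%N.
Qed.

Let principal_idealP : idealr_closed principal_ideal.
Proof.
split.
- by apply/asboolP; exists 0; rewrite mul0r.
- apply/asboolPn => -[h /(congr1 (fun g : P => g 0 0)%N)] /eqP /=.
  by rewrite !big_ord1 pcs_coef00 mulr0 oner_eq0.
- move=> a g h /asboolP[g' ->] /asboolP[h' ->]; apply/asboolP.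
  by exists (a * g' + h'); rewrite mulrDl mulrA.
Qed.
HB.instance Definition _ := isIdealr.Build P principal_ideal principal_idealP.

Definition principal_idealr : idealr P := Idealr.clone P principal_ideal _.
Definition local_ring := {ideal_quot principal_idealr}.
HB.instance Definition _ := GRing.ComNzRing.on local_ring.

Definition tolocal : P -> local_ring := \pi_local_ring.
HB.instance Definition _ := GRing.RMorphism.on tolocal.

Definition local_scale (c : K) (u : local_ring) : local_ring :=
  tolocal c%:A * u.

Let scaleA c d z : local_scale c (local_scale d z) = local_scale (c * d) z.
Proof. by rewrite /local_scale mulrA -rmorphM -scalerAl mul1r scalerA. Qed.
Let scale1 : left_id 1 local_scale.
Proof. by move=> z; rewrite /local_scale scale1r rmorph1 mul1r. Qed.
Let scaleDr : right_distributive local_scale +%R.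
Proof. by move=> c z t; rewrite /local_scale mulrDr. Qed.
Let scaleDl z : {morph local_scale^~ z : c d / c + d}.
Proof. by move=> c d; rewrite /local_scale scalerDl rmorphD mulrDl. Qed.
HB.instance Definition _ :=
  GRing.Zmodule_isLmodule.Build K local_ring scaleA scale1 scaleDr scaleDl.
Let scaleAl (c : K) (z t : local_ring) : c *: (z * t) = (c *: z) * t.
Proof. by rewrite /GRing.scale /= /local_scale mulrA. Qed.
HB.instance Definition _ := GRing.Lmodule_isLalgebra.Build K local_ring scaleAl.
HB.instance Definition _ := GRing.Lalgebra_isComAlgebra.Build K local_ring.

End LocalRing.

(* [quotient_dim U W n] : for subspaces W of U of V, the quotient U / W has
   dimension n, i.e. the classes of some b_0, ..., b_(n-1) in U form a basis. *)
Definition quotient_dim (K : fieldType) (V : lmodType K) (U W : V -> Prop)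
    (n : nat) : Prop :=
  exists2 b : 'I_n -> V, (forall i, U (b i)) &
    forall v, U v -> exists! c : 'rV[K]_n, W (v - \sum_i c 0 i *: b i).

Section Invariants.
Variable K : fieldType.
Implicit Types (g h : {fps2 K}) (f : plane_curve_singularity K).

Definition jacobian_ideal g : {fps2 K} -> Prop :=
  fun h => exists u v, h = u * fps2_dx g + v * fps2_dy g.

Definition milnor_number g : nat -> Prop :=
  quotient_dim (fun=> True) (jacobian_ideal g).

Definition irreducible_fps2 g : Prop :=
  [/\ g != 0, g \isn't a GRing.unit &
    forall u v, g = u * v -> u \is a GRing.unit \/ v \is a GRing.unit].

Definition reduced g : Prop :=
  g != 0 /\ forall q u, irreducible_fps2 q -> g <> q ^+ 2 * u.

(* Counted with multiplicity; for a reduced g the q i are pairwise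
   non-associated. *)
Definition nb_irreducible_factors g (r : nat) : Prop :=
  exists (u : {fps2 K}) (q : 'I_r -> {fps2 K}),
    [/\ u \is a GRing.unit, forall i, irreducible_fps2 (q i) &
        g = u * \prod_i q i].

Definition total_quotient_ring f : comAlgType K :=
  GRing.ComAlgebra.clone K
    (total_fraction (GRing.ComNzRing.clone (local_ring f) _)) _.

Definition to_total f : local_ring f -> total_quotient_ring f := @tofraction _.
HB.instance Definition _ f := GRing.RMorphism.on (@to_total f).

Definition integral_closure f : total_quotient_ring f -> Prop :=
  integralOver (@to_total f).

Definition delta_invariant f : nat -> Prop :=
  quotient_dim (@integral_closure f) (fun z => exists a, z = to_total a).

(* The equation forces mu(f) and delta(f) to be finite; it is written in [int]
   to avoid truncated subtraction. *)
Definition tame f : Prop :=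
  reduced f /\
  exists mu delta r : nat,
    [/\ milnor_number f mu, delta_invariant f delta,
        nb_irreducible_factors f r & mu%:Z = 2 * delta%:Z - r%:Z + 1].

End Invariants.

(* Main.v *)
Require Import Defs.
From HB Require Import structures.
From mathcomp Require Import all_boot all_algebra.
From mathcomp Require Import boolp mpoly zify ring.

Set Implicit Arguments.
Unset Strict Implicit.
Unset Printing Implicit Defensive.

Import GRing.Theory.
Local Open Scope ring_scope.

(** Dividing by a common factor, the weights n, m may be taken coprime; let d be
    the weight of the initial form of f. Both sides of Milnor's formula are
    computed in terms of n, m, d and of the number r of branches:

      mu n m = (d - n) (d - m),    2 delta n m = (d - n) (d - m) + (r - 1) n m.

    The hypothesis enters through two consequences. The forms of weights d - n
    and d - m of the two partial derivatives meet only at the origin; and the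
    curve cut out by the initial form of f is smooth away from the origin
    ([smooth]).

    The first formula is a weighted Bezout theorem ([bezout]). For quasihomogeneous
    forms, the dimension of the quotient by two of them is additive in each form
    ([has_graded_ci_mul]), and over an algebraically closed field a form splits
    into factors x, y and x^m - c y^n, for which the quotient has a basis of
    monomials. The passage from initial forms to power series works because
    the forms have only Koszul syzygies ([transfer_free]).

    For the second formula the branches are split off one at a time ([peel]), by
    induction on d. A zero (a, b) of the initial form other than the origin is a
    simple one, so Newton's method deforms the curve (a t^n, b t^m) into a
    parametrisation phi with phi(f) = 0, in any characteristic ([newton]). Its
    kernel is generated by a series q with initial form x^m - c y^n, and the
    orders of phi(h) form the semigroup generated by n and m, which has
    (n - 1) (m - 1) / 2 gaps ([branch_weighted]). If a or b vanishes, other weights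
    bring the situation back to this one ([peels_yaxis]). Hence f = q g, where g is
    again smooth in the above sense, and phi(g) has order e, the weight of g (divided
    by m or by n in the exceptional cases). The map with components the
    parametrisations of all branches sends K[[x,y]]/(f) into K[[t]]^r
    ([normalization]); adding the branch q increases the codimension of the image
    by e plus the number of gaps ([new_factor_codim]).

    Finally K[[t]]^r is identified with the integral closure. Elements of the total
    quotient ring and of K((t))^r are compared through [expansion]; the integral ones
    correspond to K[[t]]^r because K[[t]] is integrally closed on the one hand, and
    because the image of K[[x,y]] contains all tuples of large order on the other.
    The injectivity of the map also shows that f is reduced. *)

(** * Successive approximation *)

(** [F e] stands for the elements of order at least [e]. *)
Definition complete_filtration (U : zmodType) (F : nat -> U -> Prop) :=
  forall u : nat -> U, (forall e, F e (u e.+1 - u e)) ->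
  exists s, forall e, F e (s - u e).

Lemma complete_limit (U : zmodType) (F : nat -> U -> Prop)
    (Good : nat -> U -> Prop) (u0 : U) :
    complete_filtration F -> Good 0%N u0 ->
    (forall e (u : U), Good e u -> exists2 u', F e (u' - u) & Good e.+1 u') ->
  exists2 s, F 0%N (s - u0) & forall e, exists2 u : U, Good e u & F e (s - u).
Proof.
move=> cF G0 step.
have next e (u : {u : U | Good e u}) :
    {u' : {u' : U | Good e.+1 u'} | F e (sval u' - sval u)}.
  by case: u => u gu; have [u' h1 h2] := cid2 (step e u gu); exists (exist _ u' h2).
pose v := fix v e : {u : U | Good e u} :=
  if e is e'.+1 then sval (next e' (v e')) else exist _ u0 G0.
have [e|s hs] := cF (fun e => sval (v e)); first exact: svalP (next e (v e)).
by exists s => [|e]; [exact: hs 0%N | exists (sval (v e)); first exact: svalP].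
Qed.

(** The corrections found order by order add up to a preimage. [Z] is an invariant
    of the remainders, such as lying in the kernel of a ring morphism. *)
Lemma filtered_surj (U V : zmodType) (FU : nat -> U -> Prop)
    (FV : nat -> V -> Prop) (Z : V -> Prop) (T : U -> V) :
    zmod_morphism T -> complete_filtration FU ->
    (forall e (u : U), FU e u -> FV e (T u)) ->
    (forall e v w, FV e v -> FV e w -> FV e (v - w)) ->
    (forall v, (forall e, FV e v) -> v = 0) ->
    (forall e v, FV e v -> Z v ->
      exists u : U, [/\ FU e u, FV e.+1 (v - T u) & Z (v - T u)]) ->
  forall v, FV 0%N v -> Z v -> exists2 u : U, FU 0%N u & T u = v.
Proof.
move=> TB cU TF FB sep step v v0 Zv.
have T0 : T 0 = 0 by rewrite -[0 in LHS](subrr 0) TB subrr.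
have TD u u' : T (u + u') = T u + T u'.
  by rewrite -{1}[u']opprK TB -[- u']add0r TB T0 add0r opprK.
have [||s] := complete_limit (Good := fun e u => FV e (v - T u) /\ Z (v - T u))
    (u0 := 0) cU.
- by rewrite T0 subr0.
- move=> e u [ve Ze]; have [u' [h1 h2 h3]] := step _ _ ve Ze.
  by exists (u + u'); rewrite ?[u + u' - u]addrAC ?subrr ?add0r // TD opprD addrA.
rewrite subr0 => s0 hs; exists s => //; apply/eqP; rewrite -subr_eq0; apply/eqP.
apply: sep => e; have [u [hu _] su] := hs e.
have -> : T s - v = T (s - u) - (v - T u).
  by rewrite TB opprB addrA subrK.
by apply: FB => //; apply: TF.
Qed.

(** * Power series in two variables *)

Section Basics.
Variable K : fieldType.
Local Notation P := {fps2 K}.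
Implicit Types f g h u : P.

Lemma sum2_only (A B a b : nat) (F : nat -> nat -> K) :
    (a < A)%N -> (b < B)%N ->
    (forall i j, (i < A)%N -> (j < B)%N -> (i, j) != (a, b) -> F i j = 0) ->
  \sum_(i < A) \sum_(j < B) F i j = F a b.
Proof.
move=> aA bB F0; rewrite (bigD1 (Ordinal aA)) //= (bigD1 (Ordinal bB)) //=.
rewrite big1 ?addr0 => [|j nj]; last first.
  by apply: F0 => //; apply: contraNneq nj => -[jb]; apply/eqP/val_inj.
rewrite big1 ?addr0 // => i ni; rewrite big1 // => j _.
by apply: F0 => //; apply: contraNneq ni => -[ia _]; apply/eqP/val_inj.
Qed.

Lemma fps2ME f g a b : (f * g) a b =
  \sum_(i < a.+1) \sum_(j < b.+1) f i j * g (a - i)%N (b - j)%N.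
Proof. by []. Qed.

Lemma fps2DE f g a b : (f + g) a b = f a b + g a b. Proof. by []. Qed.
Lemma fps2NE f a b : (- f) a b = - f a b. Proof. by []. Qed.
Lemma fps2BE f g a b : (f - g) a b = f a b - g a b. Proof. by []. Qed.
Lemma fps2ZE c f a b : (c *: f) a b = c * f a b. Proof. by []. Qed.
Lemma fps20E a b : (0 : P) a b = 0. Proof. by rewrite /=; case: ifP. Qed.
Lemma fps21E a b : (1 : P) a b = ((a == 0%N) && (b == 0%N))%:R.
Proof. by rewrite /=; case: ifP. Qed.

Lemma fps2_sumE (I : Type) (r : seq I) (Q : pred I) (F : I -> P) a b :
  (\sum_(i <- r | Q i) F i) a b = \sum_(i <- r | Q i) F i a b.
Proof. by elim/big_rec2: _ => [|i y x _ <-]; rewrite ?fps20E ?fps2DE. Qed.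

Definition mono i j : P := Fps2 (fun a b => ((a == i) && (b == j))%:R).

Lemma monoE i j a b : mono i j a b = ((a == i) && (b == j))%:R.
Proof. by []. Qed.

Lemma mono00 : mono 0 0 = 1.
Proof. by apply: fps2P => a b; rewrite fps21E. Qed.

Lemma mono_mulE i j f a b : (mono i j * f) a b =
  if (i <= a)%N && (j <= b)%N then f (a - i)%N (b - j)%N else 0.
Proof.
rewrite fps2ME; case: ifP => [/andP[ia jb]|nij].
  etransitivity; first apply: (sum2_only (a := i) (b := j)
    (F := fun k l => mono i j k l * f (a - k)%N (b - l)%N)) => //; last first.
    by rewrite monoE !eqxx mul1r.
  move=> k l _ _ nkl; rewrite monoE; case: andP => [[/eqP ki /eqP lj]|_].
    by rewrite ki lj eqxx in nkl.
  by rewrite mul0r.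
rewrite big1 // => k _; rewrite big1 // => l _; rewrite monoE.
case: andP => [[/eqP ki /eqP lj]|_]; last by rewrite mul0r.
by move: nij (ltn_ord k) (ltn_ord l); rewrite ki lj !ltnS => /negbT /nandP[]
  /negPf->.
Qed.

Lemma mono_mul i j k l : mono i j * mono k l = mono (i + k)%N (j + l)%N.
Proof.
apply: fps2P => a b; rewrite mono_mulE !monoE; case: ifP; last first.
  by move=> h; case: andP => // -[/eqP ha /eqP hb]; move: h; rewrite ha hb !leq_addr.
by move=> /andP[ia jb]; congr ((_ && _)%:R); lia.
Qed.

Lemma fps2_neq0P f : f != 0 -> exists i j, f i j != 0.
Proof.
move=> f0; apply: contrapT => nf; case/eqP: f0; apply: fps2P => a b.
by rewrite fps20E; apply/eqP/negPn/negP => fab; apply: nf; exists a, b.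
Qed.

(** The lexicographically least monomial; such monomials multiply, so that
    K[[x,y]] is a domain. *)
Lemma fps2_lexlead f : f != 0 -> exists a b, f a b != 0 /\
  forall i j, (i < a)%N || (i == a) && (j < b)%N -> f i j = 0.
Proof.
move=> /fps2_neq0P[i0 [j0 fij]].
have ex : exists a, `[< exists b, f a b != 0 >].
  by exists i0; apply/asboolP; exists j0.
case: (ex_minnP ex) => a /asboolP exb amin.
case: (ex_minnP exb) => b fab bmin; exists a, b; split=> // i j.
case/orP=> [ia|/andP[/eqP-> jb]]; apply/eqP/negPn/negP => fij'.
  have /amin : `[< exists b, f i b != 0 >] by apply/asboolP; exists j.
  by rewrite leqNgt ia.
by have /bmin := fij'; rewrite leqNgt jb.
Qed.

Let fps2_idomain : GRing.integral_domain_axiom P.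
Proof.
move=> f g fg0; apply/negPn; rewrite negb_or; apply/negP.
case/andP=> /fps2_lexlead[a [b [fab fl]]] /fps2_lexlead[c [d [gcd gl]]].
have /eqP := congr1 (fun h : P => h (a + c)%N (b + d)%N) fg0.
rewrite fps20E fps2ME.
suff -> : \sum_(k < (a + c).+1) \sum_(l < (b + d).+1)
    f k l * g (a + c - k)%N (b + d - l)%N = f a b * g c d.
  by rewrite mulf_eq0 (negPf fab) (negPf gcd).
have -> : f a b * g c d = f a b * g (a + c - a)%N (b + d - b)%N.
  by rewrite !addKn.
apply: (sum2_only (F := fun k l => f k l * g (a + c - k)%N (b + d - l)%N));
  try by rewrite ltnS leq_addr.
move=> i j hi hj nij.
have [h|h] := boolP ((i < a)%N || (i == a) && (j < b)%N).
  by rewrite fl ?mul0r.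
rewrite gl ?mulr0 //; move: nij h; rewrite xpair_eqE; lia.
Qed.

HB.instance Definition _ := GRing.ComUnitRing_isIntegral.Build P fps2_idomain.

(** * Weights *)
Section Weights.
Variables n m : nat.

Definition wge d f := forall i j, (i * n + j * m < d)%N -> f i j = 0.
(** The weight of a monomial is raised by [w], instead of lowering [d], as [d - w]
    would be truncated. These are the orders and components of the cofactor of
    a form of weight [w]. *)
Definition swge w d f := forall i j, (i * n + j * m + w < d)%N -> f i j = 0.
Definition wcomp d f : P :=
  Fps2 (fun i j => if (i * n + j * m == d)%N then f i j else 0).
Definition swcomp w d f : P :=
  Fps2 (fun i j => if (i * n + j * m + w == d)%N then f i j else 0).
Definition isobaric d f := forall i j, (i * n + j * m)%N != d -> f i j = 0.

Lemma wge_le d e f : (d <= e)%N -> wge e f -> wge d f.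
Proof. by move=> de fe i j ij; apply: fe; apply: leq_trans ij de. Qed.

Lemma wge0 f : wge 0 f. Proof. by []. Qed.

Lemma wgeD d f g : wge d f -> wge d g -> wge d (f + g).
Proof. by move=> hf hg i j ij; rewrite fps2DE hf ?hg ?addr0. Qed.

Lemma wgeB d f g : wge d f -> wge d g -> wge d (f - g).
Proof. by move=> hf hg i j ij; rewrite fps2BE hf ?hg ?subr0. Qed.

Lemma wgeZ d c f : wge d f -> wge d (c *: f).
Proof. by move=> hf i j ij; rewrite fps2ZE hf ?mulr0. Qed.

Lemma wge_mono i j : wge (i * n + j * m)%N (mono i j).
Proof.
move=> a b; rewrite monoE; case: andP => // -[/eqP-> /eqP->].
by rewrite ltnn.
Qed.

Lemma swgeM w' w d u q :
  swge (w' + w)%N d u -> wge w q -> swge w' d (u * q).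
Proof.
move=> hu hq a b ab; rewrite fps2ME big1 // => i _; rewrite big1 // => j _.
case: (ltnP (i * n + j * m + (w' + w)) d) => [/hu->|h]; first by rewrite mul0r.
rewrite hq ?mulr0 //; move: (ltn_ord i) (ltn_ord j); nia.
Qed.

Lemma swge0 d f : swge 0 d f <-> wge d f.
Proof. by split=> h i j; have := h i j; rewrite addn0. Qed.

Lemma wgeM_sw w d u q : swge w d u -> wge w q -> wge d (u * q).
Proof. by move=> hu hq; apply/swge0; apply: swgeM hq. Qed.

Lemma wgeM d e f g : wge d f -> wge e g -> wge (d + e)%N (f * g).
Proof.
move=> hf; apply: wgeM_sw => i j; rewrite ltn_add2r; exact: hf.
Qed.

Lemma wge_sep f : (0 < n)%N -> (0 < m)%N -> (forall d, wge d f) -> f = 0.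
Proof.
move=> n0 m0 hf; apply: fps2P => a b.
by rewrite fps20E; apply: (hf (a * n + b * m).+1).
Qed.

Lemma wcompE d f i j : wcomp d f i j =
  if (i * n + j * m == d)%N then f i j else 0. Proof. by []. Qed.

Lemma isobaric_wcomp d f : isobaric d (wcomp d f).
Proof. by move=> i j ij; rewrite wcompE (negPf ij). Qed.

Lemma wcomp_isobaric d f : isobaric d f -> wcomp d f = f.
Proof.
by move=> hf; apply: fps2P => i j; rewrite wcompE; case: eqP => // /eqP /hf.
Qed.

Lemma isobaric_wge d f : isobaric d f -> wge d f.
Proof. by move=> hf i j ij; apply: hf; rewrite neq_ltn ij. Qed.

Lemma wge_wcomp d f : wge d (wcomp d f).
Proof. exact/isobaric_wge/isobaric_wcomp. Qed.

Lemma wge_subcomp d f : wge d f -> wge d.+1 (f - wcomp d f).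
Proof.
move=> hf i j; rewrite ltnS leq_eqVlt fps2BE wcompE => /orP[/eqP->|ij].
  by rewrite eqxx subrr.
by rewrite hf // ltn_eqF // subrr.
Qed.

Lemma wge_comp0 d f : wge d f -> wcomp d f = 0 -> wge d.+1 f.
Proof. by move=> /wge_subcomp + f0; rewrite f0 subr0. Qed.

Lemma wcompD d f g : wcomp d (f + g) = wcomp d f + wcomp d g.
Proof.
by apply: fps2P => i j; rewrite fps2DE !wcompE; case: ifP; rewrite ?addr0.
Qed.
Lemma wcompB d f g : wcomp d (f - g) = wcomp d f - wcomp d g.
Proof.
by apply: fps2P => i j; rewrite fps2BE !wcompE; case: ifP; rewrite ?subr0.
Qed.
Lemma wcompZ d c f : wcomp d (c *: f) = c *: wcomp d f.
Proof.
by apply: fps2P => i j; rewrite fps2ZE !wcompE; case: ifP; rewrite ?mulr0.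
Qed.

Lemma wcomp_wge0 d f : wge d.+1 f -> wcomp d f = 0.
Proof.
move=> hf; apply: fps2P => i j; rewrite wcompE fps20E; case: eqP => // e.
by apply: hf; rewrite e.
Qed.

Lemma wcompM_sw w d u q : swge w d u -> wge w q ->
  wcomp d (u * q) = swcomp w d u * wcomp w q.
Proof.
move=> hu hq; apply: fps2P => a b; rewrite wcompE !fps2ME /=.
case: eqP => [ab|nab].
  apply: eq_bigr => i _; apply: eq_bigr => j _.
  case: eqP => ij; case: eqP => ij' //.
  - move: (ltn_ord i) (ltn_ord j); nia.
  - move: (ltn_ord i) (ltn_ord j); nia.
  case: (ltnP (i * n + j * m + w) d) => h; first by rewrite hu // !mul0r.
  rewrite hq ?mul0r ?mulr0 //; move: (ltn_ord i) (ltn_ord j); nia.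
apply/esym; rewrite big1 // => i _; rewrite big1 // => j _.
case: eqP => ij; case: eqP => ij'; rewrite ?mul0r ?mulr0 //.
move: (ltn_ord i) (ltn_ord j); nia.
Qed.

Lemma swge_wge w d f : wge d f -> swge w (w + d)%N f.
Proof. by move=> hf i j ij; apply: hf; lia. Qed.

Lemma swcomp_wcomp w d f : swcomp w (w + d)%N f = wcomp d f.
Proof. by apply: fps2P => i j /=; rewrite [(_ + w)%N]addnC eqn_add2l. Qed.

Lemma wcompM d e f g : wge d f -> wge e g ->
  wcomp (d + e)%N (f * g) = wcomp d f * wcomp e g.
Proof.
move=> hf hg; rewrite addnC (wcompM_sw (w := e)) ?swcomp_wcomp //.
exact: swge_wge.
Qed.

Lemma swcomp0 d f : swcomp 0 d f = wcomp d f.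
Proof. by apply: fps2P => i j /=; rewrite addn0. Qed.

Lemma swcompM_isobaric w' w d u q : isobaric w q ->
  swcomp w' d (u * q) = swcomp (w' + w)%N d u * q.
Proof.
move=> hq; apply: fps2P => a b; rewrite [LHS]/= -!fps2ME !fps2ME /=.
case: eqP => [ab|nab].
  apply: eq_bigr => i _; apply: eq_bigr => j _.
  case: eqP => // ij; rewrite hq ?mulr0 ?mul0r //.
  move: (ltn_ord i) (ltn_ord j); nia.
apply/esym; rewrite big1 // => i _; rewrite big1 // => j _.
case: eqP => ij; rewrite ?mul0r // hq ?mulr0 //.
move: (ltn_ord i) (ltn_ord j); nia.
Qed.

Lemma wcompM_isobaric w d u q : isobaric w q -> wcomp d (u * q) = swcomp w d u * q.
Proof. by move=> hq; rewrite -swcomp0 (swcompM_isobaric _ _ _ hq). Qed.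

Lemma isobaricM d e f g : isobaric d f -> isobaric e g -> isobaric (d + e)%N (f * g).
Proof.
move=> hf hg i j ij; rewrite -(wcomp_isobaric hf) -(wcomp_isobaric hg).
by rewrite -wcompM ?wcompE ?(negPf ij) //; apply: isobaric_wge.
Qed.

(** The product of two nonzero initial forms does not vanish. *)
Lemma wge_cancel w d q f :
  wge w q -> wcomp w q != 0 -> wge (w + d)%N (q * f) -> wge d f.
Proof.
move=> hq q0 hqf; elim: d hqf => [//|d IHd] hqf.
have fd : wge d f by apply: IHd; apply: wge_le hqf; rewrite addnS.
apply: wge_comp0 => //; apply/eqP; move: q0; apply: contraR => f0.
have : wcomp w q * wcomp d f = 0.
  by rewrite -wcompM // wcomp_wge0 // -addnS.
by move/eqP; rewrite mulf_eq0 (negPf f0) orbF.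
Qed.

End Weights.

(** A coefficient of weight [k] no longer changes after step [k]. *)
Lemma swge_complete n m w : (0 < n)%N -> (0 < m)%N ->
  complete_filtration (swge n m w).
Proof.
move=> n0 m0 u hu.
exists (Fps2 (fun i j => u (i * n + j * m + w).+1 i j)) => e i j ije.
rewrite fps2BE /=.
have stable k : (i * n + j * m + w < k)%N ->
    u k i j = u (i * n + j * m + w).+1 i j.
  elim: k => // k IHk; rewrite ltnS leq_eqVlt => /orP[/eqP->//|hk].
  by rewrite -IHk //; apply/eqP; rewrite -subr_eq0 -fps2BE; apply/eqP/hu.
by rewrite (stable e) // subrr.
Qed.

Lemma wge_complete n m d : (0 < n)%N -> (0 < m)%N ->
  complete_filtration (fun e => wge n m (d + e)%N).
Proof.
move=> n0 m0 u hu.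
exists (Fps2 (fun i j => u (i * n + j * m).+1 i j)) => e i j ije.
rewrite fps2BE /=.
have stable k : (i * n + j * m < d + k)%N ->
    forall l, u (k + l)%N i j = u k i j.
  move=> hk; elim=> [|l IHl]; first by rewrite addn0.
  rewrite -IHl addnS; apply/eqP; rewrite -subr_eq0 -fps2BE; apply/eqP/hu; lia.
case: (leqP e (i * n + j * m).+1) => h.
  by rewrite -(subnKC h) stable // subrr.
rewrite -(subnKC (ltnW h)) stable ?subrr //; lia.
Qed.

Lemma fps2_unit f : f 0%N 0%N != 0 -> f \is a GRing.unit.
Proof.
move=> f00.
have [|||||u _ Tu] := @filtered_surj P P (fun e => wge 1 1 (0 + e)%N)
    (fun e => wge 1 1 (0 + e)%N) (fun=> True) ( *%R f) (mulrBr f) (@wge_complete 1 1 0 isT isT)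
    _ _ _ _ 1 _ I => //.
- by move=> e u hu; apply: (@wgeM 1 1 0).
- by move=> e v w; apply: wgeB.
- by move=> v; apply: (wge_sep (n := 1) (m := 1)).
- move=> e v hv _; exists ((f 0%N 0%N)^-1 *: wcomp 1 1 e v).
  have hw := @wgeZ 1 1 e (f 0%N 0%N)^-1 _ (@wge_wcomp 1 1 e v); split => //.
  apply: (wge_comp0 (d := e)); first by apply: wgeB => //; apply: (@wgeM 1 1 0).
  rewrite wcompB (@wcompM 1 1 0 e) // wcompZ (wcomp_isobaric (@isobaric_wcomp _ _ _ _)).
  have -> : wcomp 1 1 0 f = (f 0%N 0%N) *: 1.
    apply: fps2P => i j; rewrite wcompE fps2ZE fps21E.
    by case: i j => [|i] [|j] //=; rewrite ?mulr1 ?mulr0.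
  by rewrite -scalerAl mul1r scalerA mulfV // scale1r subrr.
by apply/unitrP; exists u; rewrite mulrC.
Qed.

End Basics.

Arguments wge {K} (n m d)%_N f.
Arguments swge {K} (n m w d)%_N f.
Arguments wcomp {K} (n m d)%_N f.
Arguments swcomp {K} (n m w d)%_N f.
Arguments isobaric {K} (n m d)%_N f.
Arguments mono K (i j)%_N.

(** * Power series in one variable *)

Section SeriesDef.
Variable K : fieldType.
Local Notation P := {fps2 K}.

Definition free_of_y : pred P :=
  fun f => `[< forall i j, j != 0%N -> f i j = 0 >].

Lemma free_of_yP (f : P) : reflect (forall i j, j != 0%N -> f i j = 0) (f \in free_of_y).
Proof. exact: asboolP. Qed.

Lemma fps2M_y0 (f g : P) a :
  (f * g) a 0%N = \sum_(i < a.+1) f i 0%N * g (a - i)%N 0%N.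
Proof. by rewrite fps2ME; apply: eq_bigr => i _; rewrite big_ord1. Qed.

Fact free_of_y_subalg : subalg_closed free_of_y.
Proof.
split.
- by apply/free_of_yP => i j /negPf j0; rewrite fps21E j0 andbF.
- move=> c f g /free_of_yP f0 /free_of_yP g0; apply/free_of_yP => i j j0.
  by rewrite fps2DE fps2ZE f0 ?g0 // mulr0 addr0.
move=> f g /free_of_yP f0 /free_of_yP g0; apply/free_of_yP => i j j0.
rewrite fps2ME big1 // => k _; rewrite big1 // => l _.
have [l0|l0] := eqVneq (l : nat) 0%N; last by rewrite f0 ?mul0r.
by rewrite g0 ?mulr0 // l0 subn0.
Qed.
HB.instance Definition _ := GRing.isSubalgClosed.Build K P free_of_y free_of_y_subalg.

(** K[[t]], realised as the subalgebra K[[x]] of K[[x,y]]. *)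
Record series := Series {series_val :> P; _ : series_val \in free_of_y}.
HB.instance Definition _ := [isSub for series_val].
HB.instance Definition _ := [Choice of series by <:].
Definition series_opp (s : series) := Series (rpredNr (valP s)).
Definition series_add (s r : series) := Series (rpredD (valP s) (valP r)).
Definition series_mul (s r : series) := Series (rpredM (valP s) (valP r)).
Definition series_scale c (s : series) := Series (rpredZ c (valP s)).
Let zero_free : 0 \in free_of_y. Proof. exact: rpred0. Qed.
Let one_free : 1 \in free_of_y. Proof. exact: rpred1. Qed.
Definition series0 := Series zero_free.
Definition series1 := Series one_free.

Let addA : associative series_add.
Proof. by move=> s r t; apply/val_inj/addrA. Qed.
Let addC : commutative series_add.
Proof. by move=> s r; apply/val_inj/addrC. Qed.
Let add0 : left_id series0 series_add.
Proof. by move=> s; apply/val_inj/add0r. Qed.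
Let addN : left_inverse series0 series_opp series_add.
Proof. by move=> s; apply/val_inj/addNr. Qed.
HB.instance Definition _ := GRing.isZmodule.Build series addA addC add0 addN.

Let mulA : associative series_mul.
Proof. by move=> s r t; apply/val_inj/mulrA. Qed.
Let mulC : commutative series_mul.
Proof. by move=> s r; apply/val_inj/mulrC. Qed.
Let mul1 : left_id series1 series_mul.
Proof. by move=> s; apply/val_inj/mul1r. Qed.
Let mulDl : left_distributive series_mul series_add.
Proof. by move=> s r t; apply/val_inj/mulrDl. Qed.
Let one_neq0 : series1 != series0.
Proof. by rewrite -val_eqE oner_eq0. Qed.
HB.instance Definition _ := GRing.Zmodule_isComNzRing.Build series
  mulA mulC mul1 mulDl one_neq0.

Let scaleA c d s : series_scale c (series_scale d s) = series_scale (c * d) s.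
Proof. exact/val_inj/scalerA. Qed.
Let scale1 : left_id 1 series_scale.
Proof. by move=> s; apply/val_inj/scale1r. Qed.
Let scaleDr : right_distributive series_scale +%R.
Proof. by move=> c s r; apply/val_inj/scalerDr. Qed.
Let scaleDl s : {morph series_scale^~ s : c d / c + d}.
Proof. by move=> c d; apply/val_inj/scalerDl. Qed.
HB.instance Definition _ :=
  GRing.Zmodule_isLmodule.Build K series scaleA scale1 scaleDr scaleDl.
Let scaleAl c (s r : series) : c *: (s * r) = (c *: s) * r.
Proof. exact/val_inj/scalerAl. Qed.
HB.instance Definition _ := GRing.Lmodule_isLalgebra.Build K series scaleAl.
HB.instance Definition _ := GRing.Lalgebra_isComAlgebra.Build K series.

Definition scoef (s : series) (k : nat) : K := series_val s k 0%N.

Fact series_of_subproof (c : nat -> K) :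
  (Fps2 (fun i j => if j == 0%N then c i else 0) : P) \in free_of_y.
Proof. by apply/free_of_yP => i j /negPf /= ->. Qed.
Definition series_of (c : nat -> K) : series := Series (series_of_subproof c).

End SeriesDef.

Notation "s `[ k ]" := (scoef s k) (at level 8, k at level 50, format "s `[ k ]").

Section SeriesTheory.
Variable K : fieldType.
Local Notation P := {fps2 K}.
Local Notation L := (series K).
Implicit Types (s r v : L) (c : K).

Lemma seriesP s r : (forall k, s`[k] = r`[k]) -> s = r.
Proof.
move=> e; apply/val_inj/fps2P => i [|j]; first exact: e.
by case: s r {e} => [s hs] [r hr] /=; rewrite (free_of_yP _ hs) ?(free_of_yP _ hr).
Qed.

Lemma series_ofE (u : nat -> K) k : (series_of u)`[k] = u k. Proof. by []. Qed.
Lemma scoefD s r k : (s + r)`[k] = s`[k] + r`[k]. Proof. by []. Qed.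
Lemma scoefB s r k : (s - r)`[k] = s`[k] - r`[k]. Proof. by []. Qed.
Lemma scoefZ c s k : (c *: s)`[k] = c * s`[k]. Proof. by []. Qed.
Lemma scoef0 k : (0 : L)`[k] = 0. Proof. exact: fps20E. Qed.
Lemma scoef1 k : (1 : L)`[k] = (k == 0%N)%:R.
Proof. by rewrite /scoef fps21E andbT. Qed.
Lemma scoefM s r k : (s * r)`[k] = \sum_(i < k.+1) s`[i] * r`[k - i].
Proof. by rewrite /scoef /= -fps2M_y0. Qed.
Lemma scoef_sum (I : Type) (e : seq I) (Q : pred I) (F : I -> L) k :
  (\sum_(i <- e | Q i) F i)`[k] = \sum_(i <- e | Q i) (F i)`[k].
Proof. by elim/big_rec2: _ => [|i y x _ <-]; rewrite ?scoef0 ?scoefD. Qed.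

Lemma seriesM_eq0 s r : s * r = 0 -> s = 0 \/ r = 0.
Proof.
move=> /(congr1 val) /= /eqP; rewrite mulf_eq0.
by case/orP=> /eqP h; [left|right]; apply: val_inj.
Qed.

Opaque series_add series_opp series_mul series_scale series0 series1 scoef.

Lemma scoefM0 s r : (s * r)`[0] = s`[0] * r`[0].
Proof. by rewrite scoefM big_ord1. Qed.

Lemma series_mulf_neq0 s r : s <> 0 -> r <> 0 -> s * r <> 0.
Proof. by move=> s0 r0 /seriesM_eq0[]. Qed.

Lemma series_mulfI s : s <> 0 -> injective ( *%R s).
Proof.
move=> s0 r v /eqP; rewrite -subr_eq0 -mulrBr => /eqP /seriesM_eq0[//|].
by move=> /eqP; rewrite subr_eq0 => /eqP.
Qed.

Definition oge d s := forall k, (k < d)%N -> s`[k] = 0.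

Lemma oge_le d e s : (d <= e)%N -> oge e s -> oge d s.
Proof. by move=> de he k kd; apply: he; apply: leq_trans kd de. Qed.

Lemma ogeD d s r : oge d s -> oge d r -> oge d (s + r).
Proof. by move=> hs hr k kd; rewrite scoefD hs ?hr ?addr0. Qed.
Lemma ogeB d s r : oge d s -> oge d r -> oge d (s - r).
Proof. by move=> hs hr k kd; rewrite scoefB hs ?hr ?subr0. Qed.
Lemma ogeZ d c s : oge d s -> oge d (c *: s).
Proof. by move=> hs k kd; rewrite scoefZ hs ?mulr0. Qed.
Lemma oge0 s : oge 0 s. Proof. by []. Qed.

Lemma ogeS d s : oge d s -> s`[d] = 0 -> oge d.+1 s.
Proof. by move=> hs sd k; rewrite ltnS leq_eqVlt => /orP[/eqP->|/hs]. Qed.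

Lemma oge_sep s : (forall d, oge d s) -> s = 0.
Proof. by move=> h; apply: seriesP => k; rewrite scoef0 (h k.+1). Qed.

Lemma ogeM d e s r : oge d s -> oge e r -> oge (d + e)%N (s * r).
Proof.
move=> hs hr k kde; rewrite scoefM big1 // => i _.
case: (ltnP i d) => id; first by rewrite hs ?mul0r.
rewrite hr ?mulr0 //; move: (ltn_ord i); lia.
Qed.

Lemma scoefM_lead d e s r :
  oge d s -> oge e r -> (s * r)`[d + e] = s`[d] * r`[e].
Proof.
move=> hs hr; have dl : (d < (d + e).+1)%N by lia.
rewrite scoefM (bigD1 (Ordinal dl)) //= addKn big1 ?addr0 // => i ni.
case: (ltngtP i d) => id; first by rewrite hs ?mul0r.
  rewrite hr ?mulr0 //; move: (ltn_ord i); lia.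
by case/eqP: ni; apply: val_inj.
Qed.

Lemma series_lead s : s <> 0 -> exists k, oge k s /\ s`[k] != 0.
Proof.
move=> s0; have ex : exists k, s`[k] != 0.
  apply: contrapT => nex; apply: s0; apply: seriesP => k; rewrite scoef0.
  by apply/eqP/negPn/negP => sk; apply: nex; exists k.
case: (ex_minnP ex) => k sk kmin; exists k; split=> // j jk.
by apply/eqP/negPn/negP => /kmin; rewrite leqNgt jk.
Qed.

Lemma lead_neq0 k s : s`[k] != 0 -> s <> 0.
Proof. by move=> + s0; rewrite s0 scoef0 eqxx. Qed.

Definition sT : L := series_of (fun k => (k == 1%N)%:R).

Lemma scoefTM s k : (sT * s)`[k] = if k is k'.+1 then s`[k'] else 0.
Proof.
case: k => [|k]; first by rewrite scoefM0 mul0r.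
rewrite scoefM 2!big_ord_recl big1 ?addr0 /=.
  by rewrite /bump /= addn0 mul0r mul1r add0r subn1.
by move=> i _; rewrite series_ofE /= mul0r.
Qed.

Lemma scoefTnM d s k :
  (sT ^+ d * s)`[k] = if (d <= k)%N then s`[k - d] else 0.
Proof.
elim: d k => [|d IHd] k; first by rewrite mul1r subn0.
by rewrite exprS -mulrA scoefTM; case: k => // k; rewrite IHd ltnS subSS.
Qed.

Lemma scoefTn d k : (sT ^+ d)`[k] = (k == d)%:R.
Proof.
rewrite -[sT ^+ d]mulr1 scoefTnM scoef1; case: leqP => h.
  by rewrite subn_eq0; congr (_%:R); lia.
by rewrite ltn_eqF.
Qed.

Lemma oge_TnM d s : oge d (sT ^+ d * s).
Proof. by move=> k kd; rewrite scoefTnM leqNgt kd. Qed.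

Lemma oge_Tn d : oge d (sT ^+ d).
Proof. by rewrite -[_ ^+ _]mulr1; apply: oge_TnM. Qed.

Lemma scoefTnM_lead d s : (sT ^+ d * s)`[d] = s`[0].
Proof. by rewrite scoefTnM leqnn subnn. Qed.

Lemma oge_split d s : oge d s -> exists r, s = sT ^+ d * r.
Proof.
move=> hs; exists (series_of (fun k => s`[k + d])); apply: seriesP => k.
rewrite scoefTnM; case: leqP => [dk|/hs //].
by rewrite series_ofE subnK.
Qed.

Lemma oge_complete d : complete_filtration (fun e => oge (d + e)%N).
Proof.
move=> u hu; exists (series_of (fun k => (u k.+1)`[k])) => e k ke.
rewrite scoefB series_ofE.
have stable j : (k < d + j)%N -> forall l, (u (j + l)%N)`[k] = (u j)`[k].
  move=> hk; elim=> [|l IHl]; first by rewrite addn0.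
  rewrite -IHl addnS; apply/eqP; rewrite -subr_eq0 -scoefB; apply/eqP/hu; lia.
case: (leqP e k.+1) => h.
  by rewrite -(subnKC h) stable // subrr.
rewrite -(subnKC (ltnW h)) stable ?subrr //; lia.
Qed.

(** K[[t]] is a discrete valuation ring. *)
Lemma oge_divides d s v :
  oge d s -> s`[d] != 0 -> oge d v -> exists r, v = s * r.
Proof.
move=> hs sd hv.
have [|||||r _ <-] := @filtered_surj L L (fun e => oge (0 + e)%N)
    (fun e => oge (d + e)%N) (fun=> True) ( *%R s) (mulrBr s)
    (@oge_complete 0) _ _ _ _ v _ I.
- by move=> e u hu; apply: ogeM.
- by move=> e u w; apply: ogeB.
- by move=> u hu; apply: oge_sep => e; apply: oge_le (hu e); lia.
- move=> e u hu _; exists ((u`[d + e] / s`[d]) *: sT ^+ e); split => //.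
    by apply/ogeZ/oge_Tn.
  rewrite addnS; apply: ogeS.
    by apply: ogeB => //; apply: ogeM => //; apply/ogeZ/oge_Tn.
  rewrite scoefB scoefM_lead // ?scoefZ ?scoefTn ?eqxx ?mulr1.
    by rewrite mulrC divfK ?subrr.
  exact/ogeZ/oge_Tn.
- by rewrite addn0.
by exists r.
Qed.

Lemma series_div_or s r : s <> 0 ->
  (exists v, r = s * v) \/ exists v, s = r * (sT * v).
Proof.
move=> /series_lead[k [ks sk]].
case: (pselect (oge k r)) => [hr|nr]; first by left; apply: oge_divides sk hr.
right; have r0 : r <> 0 by move=> r0; apply: nr => j _; rewrite r0 scoef0.
have [l [hl rl]] := series_lead r0.
have lk : (l < k)%N.
  by rewrite ltnNge; apply/negP => kl; apply: nr; apply: oge_le hl.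
have [v sv] := oge_divides hl rl (oge_le (ltnW lk) ks).
exists (series_of (fun k => v`[k.+1])); rewrite sv; congr (_ * _).
apply: seriesP => j; rewrite scoefTM; case: j => //.
have := ks l lk; rewrite sv -[l]addn0 scoefM_lead //.
by move=> /eqP; rewrite mulf_eq0 (negPf rl) => /eqP.
Qed.

End SeriesTheory.

Arguments oge {K} d%_N s.
Arguments scoef {K} s k%_N.

(** * Substituting series in one variable *)

Lemma sum_ord_extend (V : nmodType) (a b : nat) (F : nat -> V) :
    (a <= b)%N -> (forall i, (a <= i < b)%N -> F i = 0) ->
  \sum_(i < b) F i = \sum_(i < a) F i.
Proof.
move=> ab F0; rewrite -!(big_mkord xpredT) (big_cat_nat _ ab) //=.
by rewrite [X in _ + X]big1_seq ?addr0 // => i; rewrite mem_index_iota => /F0.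
Qed.

Lemma sum2_ord_extend (V : nmodType) (a b : nat) (F : nat -> nat -> V) :
    (a <= b)%N ->
    (forall i j, (i < b)%N -> (j < b)%N -> (a <= i)%N || (a <= j)%N -> F i j = 0) ->
  \sum_(i < b) \sum_(j < b) F i j = \sum_(i < a) \sum_(j < a) F i j.
Proof.
move=> ab F0; rewrite (sum_ord_extend (F := fun i => \sum_(j < b) F i j) ab).
  apply: eq_bigr => i _; apply: sum_ord_extend => // j /andP[aj jb].
  by apply: F0; rewrite ?aj ?orbT // (leq_trans (ltn_ord i)).
by move=> i /andP[ai ib]; rewrite big1 // => j _; apply: F0; rewrite ?ai.
Qed.

Section Subst.
Variable K : fieldType.
Local Notation P := {fps2 K}.
Local Notation L := (series K).
Implicit Types (f g : P) (X Y : L).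

Section Def.
Variables xi eta : L.

Definition smono i j : L := (sT K * xi) ^+ i * (sT K * eta) ^+ j.

(** The substitution x := t xi, y := t eta; the factors t make it well defined
    for all series [xi] and [eta]. *)
Definition subst (f : P) : L := series_of (fun k =>
  \sum_(i < k.+1) \sum_(j < k.+1) f i j * (smono i j)`[k]).

Lemma oge_smono i j : oge (i + j)%N (smono i j).
Proof.
rewrite /smono !exprMn mulrACA -exprD; exact: oge_TnM.
Qed.

Lemma substE N f k : (k <= N)%N ->
  (subst f)`[k] = \sum_(i < N.+1) \sum_(j < N.+1) f i j * (smono i j)`[k].
Proof.
move=> kN; apply/esym/(sum2_ord_extend (F := fun i j => f i j * (smono i j)`[k])) => //.
by move=> i j _ _ ij; rewrite oge_smono ?mulr0 //; lia.
Qed.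

Lemma eq_subst f g k : (forall i j, (i <= k)%N -> (j <= k)%N -> f i j = g i j) ->
  (subst f)`[k] = (subst g)`[k].
Proof.
move=> fg; apply: eq_bigr => i _; apply: eq_bigr => j _.
by rewrite fg // -ltnS.
Qed.

Fact subst_linear : linear subst.
Proof.
move=> c f g; apply: seriesP => k; rewrite scoefD scoefZ !series_ofE.
rewrite mulr_sumr -big_split; apply: eq_bigr => i _.
rewrite mulr_sumr -big_split; apply: eq_bigr => j _.
by rewrite fps2DE fps2ZE mulrDl mulrA.
Qed.
HB.instance Definition _ := GRing.isLinear.Build K P L _ subst subst_linear.

Lemma subst_mono i j : subst (mono K i j) = smono i j.
Proof.
apply: seriesP => k; rewrite (@substE (k + i + j)) ?(sum2_only (a := i) (b := j)
  (F := fun a b => mono K i j a b * (smono a b)`[k])); try lia.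
  by rewrite monoE !eqxx mul1r.
move=> a b _ _ nab; rewrite monoE; case: andP => [[/eqP ai /eqP bj]|_].
  by rewrite ai bj eqxx in nab.
by rewrite mul0r.
Qed.

(** A coefficient of a substitution depends on finitely many coefficients, so the
    multiplicativity of substitutions needs checking on monomials only. *)
Definition trunc N (f : P) : P :=
  \sum_(i < N.+1) \sum_(j < N.+1) f i j *: mono K i j.

Lemma truncE N f a b : (a <= N)%N -> (b <= N)%N -> trunc N f a b = f a b.
Proof.
move=> aN bN; rewrite fps2_sumE.
transitivity (\sum_(i < N.+1) \sum_(j < N.+1) f i j * mono K i j a b).
  by apply: eq_bigr => i _; rewrite fps2_sumE.
rewrite (sum2_only (a := a) (b := b) (F := fun i j => f i j * mono K i j a b)) //.
  by rewrite monoE !eqxx mulr1.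
move=> i j _ _ nij; rewrite monoE; case: andP => [[/eqP ai /eqP bj]|_].
  by rewrite ai bj eqxx in nij.
by rewrite mulr0.
Qed.

Lemma subst_trunc N f k : (k <= N)%N -> (subst (trunc N f))`[k] = (subst f)`[k].
Proof.
by move=> kN; apply: eq_subst => i j ik jk; apply: truncE; apply: leq_trans kN.
Qed.

Fact subst_monoid : monoid_morphism subst.
Proof.
split=> [|f g]; first by rewrite -mono00 subst_mono /smono !expr0 mulr1.
apply: seriesP => k.
have -> : (subst (f * g))`[k] = (subst (trunc k f * trunc k g))`[k].
  apply: eq_subst => i j ik jk; rewrite !fps2ME.
  apply: eq_bigr => a _; apply: eq_bigr => b _.
  have := ltn_ord a; have := ltn_ord b => ha hb; rewrite !truncE //; lia.
have -> : subst (trunc k f * trunc k g) = subst (trunc k f) * subst (trunc k g).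
  rewrite mulr_suml [subst (trunc k f)]linear_sum mulr_suml linear_sum.
  apply: eq_bigr => i _; rewrite mulr_suml linear_sum linear_sum mulr_suml.
  apply: eq_bigr => j _; rewrite -scalerAl !linearZ -scalerAl; congr (_ *: _).
  rewrite mulr_sumr [subst (trunc k g)]linear_sum mulr_sumr linear_sum.
  apply: eq_bigr => a _; rewrite mulr_sumr !linear_sum mulr_sumr.
  apply: eq_bigr => b _; rewrite -!scalerAr !linearZ -scalerAr; congr (_ *: _).
  rewrite /= mono_mul !subst_mono /smono !exprD -!mulrA; congr (_ * _).
  by rewrite mulrCA.
rewrite !scoefM; apply: eq_bigr => l _.
have := ltn_ord l => hl; rewrite !subst_trunc //; lia.
Qed.
HB.instance Definition _ := GRing.isMonoidMorphism.Build P L subst subst_monoid.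
End Def.

(** * Weighted substitutions x = t^n X, y = t^m Y *)
Section Weighted.
Variables n m : nat.
Hypotheses (n0 : (0 < n)%N) (m0 : (0 < m)%N).

Definition wsubst (X Y : L) : P -> L :=
  subst (sT K ^+ n.-1 * X) (sT K ^+ m.-1 * Y).
HB.instance Definition _ X Y := GRing.LRMorphism.on (wsubst X Y).

Lemma smono_w X Y i j :
  smono (sT K ^+ n.-1 * X) (sT K ^+ m.-1 * Y) i j =
  sT K ^+ (i * n + j * m) * (X ^+ i * Y ^+ j).
Proof.
rewrite /smono !mulrA -!exprS !prednK // !exprMn -!exprM mulrACA -exprD.
by rewrite [(n * i)%N]mulnC [(m * j)%N]mulnC mulrA.
Qed.

Lemma wsubstE X Y N f k : (k <= N)%N -> (wsubst X Y f)`[k] =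
  \sum_(i < N.+1) \sum_(j < N.+1) f i j *
    (if (i * n + j * m <= k)%N then (X ^+ i * Y ^+ j)`[k - (i * n + j * m)] else 0).
Proof.
move=> kN; rewrite (substE _ _ _ kN).
by apply: eq_bigr => i _; apply: eq_bigr => j _; rewrite smono_w scoefTnM.
Qed.

Lemma wsubst_mono X Y i j :
  wsubst X Y (mono K i j) = sT K ^+ (i * n + j * m) * (X ^+ i * Y ^+ j).
Proof. by rewrite /wsubst subst_mono smono_w. Qed.

Lemma oge_wsubst X Y d f : wge n m d f -> oge d (wsubst X Y f).
Proof.
move=> hf k kd; rewrite (wsubstE _ _ _ (leqnn k)) big1 // => i _.
rewrite big1 // => j _; case: leqP => h; last by rewrite mulr0.
by rewrite hf ?mul0r //; apply: leq_ltn_trans kd.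
Qed.

(** Value at (a, b) of the part of weight [d]. *)
Definition lead d (f : P) (a b : K) : K := \sum_(i < d.+1) \sum_(j < d.+1)
  if (i * n + j * m == d)%N then f i j * (a ^+ i * b ^+ j) else 0.

(** Value at (a, b) of the x-derivative of the part of weight [d]. *)
Definition leadx d (f : P) (a b : K) : K := \sum_(i < d.+1) \sum_(j < d.+1)
  if (i * n + j * m == d)%N then f i j *+ i * (a ^+ i.-1 * b ^+ j) else 0.

Lemma weight_bound N i j d :
  (N < i)%N || (N < j)%N -> (i * n + j * m == d)%N -> (N < d)%N.
Proof. by move=> ij /eqP <-; nia. Qed.

Lemma lead_extend N d f a b : (d <= N)%N -> lead d f a b =
  \sum_(i < N.+1) \sum_(j < N.+1)
    if (i * n + j * m == d)%N then f i j * (a ^+ i * b ^+ j) else 0.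
Proof.
move=> dN; apply/esym/(sum2_ord_extend (F := fun i j =>
  if (i * n + j * m == d)%N then f i j * (a ^+ i * b ^+ j) else 0)) => //.
by move=> i j _ _ /weight_bound h; case: ifP => // /h; rewrite ltnn.
Qed.

Lemma leadx_extend N d f a b : (d <= N)%N -> leadx d f a b =
  \sum_(i < N.+1) \sum_(j < N.+1)
    if (i * n + j * m == d)%N then f i j *+ i * (a ^+ i.-1 * b ^+ j) else 0.
Proof.
move=> dN; apply/esym/(sum2_ord_extend (F := fun i j =>
  if (i * n + j * m == d)%N then f i j *+ i * (a ^+ i.-1 * b ^+ j) else 0)) => //.
by move=> i j _ _ /weight_bound h; case: ifP => // /h; rewrite ltnn.
Qed.

Lemma scoefX0 (X : L) i : (X ^+ i)`[0] = X`[0] ^+ i.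
Proof.
elim: i => [|i IHi]; first by rewrite !expr0 scoef1.
by rewrite !exprS scoefM0 IHi.
Qed.

Lemma wsubst_lead X Y d f : wge n m d f ->
  (wsubst X Y f)`[d] = lead d f X`[0] Y`[0].
Proof.
move=> hf; rewrite (wsubstE _ _ _ (leqnn d)).
apply: eq_bigr => i _; apply: eq_bigr => j _; case: ltngtP => h.
- by rewrite hf ?mul0r.
- by rewrite mulr0.
- by rewrite h subnn scoefM0 !scoefX0.
Qed.

Lemma scoef_const a k : (a%:A : L)`[k] = if k == 0%N then a else 0.
Proof. by rewrite scoefZ scoef1; case: eqP; rewrite ?mulr1 ?mulr0. Qed.

Lemma leadM d e f g a b : wge n m d f -> wge n m e g ->
  lead (d + e)%N (f * g) a b = lead d f a b * lead e g a b.
Proof.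
move=> hf hg; have h c : (c%:A : L)`[0] = c by rewrite scoef_const.
rewrite -{1 2}[a]h -{1 2}[b]h -wsubst_lead; last exact: wgeM.
rewrite rmorphM scoefM_lead; try exact: oge_wsubst.
by rewrite !wsubst_lead // !h.
Qed.

Lemma leadD d f g a b : lead d (f + g) a b = lead d f a b + lead d g a b.
Proof.
rewrite -big_split; apply: eq_bigr => i _; rewrite -big_split.
by apply: eq_bigr => j _ /=; case: ifP; rewrite ?addr0 ?mulrDl.
Qed.

Lemma lead_mono i j a b :
  lead (i * n + j * m)%N (mono K i j) a b = a ^+ i * b ^+ j.
Proof.
have h c : (c%:A : L)`[0] = c by rewrite scoef_const.
rewrite -{1}[a]h -{1}[b]h -wsubst_lead; last exact: wge_mono.
by rewrite wsubst_mono scoefTnM_lead scoefM0 !scoefX0 !h.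
Qed.

Lemma lead_wcomp d f a b : lead d (wcomp n m d f) a b = lead d f a b.
Proof.
apply: eq_bigr => i _; apply: eq_bigr => j _; rewrite wcompE.
by case: eqP.
Qed.

Lemma leadZ d c f a b : lead d (c *: f) a b = c * lead d f a b.
Proof.
rewrite mulr_sumr; apply: eq_bigr => i _; rewrite mulr_sumr.
by apply: eq_bigr => j _; case: ifP; rewrite ?mulr0 ?fps2ZE ?mulrA.
Qed.

Opaque wsubst.

(** * Newton's method *)

(** In the next two lemmas X' differs from X by s t^k + ..., and the leading term of
    the variation of a monomial, then of a series, is given by its x-derivative. *)
Lemma scoefX_diff k (X X' : L) i : (0 < k)%N -> oge k (X' - X) ->
  oge k (X' ^+ i - X ^+ i) /\
  (X' ^+ i - X ^+ i)`[k] = (X' - X)`[k] * X`[0] ^+ i.-1 *+ i.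
Proof.
move=> k0 hX; have X0 : X'`[0] = X`[0].
  by apply/eqP; rewrite -subr_eq0 -scoefB hX.
elim: i => [|i [IH1 IH2]].
  by rewrite subrr; split=> [j _|]; rewrite scoef0 ?mulr0n.
have -> : X' ^+ i.+1 - X ^+ i.+1 = (X' - X) * X' ^+ i + X * (X' ^+ i - X ^+ i).
  by rewrite !exprS; ring.
split.
  apply: ogeD; first by rewrite -[k]addn0; exact: ogeM hX (oge0 _).
  by rewrite -[k]add0n; exact: ogeM (oge0 _) IH1.
have := scoefM_lead hX (oge0 (X' ^+ i)); rewrite addn0 => e1.
have := scoefM_lead (oge0 X) IH1; rewrite add0n => e2.
rewrite [LHS]scoefD e1 e2 scoefX0 X0 IH2 mulrS; congr (_ + _).
by case: i {IH1 IH2 e1 e2} => [|i]; rewrite ?mulr0n ?mulr0 // mulrnAr mulrCA -exprS.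
Qed.

Lemma wsubst_diff k d X (X' : L) Y f :
    (0 < k)%N -> oge k (X' - X) -> wge n m d f ->
  oge (d + k)%N (wsubst X' Y f - wsubst X Y f) /\
  (wsubst X' Y f - wsubst X Y f)`[d + k] =
    (X' - X)`[k] * leadx d f X`[0] Y`[0].
Proof.
move=> k0 hX hf.
have monoB i j l : (X' ^+ i * Y ^+ j)`[l] - (X ^+ i * Y ^+ j)`[l] =
    ((X' ^+ i - X ^+ i) * Y ^+ j)`[l].
  by rewrite mulrBl scoefB.
have hmono i j : oge k ((X' ^+ i - X ^+ i) * Y ^+ j).
  by rewrite -[k]addn0; exact: ogeM (proj1 (scoefX_diff i k0 hX)) (oge0 _).
have E l : (wsubst X' Y f - wsubst X Y f)`[l] =
    \sum_(i < l.+1) \sum_(j < l.+1) f i j * (if (i * n + j * m <= l)%N then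
      ((X' ^+ i - X ^+ i) * Y ^+ j)`[l - (i * n + j * m)] else 0).
  rewrite [LHS]scoefB (wsubstE X' Y f (leqnn l)) (wsubstE X Y f (leqnn l)) -sumrB.
  apply: eq_bigr => i _.
  rewrite -sumrB; apply: eq_bigr => j _; rewrite -mulrBr; congr (_ * _).
  by case: ifP; rewrite ?subr0 // monoB.
split=> [l ld|].
  rewrite E big1 // => i _; rewrite big1 // => j _; case: leqP => h; last first.
    by rewrite mulr0.
  case: (ltnP (i * n + j * m) d) => h'; first by rewrite hf ?mul0r.
  rewrite hmono ?mulr0 //; lia.
rewrite E (leadx_extend (N := (d + k)%N)) ?leq_addr // mulr_sumr.
apply: eq_bigr => i _; rewrite mulr_sumr; apply: eq_bigr => j _.
case: (ltngtP (i * n + j * m) d) => h.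
- by rewrite hf ?mul0r ?mulr0.
- case: leqP => h'; last by rewrite !mulr0.
  rewrite hmono ?mulr0 //; lia.
rewrite h leq_addr addKn.
have := scoefM_lead (proj1 (scoefX_diff i k0 hX)) (oge0 (Y ^+ j)).
rewrite addn0 => ->.
rewrite (proj2 (scoefX_diff i k0 hX)) scoefX0.
rewrite !(mulrnAl, mulrnAr) -!mulrA; congr (_ *+ i).
by rewrite mulrCA.
Qed.

(** Leibniz rule, read off the variation of a product under x := x + t. *)
Lemma leadxM d e f g a b : wge n m d f -> wge n m e g ->
  leadx (d + e)%N (f * g) a b =
  leadx d f a b * lead e g a b + lead d f a b * leadx e g a b.
Proof.
move=> hf hg; have h c : (c%:A : L)`[0] = c by rewrite scoef_const.
pose X : L := a%:A; pose X' := X + sT K; pose Y : L := b%:A.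
have XX : X' - X = sT K by rewrite addrAC subrr add0r.
have o1 : oge 1 (X' - X) by rewrite XX -[sT K]expr1; apply: oge_Tn.
have c1 : (X' - X)`[1] = 1 by rewrite XX.
have X'0 : X'`[0] = a by rewrite scoefD h addr0.
have [_] := wsubst_diff Y (ltn0Sn 0) o1 (wgeM hf hg).
have [f1 f2] := wsubst_diff Y (ltn0Sn 0) o1 hf.
have [g1 g2] := wsubst_diff Y (ltn0Sn 0) o1 hg.
rewrite c1 !mul1r !h in f2 g2 *; move=> <-; rewrite !rmorphM.
have -> : wsubst X' Y f * wsubst X' Y g - wsubst X Y f * wsubst X Y g =
  (wsubst X' Y f - wsubst X Y f) * wsubst X' Y g +
  wsubst X Y f * (wsubst X' Y g - wsubst X Y g) by ring.
have := scoefM_lead f1 (oge_wsubst X' Y hg); rewrite addnAC => e1.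
have := scoefM_lead (oge_wsubst X Y hf) g1; rewrite addnA => e2.
rewrite scoefD e1 e2.
by rewrite f2 g2 !wsubst_lead // X'0 !h.
Qed.

(** A zero of the leading form at which the x-derivative does not vanish is
    corrected in its first coordinate, one power of t at a time. *)
Lemma newton d f a b : wge n m d f -> lead d f a b = 0 -> leadx d f a b != 0 ->
  exists X : L, X`[0] = a /\ wsubst X b%:A f = 0.
Proof.
move=> hf f0 fx; set Y : L := b%:A.
have Y0 : Y`[0] = b by rewrite scoef_const.
have [||X X0 hX] := complete_limit (Good := fun e X =>
    X`[0] = a /\ oge (d + e).+1 (wsubst X Y f)) (u0 := (a%:A : L))
    (@oge_complete K 1).
- rewrite scoef_const; split => //; rewrite addn0; apply: ogeS.
    exact: oge_wsubst.
  by rewrite wsubst_lead // Y0 scoef_const.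
- move=> e X [X0 hX]; set c := - ((wsubst X Y f)`[d + e.+1] / leadx d f a b).
  have XX : X + c *: sT K ^+ e.+1 - X = c *: sT K ^+ e.+1.
    by rewrite addrAC subrr add0r.
  have oX : oge e.+1 (X + c *: sT K ^+ e.+1 - X).
    by rewrite XX; apply/ogeZ/oge_Tn.
  have [D1 D2] := wsubst_diff Y (ltn0Sn e) oX hf.
  exists (X + c *: sT K ^+ e.+1) => //; split.
    by rewrite scoefD scoefZ scoefTn mulr0 addr0.
  rewrite -[wsubst _ _ _](subrK (wsubst X Y f)) addrC; apply: ogeS.
    by apply: ogeD => //; rewrite addnS.
  rewrite scoefD D2 XX scoefZ scoefTn eqxx mulr1 X0 Y0 /c mulNr divfK //.
  by rewrite subrr.
exists X; split.
  by have /eqP := X0 0%N isT; rewrite scoefB scoef_const subr_eq0 => /eqP.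
apply: oge_sep => e; have [X1 [_ o1] o2] := hX e.
have [D1 _] := wsubst_diff Y (ltn0Sn e) o2 hf.
rewrite -[wsubst _ _ _](subrK (wsubst X1 Y f)); apply: ogeD.
  by apply: oge_le D1; lia.
by apply: oge_le o1; lia.
Qed.

End Weighted.
End Subst.

Arguments wsubst {K} (n m)%_N X Y f.
Arguments lead {K} (n m d)%_N f a b.
Arguments leadx {K} (n m d)%_N f a b.

(** * The numerical semigroup generated by two coprime integers *)

Section Semigroup.
Variables n m : nat.
Hypotheses (n0 : (0 < n)%N) (m0 : (0 < m)%N) (nm : coprime n m).

Definition in_semigroup k :=
  [exists i : 'I_k.+1, exists j : 'I_k.+1, (i * n + j * m == k)%N].

Lemma in_semigroupP k :
  reflect (exists i j, (i * n + j * m)%N = k) (in_semigroup k).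
Proof.
apply: (iffP existsP) => [[i /existsP[j /eqP]]|[i [j ij]]].
  by exists i, j.
have ik : (i < k.+1)%N by nia.
have jk : (j < k.+1)%N by nia.
by exists (Ordinal ik); apply/existsP; exists (Ordinal jk); apply/eqP.
Qed.

Lemma semigroup_repr_eq i j i' j' : (i < m)%N -> (i' < m)%N ->
  (i * n + j * m = i' * n + j' * m)%N -> (i, j) = (i', j').
Proof.
move=> im im' e; suff ii : i = i'.
  by move: e; rewrite ii => /addnI /eqP; rewrite eqn_pmul2r // => /eqP->.
wlog le_ii : i i' j j' im im' e / (i <= i')%N.
  by move=> W; case: (leqP i i') => [|/ltnW] h; [apply: (W i i' j j') |
    apply/esym/(W i' i j' j)].
have : (m %| (i' - i) * n)%N.
  have -> : ((i' - i) * n)%N = ((j - j') * m)%N by nia.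
  exact: dvdn_mull.
rewrite Gauss_dvdl 1?coprime_sym //.
case: (posnP (i' - i)) => [h _|h /dvdn_leq]; first by lia.
by move/(_ h); lia.
Qed.

(** [n] is invertible modulo [m]. *)
Lemma semigroup_residue k :
  exists i, (i < m)%N /\ (k = i * n %[mod m])%N.
Proof.
have [m1|m_neq1] := eqVneq m 1%N; first by exists 0%N; rewrite m1 !modn1.
have [u _ hu] := Bezoutr n m0; rewrite (eqnP nm) in hu.
exists (k * (m.-1 * u) %% m)%N; split; first by rewrite ltn_mod.
rewrite modnMml.
have [v hv] := dvdnP hu.
have -> : (k * (m.-1 * u) * n)%N = (k * (m.-1 * (u * n)))%N by rewrite -!mulnA.
have -> : (u * n = v * m - 1)%N by rewrite -hv addKn.
have v0 : (0 < v)%N by case: v hv.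
have -> : (k * (m.-1 * (v * m - 1)) = k * (m.-1 * v - 1) * m + k)%N.
  rewrite -mulnA -mulnSr; congr (k * _)%N.
  case: (m) m_neq1 m0 v0 => [|[|m']] // _ _; case: (v) => // v' _ /=.
  have -> : (v'.+1 * m'.+2 - 1 = v' * m'.+2 + m'.+1)%N by lia.
  have -> : (m'.+1 * v'.+1 - 1 = m'.+1 * v' + m')%N by lia.
  lia.
by rewrite modnMDl.
Qed.

(** Every integer is uniquely i n + j m with 0 <= i < m and j in Z; it lies in the
    semigroup if and only if j is nonnegative. *)
Lemma semigroup_or k : (exists i j, (i < m)%N /\ (i * n + j * m)%N = k) \/
  (exists i j, (i < m)%N /\ (k + j.+1 * m)%N = (i * n)%N).
Proof.
have [i [im e]] := semigroup_residue k.
have E1 := divn_eq k m; have E2 := divn_eq (i * n) m; rewrite -e in E2.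
case: (leqP (i * n) k) => h; [left; exists i, (k %/ m - i * n %/ m)%N |
  right; exists i, (i * n %/ m - k %/ m).-1].
  split=> //; rewrite mulnBl.
  have : (i * n %/ m <= k %/ m)%N by apply: leq_div2r.
  nia.
split=> //; have lt : (k %/ m < i * n %/ m)%N by nia.
rewrite prednK ?subn_gt0 // mulnBl; nia.
Qed.

(** The largest gap is [n m - n - m]. *)
Lemma semigroup_conductor k : (n.-1 * m.-1 <= k)%N ->
  exists i j, (i < m)%N /\ (i * n + j * m)%N = k.
Proof.
move=> ck; case: (semigroup_or k) => // -[i [j [im e]]].
by exfalso; nia.
Qed.

Lemma semigroup_small k : in_semigroup k ->
  exists i j, (i < m)%N /\ (i * n + j * m)%N = k.
Proof.
case: (semigroup_or k) => // -[i [j [im e]]] /in_semigroupP[i' [j' e']].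
exfalso; have e'' : ((i' %% m) * n + (i' %/ m * n + j' + j.+1) * m = i * n + 0 * m)%N.
  rewrite mul0n addn0 -e -e'; have := divn_eq i' m.
  by move: (i' %/ m)%N (i' %% m)%N => a b ->; nia.
have := semigroup_repr_eq (ltn_pmod i' m0) im e''.
by case=> _ /eqP; rewrite addn_eq0 andbF.
Qed.

(** The reflection k <-> n m - n - m - k exchanges gaps and elements. *)
Lemma semigroup_symmetric k : (k < n.-1 * m.-1)%N ->
  in_semigroup (n.-1 * m.-1 - k.+1)%N = ~~ in_semigroup k.
Proof.
move=> kc; case: (boolP (in_semigroup k)) => /= [/in_semigroupP[i [j ij]]|nk].
  apply/negbTE/negP => /in_semigroupP[i' [j' ij']].
  have e : ((i + i').+1 * n + (j + j').+1 * m = n * m)%N.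
    case: (n) (m) n0 m0 kc ij ij' => // n' [//|m'] _ _ /=; nia.
  have : (m %| (i + i').+1 * n)%N.
    have -> : ((i + i').+1 * n)%N = ((n - (j + j').+1) * m)%N.
      rewrite mulnBl; lia.
    exact: dvdn_mull.
  rewrite Gauss_dvdl 1?coprime_sym // => /(dvdn_leq (ltn0Sn _)).
  rewrite -(leq_pmul2r n0) => h; have : (0 < (j + j').+1 * m)%N by rewrite muln_gt0.
  by move: e h; rewrite [(n * m)%N]mulnC; lia.
case: (semigroup_or k) => -[i [j [im e]]].
  by case/in_semigroupP: nk; exists i, j.
apply/in_semigroupP; exists (m - i.+1)%N, j.
have E : ((m - i.+1) * n + i * n + n = m * n)%N.
  by rewrite -addnA -mulSnr -mulnDl subnK.
have E2 : (n.-1 * m.-1 + n + m = n * m + 1)%N.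
  case: (n) (m) n0 m0 => // n' [//|m'] _ _ /=; lia.
by rewrite mulSn in e; rewrite mulnC in E; lia.
Qed.

Definition semigroup_gaps :=
  [seq k <- iota 0 (n.-1 * m.-1) | ~~ in_semigroup k].

Lemma mem_semigroup_gaps k : (k \in semigroup_gaps) = ~~ in_semigroup k.
Proof.
rewrite mem_filter mem_iota /= add0n andb_idr // => nk.
rewrite ltnNge; apply: contra nk => /semigroup_conductor[i [j [_ ij]]].
by apply/in_semigroupP; exists i, j.
Qed.

Lemma uniq_semigroup_gaps : uniq semigroup_gaps.
Proof. exact/filter_uniq/iota_uniq. Qed.

Lemma size_semigroup_gaps : (2 * size semigroup_gaps = n.-1 * m.-1)%N.
Proof.
set c := (n.-1 * m.-1)%N.
have -> : size semigroup_gaps = (\sum_(k < c) ~~ in_semigroup k)%N.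
  rewrite size_filter -sum1_count big_mkcond -(big_mkord xpredT
    (fun k => nat_of_bool (~~ in_semigroup k))) /index_iota subn0.
  by apply: eq_bigr => k _; case: (in_semigroup k).
rewrite mul2n -addnn {2}(reindex_inj rev_ord_inj) -big_split /=.
rewrite (eq_bigr (fun=> 1%N)) ?sum_nat_const ?card_ord ?muln1 // => k _.
by rewrite (semigroup_symmetric (ltn_ord k)); case: in_semigroup.
Qed.

End Semigroup.

(** * Division by a binomial *)

Section Binomial.
Variable K : fieldType.
Local Notation P := {fps2 K}.
Local Notation L := (series K).
Implicit Types (f g h q p u : P) (X Y v : L).
Variables n m : nat.
Hypotheses (n0 : (0 < n)%N) (m0 : (0 < m)%N).
Variable c : K.

Definition binomial_xy : P := mono K m 0 - c *: mono K 0 n.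

(** The quotient u and the remainder r of h by x^m - c y^n satisfy a recursion on
    coefficients along the monomials x^(i + m l) y^(j - n l) of the same weight;
    this sum along that line solves it. *)
Definition trade h i j : K :=
  \sum_(l < j.+1) if (n * l <= j)%N then c ^+ l * h (i + m * l)%N (j - n * l)%N else 0.

Definition bdiv h : P := Fps2 (fun i j => trade h (i + m)%N j).
Definition brem h : P := Fps2 (fun i j => if (i < m)%N then trade h i j else 0).

Lemma trade_rec h i j : trade h i j =
  h i j + (if (n <= j)%N then c * trade h (i + m)%N (j - n)%N else 0).
Proof.
rewrite /trade big_ord_recl /= !muln0 leq0n expr0 mul1r addn0 subn0; congr (_ + _).
rewrite (eq_bigr (fun l : 'I_j => (fun l => if (n * l.+1 <= j)%N then
    c ^+ l.+1 * h (i + m * l.+1)%N (j - n * l.+1)%N else 0) (l : nat))) //.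
case: leqP => nj; last first.
  rewrite big1 // => l _; case: leqP => // h1.
  by exfalso; move: h1; rewrite mulnS; lia.
rewrite (sum_ord_extend (a := (j - n).+1)
  (F := fun l => if (n * l.+1 <= j)%N then
    c ^+ l.+1 * h (i + m * l.+1)%N (j - n * l.+1)%N else 0)); try lia.
  rewrite mulr_sumr; apply: eq_bigr => l _; rewrite mulnS leq_subRL //.
  case: ifP => _; rewrite ?mulr0 // exprS -mulrA; congr (_ * (_ * h _ _)).
    by rewrite mulnS addnA.
  by rewrite subnDA.
move=> l /andP[l1 l2]; case: leqP => // h1; exfalso; move: h1.
by rewrite mulnS; nia.
Qed.

Lemma binomial_division h : h = bdiv h * binomial_xy + brem h.
Proof.
apply: fps2P => i j; rewrite fps2DE mulrC mulrBl fps2BE -scalerAl fps2ZE.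
rewrite !mono_mulE !leq0n subn0 /= subn0.
have E : c * (if (n <= j)%N then trade h (i + m)%N (j - n)%N else 0) =
    trade h i j - h i j.
  by rewrite [trade h i j]trade_rec addrAC subrr add0r; case: ifP; rewrite ?mulr0.
rewrite E andbT; case: leqP => im; last by rewrite sub0r opprB subrK.
by rewrite subnK // addr0 subKr.
Qed.

Lemma swge_bdiv d h : wge n m d h -> swge n m (n * m) d (bdiv h).
Proof.
move=> hh i j ij /=; rewrite /trade big1 // => l _; case: leqP => // nl.
by rewrite hh ?mulr0 //; nia.
Qed.

Lemma wge_brem d h : wge n m d h -> wge n m d (brem h).
Proof.
move=> hh i j ij /=; case: ifP => // im; rewrite /trade big1 // => l _.
by case: leqP => // nl; rewrite hh ?mulr0 //; nia.
Qed.

Lemma wge_binomial : wge n m (n * m) binomial_xy.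
Proof.
have := @wge_mono K n m m 0; have := @wge_mono K n m 0 n.
rewrite !mul0n addn0 add0n [(m * n)%N]mulnC => h1 h2.
by apply: wgeB => //; apply: wgeZ.
Qed.

Lemma isobaric_binomial : isobaric n m (n * m) binomial_xy.
Proof.
move=> i j ij; rewrite fps2BE fps2ZE !monoE.
case: andP => [[/eqP im /eqP jn]|_]; first by case/eqP: ij; rewrite im jn; lia.
case: andP => [[/eqP im /eqP jn]|_]; first by case/eqP: ij; rewrite im jn; lia.
by rewrite mulr0 subr0.
Qed.

Lemma binomial_neq0 : binomial_xy != 0.
Proof.
apply/eqP => /(congr1 (fun f : P => f m 0%N)); rewrite fps20E fps2BE fps2ZE !monoE.
by rewrite !eqxx eqn0Ngt m0 /= mulr0 subr0 => /eqP; rewrite oner_eq0.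
Qed.

Variables a b : K.
Hypotheses (b0 : b != 0) (a0 : (a != 0) || (m == 1%N)).
Hypothesis cE : c * b ^+ n = a ^+ m.
Hypothesis nm : coprime n m.

Lemma lead_binomial : lead n m (n * m) binomial_xy a b = 0.
Proof.
have -> : lead n m (n * m) binomial_xy a b =
    lead n m (m * n + 0 * m) (mono K m 0) a b -
    c * lead n m (0 * n + n * m) (mono K 0 n) a b.
  rewrite !mul0n addn0 add0n [(m * n)%N]mulnC.
  by rewrite /binomial_xy -scaleNr leadD !leadZ mulNr.
by rewrite !lead_mono // !expr0 mul1r mulr1 cE subrr.
Qed.

Lemma pow_small_neq0 i : (i < m)%N -> a ^+ i != 0.
Proof.
move=> im; case/orP: a0 => [|/eqP m1]; first exact: expf_neq0.
by move: im; rewrite m1; case: i => // _; rewrite expr0 oner_neq0.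
Qed.

(** The remainder has x-degree less than [m], hence at most one monomial of each
    weight. Substituting (a t^n, b t^m), which kills the binomial, shows that the
    coefficient of that monomial is zero as soon as the form of [h] vanishes at (a, b). *)
Lemma brem_lead0 d h : wge n m d h -> lead n m d h a b = 0 ->
  wge n m d.+1 (brem h).
Proof.
move=> hh h0 i j; rewrite ltnS leq_eqVlt => /orP[/eqP ij|]; last exact: wge_brem.
have : lead n m d (brem h) a b = 0.
  have c0 (x : K) : (x%:A : L)`[0] = x by rewrite scoef_const.
  rewrite -[a]c0 -[b]c0 -(wsubst_lead _ _ _ _ (wge_brem hh)) //.
  suff -> : wsubst n m (a%:A) (b%:A) (brem h) = wsubst n m (a%:A) (b%:A) h.
    by rewrite wsubst_lead // !c0.
  rewrite {2}(binomial_division h) rmorphD rmorphM /=.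
  suff -> : wsubst n m (a%:A) (b%:A) binomial_xy = 0 by rewrite mulr0 add0r.
  rewrite /binomial_xy rmorphB /= linearZ /= !wsubst_mono // addn0 add0n.
  rewrite !expr0 mulr1 mul1r [(m * n)%N]mulnC scalerAr -mulrBr !exprZn.
  by rewrite !expr1n scalerA -scalerBl cE subrr scale0r mulr0.
rewrite /=; case: ifP => // im; rewrite /lead.
rewrite (sum2_only (a := i) (b := j) (F := fun i j =>
  if (i * n + j * m == d)%N then brem h i j * (a ^+ i * b ^+ j) else 0)); try nia.
  rewrite ij eqxx /= im => /eqP; rewrite !mulf_eq0 (negPf (pow_small_neq0 im)).
  by rewrite (negPf (expf_neq0 _ b0)) !orbF => /eqP.
move=> i' j' _ _ nij; case: eqP => // e; rewrite /=.
case: ifP => im'; last by rewrite mul0r.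
case/eqP: nij; apply: (semigroup_repr_eq n0 m0 nm im' im).
by rewrite e.
Qed.

End Binomial.

(** * Branches *)

(** [phi] parametrises the branch [q = 0]. The number [delta] of orders that are
    not attained is the codimension of the image, that is the delta-invariant. *)
Definition branch (K : fieldType) (phi : {lrmorphism {fps2 K} -> series K})
    (q : {fps2 K}) (delta : nat) : Prop :=
  [/\ forall h, phi h = 0 <-> exists u, h = u * q,
      exists N, forall v : series K, oge N v -> exists h, phi h = v &
      exists G : seq nat, [/\ uniq G, size G = delta & forall k,
        (k \in G) <-> ~ exists h, oge k (phi h) /\ scoef (phi h) k != 0]].

Section Param.
Variable K : fieldType.
Local Notation P := {fps2 K}.
Local Notation L := (series K).
Implicit Types (f g h q p u : P) (X Y v : L).
Variables n m : nat.
Hypotheses (n0 : (0 < n)%N) (m0 : (0 < m)%N) (nm : coprime n m).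
Variables (X Y : L) (c : K).
Hypotheses (b0 : scoef Y 0 != 0) (a0 : (scoef X 0 != 0) || (m == 1%N)).
Hypothesis cE : c * (scoef Y 0) ^+ n = (scoef X 0) ^+ m.
Local Notation phi := (wsubst n m X Y).

Let phiB f g : phi (f - g) = phi f - phi g. Proof. exact: raddfB. Qed.
Let phiM f g : phi (f * g) = phi f * phi g. Proof. exact: rmorphM. Qed.

(** Beyond the conductor of the semigroup, every power of t is the leading term of
    the image of a monomial. *)
Lemma wsubst_surj d v : (n.-1 * m.-1 <= d)%N -> oge d v ->
  exists2 p, wge n m d p & phi p = v.
Proof.
move=> cd hv.
have [|||||p hp <-] := @filtered_surj P L (fun e => wge n m (d + e)%N)
    (fun e => oge (d + e)%N) (fun=> True) phi (raddfB phi)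
    (@wge_complete K n m d n0 m0) _ _ _ _ v _ I.
- by move=> e u; apply: oge_wsubst.
- by move=> e u w; apply: ogeB.
- by move=> u hu; apply: oge_sep => e; apply: oge_le (hu e); lia.
- move=> e u hu _.
  have [|i [j [im ij]]] := semigroup_conductor n0 m0 nm (k := (d + e)%N); first lia.
  have ab : scoef X 0 ^+ i * scoef Y 0 ^+ j != 0.
    by rewrite mulf_neq0 ?(expf_neq0 _ b0) ?(pow_small_neq0 a0).
  exists ((scoef u (d + e)%N / (scoef X 0 ^+ i * scoef Y 0 ^+ j)) *: mono K i j).
  have hw : wge n m (d + e) (mono K i j) by rewrite -ij; apply: wge_mono.
  split=> //; first exact: wgeZ.
  rewrite addnS; apply: ogeS.
    by apply: ogeB => //; apply: oge_wsubst => //; apply: wgeZ.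
  rewrite scoefB linearZ scoefZ wsubst_lead // -{3}ij lead_mono //.
  by rewrite divfK ?subrr.
- by rewrite addn0.
by exists p; rewrite ?addn0 // -[d]addn0.
Qed.

(** The image of the binomial has order larger than n m, so it is also the image of a
    series of larger weight. *)
Lemma branch_equation : exists2 p, wge n m (n * m).+1 p &
  phi (binomial_xy n m c - p) = 0.
Proof.
have hb : oge (n * m).+1 (phi (binomial_xy n m c)).
  apply: ogeS; first by apply: oge_wsubst => //; apply: wge_binomial.
  rewrite wsubst_lead //; last exact: wge_binomial.
  exact: lead_binomial.
have [|p hp e] := wsubst_surj _ hb; first by nia.
by exists p; rewrite // raddfB /= e subrr.
Qed.

Section Kernel.
Variable p : P.
Hypothesis hp : wge n m (n * m).+1 p.
Let q := binomial_xy n m c - p.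
Hypothesis q0 : phi q = 0.

(** The form of [h] vanishes at the point of the branch, so it is a multiple of the
    binomial, the initial form of [q]. *)
Lemma reduce_mod_branch d h : wge n m d h -> (scoef (phi h) d) = 0 ->
  wge n m d.+1 (h - bdiv n m c h * q).
Proof.
move=> hh h0.
have -> : h - bdiv n m c h * q = brem n m c h + bdiv n m c h * p.
  have := binomial_division n0 m0 c h; rewrite /q.
  by move: (bdiv _ _ _ _) (brem _ _ _ _) (binomial_xy _ _ _) => A B C ->; ring.
apply: wgeD.
  apply: (brem_lead0 n0 m0 b0 a0 cE nm hh).
  by rewrite -wsubst_lead.
apply: wgeM_sw hp => i j ij.
by apply: (swge_bdiv n0 m0 c hh); lia.
Qed.

Lemma branch_kernel h : phi h = 0 -> exists u, h = u * q.
Proof.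
move=> hh.
have [|||||u _ <-] := @filtered_surj P P (fun e => swge n m (n * m) e)
    (fun e => wge n m e) (fun h => phi h = 0) ( *%R^~ q) (fun x y => mulrBl q x y)
    (@swge_complete K n m (n * m) n0 m0) _ _ _ _ h _ hh.
- move=> e u hu; apply: wgeM_sw hu _; apply: wgeB; first exact: wge_binomial.
  exact: wge_le hp.
- by move=> e u w; apply: wgeB.
- by move=> u; apply: wge_sep.
- move=> e u hu u0; exists (bdiv n m c u); split.
  + exact: swge_bdiv.
  + by apply: reduce_mod_branch; rewrite // u0 scoef0.
  + by rewrite phiB phiM q0 mulr0 u0 subr0.
- by [].
by exists u.
Qed.

(** Modulo [q] one may increase the weight of [h] until its form does not vanish at
    the point of the branch; then the order on the branch is that weight. *)
Lemma branch_order h k : oge k (phi h) -> scoef (phi h) k != 0 ->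
  in_semigroup n m k.
Proof.
move=> hk hk0.
have : exists2 h', wge n m k h' & phi h' = phi h.
  elim: k hk {hk0} => [|k IHk] hk; first by exists h.
  have [h' hh e] := IHk (oge_le (leqnSn _) hk).
  exists (h' - bdiv n m c h' * q).
    by apply: reduce_mod_branch; rewrite // e hk.
  by rewrite phiB phiM q0 mulr0 subr0.
case=> h' hh e; move: hk0; rewrite -e wsubst_lead // => /eqP l0.
apply: contrapT => nS; apply: l0; rewrite /lead big1 // => i _.
rewrite big1 // => j _; case: eqP => // ij; case: nS.
by apply/in_semigroupP => //; exists i, j.
Qed.

End Kernel.

Lemma branch_weighted : exists (q : P) (delta : nat),
  [/\ branch phi q delta, (2 * delta = n.-1 * m.-1)%N, wge n m (n * m) q &
      wcomp n m (n * m) q = binomial_xy n m c].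
Proof.
have [p hp q0] := branch_equation.
exists (binomial_xy n m c - p), (size (semigroup_gaps n m)).
have hb := @wge_binomial K n m c.
split; last 3 first.
- exact: size_semigroup_gaps.
- by apply: wgeB => //; apply: wge_le hp.
- rewrite wcompB (wcomp_wge0 hp) subr0 wcomp_isobaric //; exact: isobaric_binomial.
split.
- move=> h; split; first exact: branch_kernel.
  by case=> u ->; rewrite -[LHS]/(phi _) phiM q0 mulr0.
- by exists (n.-1 * m.-1)%N => v /(wsubst_surj (leqnn _))[f _]; exists f.
exists (semigroup_gaps n m); split=> // [|k]; first exact: uniq_semigroup_gaps.
rewrite mem_semigroup_gaps //; split.
  by move=> /negP nS [h [h1 h2]]; apply: nS; apply: (branch_order hp q0 h1 h2).
move=> nex; apply/negP => kS; apply: nex.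
have [i [j [im ij]]] := semigroup_small n0 m0 nm kS.
exists (mono K i j).
have hw : wge n m k (mono K i j) by rewrite -ij; apply: wge_mono.
split; first exact: oge_wsubst.
rewrite wsubst_lead // -ij lead_mono //.
by rewrite mulf_neq0 ?(expf_neq0 _ b0) ?(pow_small_neq0 a0).
Qed.

End Param.

(** * Splitting off a branch *)

Section Swap.
Variable K : fieldType.
Local Notation P := {fps2 K}.
Local Notation L := (series K).
Implicit Types (f g h q p u : P).

Definition swap f : P := Fps2 (fun i j => f j i).

Lemma swapE f i j : swap f i j = f j i. Proof. by []. Qed.

Lemma swapK : involutive swap. Proof. by move=> f; apply: fps2P. Qed.

Fact swap_linear : linear swap. Proof. by move=> c f g; apply: fps2P. Qed.
HB.instance Definition _ := GRing.isLinear.Build K P P _ swap swap_linear.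

Fact swap_monoid : monoid_morphism swap.
Proof.
split=> [|f g]; first by apply: fps2P => i j; rewrite swapE !fps21E andbC.
apply: fps2P => i j; rewrite swapE !fps2ME exchange_big.
by apply: eq_bigr => a _; apply: eq_bigr.
Qed.
HB.instance Definition _ := GRing.isMonoidMorphism.Build P P swap swap_monoid.

Lemma wge_swap n m d f : wge n m d f -> wge m n d (swap f).
Proof. by move=> hf i j ij; apply: hf; rewrite addnC. Qed.

Lemma lead_swap n m d f a b : lead m n d (swap f) b a = lead n m d f a b.
Proof.
rewrite /lead exchange_big; apply: eq_bigr => i _; apply: eq_bigr => j _.
by rewrite addnC swapE [_ ^+ j * _]mulrC.
Qed.

Definition leady n m d f a b := leadx m n d (swap f) b a.

Lemma branch_swap (phi : {lrmorphism P -> L}) q delta :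
  branch phi q delta -> branch (phi \o swap) (swap q) delta.
Proof.
case=> h1 [N h2] [G [h3 h4 h5]]; split.
- move=> h /=; rewrite h1; split=> -[u e]; exists (swap u).
    by rewrite -[h]swapK e rmorphM.
  by rewrite e rmorphM /= swapK.
- by exists N => v /h2[h <-]; exists (swap h); rewrite /= swapK.
exists G; split=> // k; rewrite h5; split=> nex [h hh]; apply: nex.
  by exists (swap h).
by exists (swap h); rewrite /= swapK.
Qed.

End Swap.

Arguments leady {K} (n m d)%_N f a b.

Section Smooth.
Variable K : fieldType.
Local Notation P := {fps2 K}.
Local Notation L := (series K).
Implicit Types (f g h q p u : P).

(** The curve cut out by the form of weight [d] of [f] has no singular point but
    the origin. *)
Definition smooth n m d f := forall a b : K, (a != 0) || (b != 0) ->
  lead n m d f a b = 0 -> (leadx n m d f a b != 0) \/ (leady n m d f a b != 0).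

Lemma smooth_swap n m d f : smooth n m d f -> smooth m n d (swap f).
Proof.
move=> S a b ab; rewrite lead_swap => l0; rewrite /leady swapK.
by case: (S b a _ l0); rewrite 1?orbC //; [right|left].
Qed.

Section Factor.
Variables n m : nat.
Hypotheses (n0 : (0 < n)%N) (m0 : (0 < m)%N).
Variables (d e : nat) (q f : P).
Hypotheses (hq : wge n m d q) (hf : wge n m e f).
Hypothesis S : smooth n m (d + e)%N (q * f).

Lemma leadyM a b : leady n m (d + e)%N (q * f) a b =
  leady n m d q a b * lead n m e f a b + lead n m d q a b * leady n m e f a b.
Proof.
rewrite /leady rmorphM leadxM ?lead_swap //; exact: wge_swap.
Qed.

Lemma smooth_factor : smooth n m e f.
Proof.
move=> a b ab l0; have := S ab; rewrite leadM // leadxM // leadyM l0 !mulr0 !add0r.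
case=> // /eqP h; [left|right]; apply/eqP => h'; apply: h; by rewrite h' mulr0.
Qed.

(** By the Leibniz rule, the gradient of a product vanishes at the common zeros of the
    factors. *)
Lemma smooth_sep a b : (a != 0) || (b != 0) ->
  lead n m d q a b = 0 -> lead n m e f a b != 0.
Proof.
move=> ab q0; apply/eqP => f0; have := S ab.
rewrite leadM // leadxM // leadyM q0 f0 !mulr0 !mul0r addr0.
by case=> //; rewrite eqxx.
Qed.

End Factor.
End Smooth.

Arguments smooth {K} (n m d)%_N f.

Section Peel.
Variable K : fieldType.
Local Notation P := {fps2 K}.
Local Notation L := (series K).
Implicit Types (f g h q p u : P).

(** A branch [q], with initial form of weight [w], splits off [f]; [e] is the
    intersection number of [q] with the cofactor [g]. The last equation is
    2 (e + delta) = M(d) - M(d') + 1 for M(d) = (d - n) (d - m) / (n m). *)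
Definition peels n m d f : Prop :=
  exists (phi : {lrmorphism P -> L}) q g, exists w d' e delta : nat,
  [/\ branch phi q delta, f = q * g, d = (w + d')%N & (0 < w)%N] /\
  [/\ wge n m d' g, smooth n m d' g, oge e (phi g), scoef (phi g) e != 0 &
    (2 * (e + delta) * (n * m) + w * (n + m) = w * (2 * d' + w) + n * m)%N].

Lemma peels_swap n m d f : peels n m d (swap f) -> peels m n d f.
Proof.
case=> phi [q [g [w [d' [e [delta [[h1 h2 h3 h4] [h5 h6 h7 h8 h9]]]]]]]].
exists (phi \o swap (K:=K)), (swap q), (swap g), w, d', e, delta; split; split => //.
- exact: branch_swap.
- by rewrite -rmorphM /= -h2 swapK.
- exact: wge_swap.
- exact: smooth_swap.
- by rewrite /= swapK.
- by rewrite /= swapK.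
- by rewrite [(m * n)%N]mulnC [(m + n)%N]addnC.
Qed.

Section Weights.
Variables n m : nat.
Hypotheses (n0 : (0 < n)%N) (m0 : (0 < m)%N) (nm : coprime n m).
Variables (d : nat) (f : P).
Hypotheses (hf : wge n m d f) (S : smooth n m d f).

Lemma lead_xaxis (g : P) i a : lead n m (i * n) g a 0 = g i 0%N * a ^+ i.
Proof.
rewrite /lead (sum2_only (a := i) (b := 0%N) (F := fun i' j =>
  if (i' * n + j * m == i * n)%N then g i' j * (a ^+ i' * 0 ^+ j) else 0)) //.
- by rewrite addn0 eqxx expr0 mulr1.
- by rewrite ltnS leq_pmulr.
move=> i' j _ _; case: j => [|j]; last by rewrite expr0n mulr0 mulr0 if_same.
rewrite addn0 eqn_pmul2r // xpair_eqE eqxx andbT => /negPf->.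
by [].
Qed.

(** If a form vanishes at (a, 0), it contains no power of x, hence is divisible by
    y. *)
Lemma leadx_xaxis (g : P) a : a != 0 ->
  lead n m d g a 0 = 0 -> leadx n m d g a 0 = 0.
Proof.
move=> a0 l0; rewrite /leadx big1 // => i _; rewrite big1 // => -[[|j] hj] _ /=;
  last by rewrite expr0n !mulr0 if_same.
rewrite addn0; case: eqP => // e; move: (nat_of_ord i) e => {i} i e; move: l0.
rewrite -e lead_xaxis => /eqP.
by rewrite mulf_eq0 (negPf (expf_neq0 _ a0)) orbF => /eqP->; rewrite mul0rn mul0r.
Qed.

Lemma lead_yaxis (g : P) j b : lead n m (j * m) g 0 b = g 0%N j * b ^+ j.
Proof.
rewrite /lead (sum2_only (a := 0%N) (b := j) (F := fun i j' =>
  if (i * n + j' * m == j * m)%N then g i j' * (0 ^+ i * b ^+ j') else 0)) //.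
- by rewrite add0n eqxx expr0 mul1r.
- by rewrite ltnS leq_pmulr.
move=> i j' _ _; case: i => [|i]; last by rewrite expr0n mul0r mulr0 if_same.
by rewrite add0n eqn_pmul2r // xpair_eqE eqxx /= => /negPf->.
Qed.

Lemma leadx_neq0_comp a b : leadx n m d f a b != 0 ->
  exists i j, (i * n + j * m)%N = d /\ f i j != 0.
Proof.
move=> lx; apply: contrapT => nex; case/eqP: lx.
rewrite /leadx big1 // => i _; rewrite big1 // => j _; case: eqP => // e.
suff -> : f i j = 0 by rewrite mul0rn mul0r.
by apply/eqP/negPn/negP => fij; apply: nex; exists i, j.
Qed.

Lemma peels_torus a b : a != 0 -> b != 0 ->
  lead n m d f a b = 0 -> leadx n m d f a b != 0 -> peels n m d f.
Proof.
move=> a0 b0 l0 lx.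
have [X [X0 hX]] := newton n0 m0 hf l0 lx.
have Y0 : scoef (b%:A : L) 0 = b by rewrite scoef_const.
have cE : a ^+ m / b ^+ n * scoef (b%:A : L) 0 ^+ n = scoef X 0 ^+ m.
  by rewrite Y0 X0 divfK // expf_neq0.
have [|//|q [delta [B D hq cq]]] := branch_weighted n0 m0 nm _ _ cE.
- by rewrite Y0.
- by rewrite X0 a0.
have [u fu] : exists u, f = u * q by case: B => /(_ f)[/(_ hX)].
have nmd : (n * m <= d)%N.
  rewrite leqNgt; apply/negP => dnm.
  have [i [j [ij /eqP[]]]] := leadx_neq0_comp lx.
  by have := wgeM (@wge0 _ n m u) hq; rewrite -fu; apply; rewrite ij.
have hu : wge n m (d - n * m) u.
  apply: (wge_cancel hq); first by rewrite cq binomial_neq0.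
  by rewrite subnKC // mulrC -fu.
have S' : smooth n m (n * m + (d - n * m)) (q * u) by rewrite subnKC // mulrC -fu.
have lq : lead n m (n * m) q a b = 0.
  by rewrite -lead_wcomp cq lead_binomial // divfK ?expf_neq0.
exists (wsubst n m X b%:A), q, u, (n * m)%N, (d - n * m)%N, (d - n * m)%N, delta.
split; split => //.
- by rewrite mulrC.
- by rewrite subnKC.
- by rewrite muln_gt0 n0.
- exact: smooth_factor S'.
- exact: oge_wsubst.
- rewrite wsubst_lead // X0 Y0; apply: (smooth_sep n0 m0 hq hu S') => //.
  by rewrite a0.
have E : (n.-1 * m.-1 + n + m = n * m + 1)%N.
  by case: (n) (m) n0 m0 => // n' [//|m'] _ _ /=; lia.
rewrite mulnDr D [(n * m * (n + m))%N]mulnC -mulnDl; move: E.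
move: (n * m)%N (n.-1 * m.-1)%N (d - _)%N => A B' C E.
have -> : (2 * C + B' + (n + m) = 2 * C + A + 1)%N by lia.
by rewrite addn1 -mulnSr mulnC.
Qed.

(** The form of [f] vanishes simply along x = 0, so it is x (c y^e + x (...)), but the
    branch belonging to this factor x is not determined by the form. For the weights (s, 1)
    with s the least integer larger than n / m, the form of [f] becomes
    y^e (c x + c' y^s), and the branch passes through the point (- c' / c, 1). *)
Lemma peels_yaxis b : b != 0 ->
  lead n m d f 0 b = 0 -> leadx n m d f 0 b != 0 -> peels n m d f.
Proof.
move=> b0 l0 lx.
have [e [de f1e]] : exists e, (n + e * m)%N = d /\ f 1%N e != 0.
  apply: contrapT => nex; case/eqP: lx.
  rewrite /leadx big1 // => i _; rewrite big1 // => j _; case: eqP => // ij.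
  case: (i : nat) ij => [|[|k]] ij; first by rewrite mulr0n mul0r.
    suff -> : f 1%N j = 0 by rewrite mul0rn mul0r.
    apply/eqP/negPn/negP => fij; apply: nex; exists j; split=> //.
    by rewrite -[RHS]ij mul1n.
  by rewrite /= expr0n mul0r mulr0.
have f0 j : (j * m)%N = d -> f 0%N j = 0.
  move=> jd; move: l0; rewrite -jd lead_yaxis => /eqP.
  by rewrite mulf_eq0 (negPf (expf_neq0 _ b0)) orbF => /eqP.
pose s := (n %/ m).+1.
have ns : (n < s * m)%N by rewrite ltn_ceil.
have sn j : (j * m <= n)%N -> (j < s)%N by rewrite ltnS leq_divRL.
have s0 : (0 < s)%N by [].
(* No monomial of [f] has weight less than s + e, and only x y^e and y^(s + e)
   attain it. *)
have f_big i j : f i j != 0 -> (s + e <= i * s + j)%N /\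
    ((i * s + j)%N = (s + e)%N -> (i <= 1)%N).
  move=> fij; have w : (d <= i * n + j * m)%N.
    by rewrite leqNgt; apply/negP => /hf /eqP; rewrite (negPf fij).
  case: i fij w => [|[|i]] fij w; last 1 first.
  - have : ((s + e) * m < (i.+2 * s + j) * m)%N by nia.
    rewrite ltn_pmul2r // => h; split; first exact: ltnW.
    by move=> h'; move: h; rewrite h' ltnn.
  - split=> //; rewrite mul0n add0n.
    have nj : (j * m)%N != d by apply/negP => /eqP /f0 /eqP; rewrite (negPf fij).
    have : (e * m + n < j * m)%N by lia.
    case: (leqP (s + e) j) => // js jm; have : (j - e < s)%N by lia.
    rewrite ltnS leq_divRL // mulnBl; lia.
  - split=> //; have : (e * m <= j * m)%N by lia.
    by rewrite leq_pmul2r //; lia.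
have hfs : wge s 1 (s + e) f.
  move=> i j; rewrite muln1 => ij; apply/eqP/negPn/negP => /f_big[].
  by rewrite leqNgt ij.
pose a := - (f 0%N (s + e)%N / f 1%N e).
have sum_lin (F : nat -> nat -> K) : (forall i j, (1 < i)%N -> F i j = 0) ->
    (forall i j, (i * s + j)%N != (s + e)%N -> F i j = 0) ->
    \sum_(i < (s + e).+1) \sum_(j < (s + e).+1) F i j = F 0%N (s + e)%N + F 1%N e.
  move=> F1 F2; rewrite (sum_ord_extend (a := 2) (F := fun i =>
    \sum_(j < (s + e).+1) F i j)); last 2 first.
  - by rewrite ltnS.
  - by move=> i /andP[i1 _]; rewrite big1 // => j _; apply: F1.
  rewrite big_ord_recl big_ord1 /=; congr (_ + _).
    rewrite (bigD1 ord_max) //= big1 ?addr0 // => j nj; apply: F2.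
    by rewrite mul0n add0n; apply: contraNneq nj => h; apply/eqP/val_inj.
  have he : (e < (s + e).+1)%N by rewrite ltnS leq_addl.
  rewrite (bigD1 (Ordinal he)) //= big1 ?addr0 // => j nj; apply: F2.
  rewrite mul1n eqn_add2l; apply: contraNneq nj => h; exact/eqP/val_inj.
have F0 i j (x : K) : (1 < i)%N ->
    (if (i * s + j * 1 == s + e)%N then f i j * x else 0) = 0.
  move=> i1; case: eqP => // ij; suff -> : f i j = 0 by rewrite mul0r.
  apply/eqP/negPn/negP => /f_big[_]; rewrite -[j]muln1 => /(_ ij).
  by rewrite leqNgt i1.
have la : lead s 1 (s + e) f a 1 = 0.
  rewrite /lead (sum_lin (fun i j => if (i * s + j * 1 == s + e)%N then
    f i j * (a ^+ i * 1 ^+ j) else 0)).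
  - rewrite mul0n add0n muln1 eqxx mul1n muln1 eqxx !expr1n expr0 expr1 !mulr1.
    by rewrite /a mulrN mulrC divfK // subrr.
  - by move=> i j i1; rewrite F0.
  - by move=> i j; rewrite muln1 => /negPf->.
have lxa : leadx s 1 (s + e) f a 1 != 0.
  rewrite /leadx (sum_lin (fun i j => if (i * s + j * 1 == s + e)%N then
    f i j *+ i * (a ^+ i.-1 * 1 ^+ j) else 0)).
  - rewrite mul0n add0n muln1 eqxx mul1n muln1 eqxx !expr1n expr0 !mulr1 mulr0n.
    by rewrite ?mul0r add0r.
  - by move=> i j i1; rewrite mulrnAl -mulrnAr F0.
  - by move=> i j; rewrite muln1 => /negPf->.
have [X [X0 hX]] := newton s0 (ltn0Sn 0) hfs la lxa.
have Y0 : scoef (1%:A : L) 0 = 1 by rewrite scoef_const.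
have cE : a * scoef (1%:A : L) 0 ^+ s = scoef X 0 ^+ 1.
  by rewrite Y0 X0 expr1n mulr1.
have [||q [delta [B D hq cq]]] := branch_weighted s0 (ltn0Sn 0) (coprimen1 s) _ _ cE.
- by rewrite Y0 oner_neq0.
- by rewrite orbT.
rewrite muln1 in hq cq.
have [u fu] : exists u, f = u * q by case: B => /(_ f)[/(_ hX)].
have q10 : q 1%N 0%N = 1.
  have := congr1 (fun g : P => g 1%N 0%N) cq; rewrite wcompE mul1n addn0 eqxx => ->.
  by rewrite fps2BE fps2ZE !monoE /= mulr0 subr0.
have q0j j : (j * m <= n)%N -> q 0%N j = 0.
  by move=> /sn js; apply: hq; rewrite mul0n add0n muln1.
have hqn : wge n m n q.
  move=> [|i] j ij; last by move: ij; rewrite mulSn; lia.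
  by apply: q0j; apply: ltnW.
have cqn : wcomp n m n q != 0.
  apply/eqP => /(congr1 (fun g : P => g 1%N 0%N)); rewrite fps20E wcompE mul1n mul0n.
  by rewrite addn0 eqxx q10 => /eqP; rewrite oner_eq0.
have hu : wge n m (e * m) u by apply: (wge_cancel hqn cqn); rewrite de mulrC -fu.
have S' : smooth n m (n + e * m) (q * u) by rewrite de mulrC -fu.
have lq : lead n m n q 0 b = 0.
  rewrite /lead big1 // => i _; rewrite big1 // => j _; case: eqP => // ij.
  case: (i : nat) ij => [|k] ij; last by rewrite expr0n mul0r mulr0.
  by rewrite q0j ?mul0r // -[leqRHS]ij mul0n add0n.
have ue : u 0%N e != 0.
  have := smooth_sep n0 m0 hqn hu S' (a := 0) (b := b); rewrite b0 orbT lead_yaxis.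
  by move=> /(_ isT lq); rewrite mulf_eq0 negb_or => /andP[].
have hus : wge s 1 e u.
  move=> i j ij; apply: hu; rewrite muln1 in ij.
  have : ((i * s + j) * m < e * m)%N by rewrite ltn_pmul2r.
  nia.
exists (wsubst s 1 X 1%:A), q, u, n, (e * m)%N, e, delta.
split; split => //.
- by rewrite mulrC.
- exact: smooth_factor S'.
- exact: oge_wsubst.
- rewrite wsubst_lead // X0 Y0 /lead (sum2_only (a := 0%N) (b := e) (F := fun i j =>
    if (i * s + j * 1 == e)%N then u i j * (a ^+ i * 1 ^+ j) else 0)) //.
    by rewrite mul0n add0n muln1 eqxx expr0 expr1n !mulr1.
  move=> i j _ _ nij; case: eqP => // ij; rewrite hu ?mul0r //.
  case: i nij ij => [|i]; first by rewrite mul0n add0n muln1 => + ij; rewrite ij eqxx.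
  by move=> _ <-; rewrite muln1 mulnDl ltn_add2r -mulnA ltn_pmul2l.
have -> : delta = 0%N by move: D; rewrite muln0; lia.
rewrite addn0 /= !mulnDr; lia.
Qed.

Lemma peels_x a b : (a != 0) || (b != 0) ->
  lead n m d f a b = 0 -> leadx n m d f a b != 0 -> peels n m d f.
Proof.
have [->|a0] := eqVneq a 0; first by move=> /= b0; apply: peels_yaxis.
have [->|b0 _] := eqVneq b 0; last exact: peels_torus.
by move=> _ /(leadx_xaxis a0) ->; rewrite eqxx.
Qed.

End Weights.
End Peel.

Section Closed.
Variable K : closedFieldType.
Local Notation P := {fps2 K}.
Implicit Types (f : P).

(** The form restricted to a = 1 is a polynomial in b; if it has no root it is a
    constant, that is the form is a power of x, and vanishes at (0, 1). *)
Lemma lead_has_zero n m d f : (0 < n)%N -> (0 < m)%N -> (0 < d)%N ->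
  exists a b : K, (a != 0) || (b != 0) /\ lead n m d f a b = 0.
Proof.
move=> n0 m0 d0.
pose p : {poly K} := \sum_(i < d.+1) \sum_(j < d.+1)
  if (i * n + j * m == d)%N then f i j *: 'X^j else 0.
have pE z : p.[z] = lead n m d f 1 z.
  rewrite horner_sum; apply: eq_bigr => i _; rewrite horner_sum.
  apply: eq_bigr => j _; case: ifP => _; last exact: horner0.
  by rewrite hornerZ hornerXn expr1n mul1r.
have [p1|] := eqVneq (size p) 1%N; last first.
  move=> /closed_rootP[z /rootP]; rewrite pE => hz.
  by exists 1, z; rewrite oner_neq0.
exists 0, 1; rewrite oner_neq0 orbT; split=> //.
rewrite /lead big1 // => -[i hi] _; rewrite big1 // => -[j hj] _ /=.
case: eqP => // ij; case: i hi ij => [|i] hi ij; last by rewrite expr0n mul0r mulr0.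
suff -> : f 0%N j = 0 by rewrite mul0r.
have : p`_j = 0.
  by apply: nth_default; rewrite p1; case: j ij {hj} => // ij; move: d0; rewrite -ij.
rewrite coef_sum => <-.
transitivity (\sum_(i < d.+1) \sum_(j' < d.+1)
  if (i * n + j' * m == d)%N then f i j' * (j == j')%:R else 0).
  apply/esym; rewrite (sum2_only (a := 0%N) (b := j) (F := fun i j' =>
    if (i * n + j' * m == d)%N then f i j' * (j == j')%:R else 0)) //.
    by rewrite ij eqxx eqxx mulr1.
  move=> i j' _ _ nij; case: eqP => // e; case: eqP => [jj|_]; last by rewrite mulr0.
  by case/eqP: nij; rewrite -jj; congr (_, _); move: e; rewrite -jj -ij; nia.
apply: eq_bigr => i _; rewrite coef_sum; apply: eq_bigr => j' _.
by case: ifP; rewrite ?coef0 // coefZ coefXn.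
Qed.

(** A zero of the form where the y-derivative does not vanish is handled by exchanging
    the variables. *)
Lemma peel n m d f : (0 < n)%N -> (0 < m)%N -> coprime n m ->
  wge n m d f -> smooth n m d f -> (0 < d)%N -> peels n m d f.
Proof.
move=> n0 m0 nm hf S d0; have [a [b [ab l0]]] := lead_has_zero f n0 m0 d0.
case: (S a b ab l0) => lx; first exact: (peels_x n0 m0 nm hf S ab).
apply: peels_swap; apply: (peels_x m0 n0 _ _ (smooth_swap S) (a := b) (b := a)) => //.
- by rewrite coprime_sym.
- exact: wge_swap.
- by rewrite orbC.
- by rewrite lead_swap.
Qed.

End Closed.

(** * Assembling the branches *)

Section Codim.
Variable K : fieldType.
Local Notation P := {fps2 K}.
Local Notation L := (series K).
Implicit Types (f g h q p u : P) (v w : L).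

Lemma oge_divides_shift d e (s v : L) :
  oge d s -> scoef s d != 0 -> oge (d + e) v -> exists2 r, oge e r & v = s * r.
Proof.
move=> hs sd hv.
have [v' ev] : exists v', v = sT K ^+ e * v' /\ oge d v'.
  have [v' ev] := oge_split (oge_le (leq_addl _ _) hv).
  exists v'; split=> // k kd; have := hv (k + e)%N.
  by rewrite ltn_add2r ev scoefTnM leq_addl addnK; apply.
case: ev => -> /(oge_divides hs sd)[r ->].
by exists (sT K ^+ e * r); [apply: oge_TnM | rewrite mulrCA].
Qed.

Lemma order_unique k l (s : L) : oge k s -> scoef s k != 0 ->
  oge l s -> scoef s l != 0 -> k = l.
Proof.
move=> ks sk ls sl; apply/eqP; rewrite eqn_leq; apply/andP; split; rewrite leqNgt.
  by apply: contra sl => /ks->.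
by apply: contra sk => /ls->.
Qed.

(** The powers of t whose exponents are not orders of elements of the subspace [W]
    span a complement of it. *)
Lemma codim_series (W : L -> Prop) (G : seq nat) N :
    W 0 -> (forall c v w, W v -> W w -> W (c *: v + w)) -> uniq G ->
    (forall v, oge N v -> W v) ->
    (forall k, k \in G <-> ~ exists w, [/\ W w, oge k w & scoef w k != 0]) ->
  (forall v, exists c : 'I_(size G) -> K,
     W (v - \sum_k c k *: sT K ^+ nth 0%N G k)) /\
  (forall c : 'I_(size G) -> K, W (\sum_k c k *: sT K ^+ nth 0%N G k) ->
     forall k, c k = 0).
Proof.
move=> W0 WD uG WN GP; split.
  suff span v t : oge (N - t) v -> exists c : 'I_(size G) -> K,
      W (v - \sum_k c k *: sT K ^+ nth 0%N G k).
    by move=> v; apply: (span v N); rewrite subnn.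
  elim: t v => [|t IHt] v hv.
    exists (fun=> 0); apply: WN; rewrite big1 ?subr0 -1?[N]subn0 // => k _.
    by rewrite scale0r.
  case: (leqP N t) => Nt.
    by apply: IHt; have -> : (N - t = N - t.+1)%N by lia.
  set d := (N - t.+1)%N in hv.
  have dS : (N - t = d.+1)%N by rewrite /d; lia.
  have [/(nthP 0%N)[i iG di]|/negP dG] := boolP (d \in G).
    have hv' : oge (N - t) (v - scoef v d *: sT K ^+ d).
      rewrite dS; apply: ogeS; first by apply: ogeB => //; apply/ogeZ/oge_Tn.
      by rewrite scoefB scoefZ scoefTn eqxx mulr1 subrr.
    have [c hc] := IHt _ hv'.
    exists (fun k => c k + scoef v d *+ (k == Ordinal iG)).
    suff -> : \sum_k (c k + scoef v d *+ (k == Ordinal iG)) *: sT K ^+ nth 0%N G k =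
      scoef v d *: sT K ^+ d + \sum_k c k *: sT K ^+ nth 0%N G k.
      by rewrite opprD addrA.
    under eq_bigr do rewrite scalerDl.
    rewrite big_split addrC; congr (_ + _) => /=.
    rewrite (bigD1 (Ordinal iG)) //= eqxx mulr1n di big1 ?addr0 // => k /negPf->.
    by rewrite mulr0n scale0r.
  have [w [Ww ow w0]] : exists w, [/\ W w, oge d w & scoef w d != 0].
    by apply: contrapT => nex; apply: dG; apply/GP.
  have hv' : oge (N - t) (v - (scoef v d / scoef w d) *: w).
    rewrite dS; apply: ogeS; first by apply: ogeB => //; apply: ogeZ.
    by rewrite scoefB scoefZ divfK // subrr.
  have [c hc] := IHt _ hv'; exists c.
  have := WD (scoef v d / scoef w d) _ _ Ww hc.
  by rewrite addrA [_ *: w + (_ - _)]addrCA subrr addr0.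
move=> c Wc k0.
set s := \sum_k _ in Wc.
have sE j : scoef s j = \sum_k c k * (j == nth 0%N G k)%:R.
  by rewrite scoef_sum; apply: eq_bigr => k _; rewrite scoefZ scoefTn.
have sk (k : 'I_(size G)) : scoef s (nth 0%N G k) = c k.
  rewrite sE (bigD1 k) //= eqxx mulr1 big1 ?addr0 // => j jk.
  by rewrite nth_uniq // eq_sym (inj_eq val_inj) (negPf jk) mulr0.
apply/eqP/negPn/negP; rewrite -sk => /lead_neq0/series_lead[l [ol sl]].
have : l \in G.
  apply: contraNT sl => lG; rewrite sE big1 // => k _.
  case: eqP => [lk|]; last by rewrite mulr0.
  by rewrite lk mem_nth in lG.
by move/GP; apply; exists s.
Qed.

End Codim.

Section Resolution.
Variable K : fieldType.
Local Notation P := {fps2 K}.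
Local Notation L := (series K).
Implicit Types (f g h q p u : P) (v w : L).

Section Param.
Variable phi : {lrmorphism P -> L}.
Lemma param0 : phi 0 = 0. Proof. exact: rmorph0. Qed.
Lemma param1 : phi 1 = 1. Proof. exact: rmorph1. Qed.
Lemma paramD f g : phi (f + g) = phi f + phi g. Proof. exact: rmorphD. Qed.
Lemma paramB f g : phi (f - g) = phi f - phi g. Proof. exact: rmorphB. Qed.
Lemma paramM f g : phi (f * g) = phi f * phi g. Proof. exact: rmorphM. Qed.
Lemma paramX f k : phi (f ^+ k) = phi f ^+ k. Proof. exact: rmorphXn. Qed.
Lemma param_sum (I : finType) (F : I -> P) : phi (\sum_i F i) = \sum_i phi (F i).
Proof. exact: raddf_sum. Qed.
Lemma paramZ c f : phi (c *: f) = c *: phi f. Proof. exact: linearZ. Qed.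
End Param.

(** The [Phi i] identify K[[t]]^r with the normalisation of K[[x,y]]/(f); the [B k] are
    a basis of the quotient of K[[t]]^r by the image of K[[x,y]]. *)
Record normalization f r (delta : nat) (Phi : 'I_r -> {lrmorphism P -> L})
    (B : 'I_delta -> 'I_r -> L) : Prop := Normalization {
  norm_ker : forall h, (forall i, Phi i h = 0) <-> exists u, h = u * f;
  norm_conductor : exists N, forall v : 'I_r -> L, (forall i, oge N (v i)) ->
    exists h, forall i, Phi i h = v i;
  norm_span : forall v : 'I_r -> L, exists (c : 'I_delta -> K) h,
    forall i, v i - \sum_k c k *: B k i = Phi i h;
  norm_free : forall (c : 'I_delta -> K) h,
    (forall i, \sum_k c k *: B k i = Phi i h) -> forall k, c k = 0 }.

Definition resolved f r delta : Prop := nb_irreducible_factors f r /\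
  exists Phi B, @normalization f r delta Phi B.

Lemma resolved_unit f : f \is a GRing.unit -> resolved f 0 0.
Proof.
move=> fu; split; first by exists f, (fun=> 0); rewrite big_ord0 mulr1; split => // -[].
have noI (i : 'I_0) : False by case: i.
exists (fun i => False_rect _ (noI i)), (fun i => False_rect _ (noI i)); split.
- by move=> h; split=> [_|_ []//]; exists (h / f); rewrite divrK.
- by exists 0%N => v _; exists 0 => -[].
- by move=> v; exists (fun=> 0), 0 => -[].
- by move=> c h _ [].
Qed.

(** [q] generates the kernel of a morphism to a domain, so it is prime. *)
Lemma branch_irreducible (phi : {lrmorphism P -> L}) q delta :
  branch phi q delta -> q != 0 -> irreducible_fps2 q.
Proof.
move=> [ker _ _] q0; have qq : phi q = 0 by apply/ker; exists 1; rewrite mul1r.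
split=> // [|u v].
  apply/negP => /unitrP[w [/(congr1 phi)]]; rewrite paramM qq mulr0 param1.
  by move/esym/eqP; rewrite oner_eq0.
have unit_r a b : q = a * b -> phi a = 0 -> b \is a GRing.unit.
  move=> e /ker[w aw]; apply/unitrP; exists w; rewrite [b * w]mulrC; split;
    apply: (mulIf q0); rewrite mul1r {2}e aw; ring.
move=> e; have := qq; rewrite e paramM => /seriesM_eq0[h|h].
  by right; apply: unit_r h.
by left; apply: (unit_r v); rewrite // mulrC.
Qed.

(** A series vanishing on one branch is killed, modulo [f], by a series of the
    conductor that vanishes on all other branches. *)
Lemma normalization_zerodiv f r delta Phi B : @normalization f r delta Phi B ->
  forall h i, Phi i h = 0 -> exists2 g, (forall u, g <> u * f) &
    exists u, h * g = u * f.
Proof.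
move=> [ker [N cond] _ _] h i hi.
have [|g hg] := cond (fun j => if j == i then sT K ^+ N else 0).
  by move=> j; case: ifP => _; [exact: oge_Tn | move=> k _; rewrite scoef0].
exists g => [u gu|].
  have : Phi i g = 0 by apply: (proj2 (ker g)); exists u.
  rewrite hg eqxx => /(congr1 (fun s => scoef s N)); rewrite scoefTn eqxx scoef0.
  by move/eqP; rewrite oner_eq0.
apply/ker => j; rewrite paramM hg; case: eqP => [->|_]; last by rewrite mulr0.
by rewrite hi mul0r.
Qed.

Section AddBranch.
Variables (f q g : P) (r delta : nat) (phi : {lrmorphism P -> L}) (delta0 e : nat).
Variables (Phi : 'I_r -> {lrmorphism P -> L}) (B : 'I_delta -> 'I_r -> L).
Hypotheses (f0 : f != 0) (fqg : f = q * g) (Bq : branch phi q delta0).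
Hypotheses (ge : oge e (phi g)) (ge0 : scoef (phi g) e != 0).
Hypothesis N : normalization g Phi B.

Let q0 : q != 0. Proof. by apply: contraNneq f0 => h; rewrite fqg h mul0r. Qed.

Let phiq0 : phi q = 0.
Proof. by case: Bq => ker _ _; apply/ker; exists 1; rewrite mul1r. Qed.

Let phig0 : phi g <> 0. Proof. exact: lead_neq0 ge0. Qed.

(** If [q] vanished on a branch of [g], it would be a zero divisor modulo [g], which is
    impossible as [q] is prime and does not divide [g]. *)
Lemma other_branch_neq0 i : Phi i q <> 0.
Proof.
case: Bq => ker _ _ hq; have [h nh [k hk]] := normalization_zerodiv N hq.
have : phi k = 0.
  apply: contrapT => k0; have := congr1 phi hk; rewrite !paramM phiq0 mul0r.
  by move/esym/seriesM_eq0 => -[].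
case/ker=> k' kk; apply: (nh k'); apply: (mulfI q0); rewrite hk kk; ring.
Qed.

Definition cons_branch (i : 'I_r.+1) : {lrmorphism P -> L} :=
  if unlift ord0 i is Some j then Phi j else phi.

Lemma cons_branch0 : cons_branch ord0 = phi.
Proof. by rewrite /cons_branch unlift_none. Qed.
Lemma cons_branchS i : cons_branch (lift ord0 i) = Phi i.
Proof. by rewrite /cons_branch liftK. Qed.

Lemma forall_cons_branch (Q : 'I_r.+1 -> Prop) :
  Q ord0 -> (forall i, Q (lift ord0 i)) -> forall i, Q i.
Proof. by move=> h0 hS i; case: (unliftP ord0 i) => [j ->|->]. Qed.

Lemma cons_branch_ker h :
  (forall i, cons_branch i h = 0) <-> exists u, h = u * f.
Proof.
case: (N) => ker _ _ _; case: Bq => kerq _ _; split=> [h0|[u ->]].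
  have [|u hu] := (proj1 (ker h)) _; first by move=> i; rewrite -cons_branchS.
  have : phi u * phi g = 0 by rewrite -paramM -hu -cons_branch0.
  by case/seriesM_eq0 => [/kerq[w uw]|//]; exists w; rewrite hu uw fqg mulrA.
apply: forall_cons_branch => [|i].
  by rewrite cons_branch0 fqg !paramM phiq0 mul0r mulr0.
by rewrite cons_branchS; apply: (proj2 (ker _)); exists (u * q); rewrite fqg mulrA.
Qed.

(** Multiples of [q] reach the tuples supported on the old branches, and multiples
    of [g] those supported on the new one. *)
Lemma cons_branch_conductor : exists M, forall v : 'I_r.+1 -> L,
  (forall i, oge M (v i)) -> exists h, forall i, cons_branch i h = v i.
Proof.
case: (N) => ker [M1 cond] _ _; case: Bq => kerq [M2 condq] _.
have [o ho] := choice (fun i => series_lead (@other_branch_neq0 i)).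
exists ((\max_i o i) + M1 + (e + M2))%N => v hv.
have ex i : exists w, oge M1 w /\ v (lift ord0 i) = Phi i q * w.
  have [o1 o2] := ho i.
  have [|w ow ->] := @oge_divides_shift K (o i) M1 _ (v (lift ord0 i)) o1 o2.
    apply: oge_le (hv _); rewrite -addnA leq_add ?leq_addr //.
    exact: leq_bigmax_cond.
  by exists w.
have [s hs] := choice ex.
have [|h1 hh1] := cond s; first by move=> i; case: (hs i).
have [|w ow vw] := oge_divides_shift (e := M2) ge ge0 (v := v ord0 - phi (q * h1)).
  by rewrite paramM phiq0 mul0r subr0; apply: oge_le (hv _); rewrite leq_addl.
have [h2 hh2] := condq _ ow.
exists (q * h1 + h2 * g); apply: forall_cons_branch => [|i].
  by rewrite cons_branch0 paramD [phi (h2 * _)]paramM hh2 [w * _]mulrC -vw addrC subrK.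
rewrite cons_branchS paramD !paramM hh1 (_ : Phi i g = 0) ?mulr0 ?addr0.
  by case: (hs i).
by apply: (proj2 (ker _)); exists 1; rewrite mul1r.
Qed.

(** The series vanishing on all old branches are the multiples of [g], so the image of
    K[[x,y]] meets the new factor K[[t]] in phi(g) phi(K[[x,y]]). The orders missing
    there are 0, ..., e - 1 and the gaps of the branch shifted by [e]. *)
Lemma new_factor_codim : exists G : seq nat, [/\ size G = (e + delta0)%N,
  forall v, exists (c : 'I_(size G) -> K) h,
     v - \sum_k c k *: sT K ^+ nth 0%N G k = phi g * phi h &
  forall (c : 'I_(size G) -> K) h,
     \sum_k c k *: sT K ^+ nth 0%N G k = phi g * phi h -> forall k, c k = 0].
Proof.
case: Bq => _ [M condq] [G0 [uG0 sG0 GP0]].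
pose G := iota 0 e ++ [seq (e + k)%N | k <- G0].
have memG k : (k \in G) = (k < e)%N || ((e <= k)%N && ((k - e)%N \in G0)).
  rewrite mem_cat mem_iota /= add0n; congr (_ || _).
  apply/mapP/andP => [[j jG ->]|[ek kG]]; first by rewrite leq_addr addKn.
  by exists (k - e)%N; rewrite ?subnKC.
have uG : uniq G.
  rewrite cat_uniq iota_uniq map_inj_uniq ?uG0 ?andbT; last exact: addnI.
  by apply/hasPn => k /mapP[j _ ->]; rewrite mem_iota /= add0n -leqNgt leq_addr.
have [|||||span free] := @codim_series K (fun w => exists h, w = phi g * phi h) G (e + M)%N.
- by exists 0; rewrite param0 mulr0.
- move=> c v w [h1 ->] [h2 ->]; exists (c *: h1 + h2).
  by rewrite paramD paramZ mulrDr -scalerAr.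
- exact: uG.
- move=> v /(oge_divides_shift ge ge0)[w /condq[h <-] ->]; by exists h.
- move=> k; rewrite memG; split.
    move=> hk [w [[h ->] ow wk]]; case/orP: hk => [ke|/andP[ek /GP0]].
      by case/eqP: wk; apply: (ogeM ge (oge0 (phi h))); rewrite addn0.
    apply; have /series_lead[l [ol hl]] : phi h <> 0.
      by move=> h0; case/eqP: wk; rewrite h0 mulr0 scoef0.
    have kl : k = (e + l)%N.
      apply: (order_unique ow wk); first exact: ogeM.
      by rewrite scoefM_lead // mulf_neq0.
    by exists h; rewrite kl addKn.
  move=> nex; case: ltnP => //= ek; apply/GP0 => -[h [oh hh]]; apply: nex.
  exists (phi g * phi h); split; first by exists h.
    by rewrite -(subnKC ek); apply: ogeM.
  by rewrite -(subnKC ek) scoefM_lead // mulf_neq0.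
exists G; split.
- by rewrite size_cat size_iota size_map sG0.
- by move=> v; have [c [h hh]] := span v; exists c, h.
- by move=> c h hh; apply: free; exists h.
Qed.

End AddBranch.

(** The codimension of the image is the codimension of its projection to the old
    factors plus that of its intersection with the new one. *)
Lemma resolved_branch f q g r delta phi delta0 e :
    f != 0 -> f = q * g -> branch phi q delta0 ->
    oge e (phi g) -> scoef (phi g) e != 0 ->
  resolved g r delta -> resolved f r.+1 (delta + (e + delta0)).
Proof.
move=> f0 fqg Bq ge ge0 [[u [qs [uu irr gE]]] [Phi [B N]]]; split.
  exists u, (fun i => if unlift ord0 i is Some j then qs j else q); split=> //.
    apply: forall_cons_branch => [|i]; last by rewrite liftK.
    rewrite unlift_none; apply: branch_irreducible Bq _.
    by apply: contraNneq f0 => q0; rewrite fqg q0 mul0r.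
  rewrite big_ord_recl unlift_none fqg gE mulrCA; congr (_ * (_ * _)).
  by apply: eq_bigr => i _; rewrite liftK.
have [G [sG span free]] := new_factor_codim Bq ge ge0.
rewrite -sG; exists (cons_branch phi Phi).
pose B' (k : 'I_(delta + size G)) (i : 'I_r.+1) : L :=
  match split k, unlift ord0 i with
  | inl k', Some i' => B k' i'
  | inl _, None => 0
  | inr _, Some _ => 0
  | inr k', None => sT K ^+ nth 0%N G k'
  end.
have sumS (c : 'I_(delta + size G) -> K) i : \sum_k c k *: B' k (lift ord0 i) =
    \sum_(k < delta) c (lshift _ k) *: B k i.
  rewrite big_split_ord /= [X in _ + X]big1 ?addr0.
    by apply: eq_bigr => k _; rewrite /B' (unsplitK (inl k)) liftK.
  by move=> k _; rewrite /B' (unsplitK (inr k)) liftK scaler0.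
have sum0 (c : 'I_(delta + size G) -> K) : \sum_k c k *: B' k ord0 =
    \sum_(k < size G) c (rshift _ k) *: sT K ^+ nth 0%N G k.
  rewrite big_split_ord /= big1 ?add0r.
    by apply: eq_bigr => k _; rewrite /B' (unsplitK (inr k)) unlift_none.
  by move=> k _; rewrite /B' (unsplitK (inl k)) unlift_none scaler0.
have [ker _ spang freeg] := N.
have Phig i : Phi i g = 0.
  by apply: (proj2 (ker _)); exists 1; rewrite mul1r.
exists B'; split.
- exact: (cons_branch_ker fqg Bq ge0 N).
- exact: (cons_branch_conductor f0 fqg Bq ge ge0 N).
- move=> v; have [c1 [h1 hh1]] := spang (fun i => v (lift ord0 i)).
  have [c2 [h2 hh2]] := span (v ord0 - phi h1).
  exists (fun k => match split k with inl k' => c1 k' | inr k' => c2 k' end), (h1 + g * h2).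
  apply: forall_cons_branch => [|i].
    rewrite sum0 cons_branch0 paramD [phi (g * _)]paramM -hh2.
    rewrite [RHS]addrCA addrA subrK; congr (_ - _).
    by apply: eq_bigr => k _; rewrite (unsplitK (inr k)).
  rewrite sumS cons_branchS paramD [Phi i (g * _)]paramM Phig mul0r addr0 -hh1.
  by congr (_ - _); apply: eq_bigr => k _; rewrite (unsplitK (inl k)).
move=> c h hh.
have c1 k : c (lshift _ k) = 0.
  apply: (freeg (fun k => c (lshift _ k)) h) => i.
  by rewrite -sumS hh cons_branchS.
have [|w hw] := (proj1 (ker h)) _.
  move=> i; rewrite -(cons_branchS phi) -hh sumS big1 // => k _.
  by rewrite c1 scale0r.
have c2 k : c (rshift _ k) = 0.
  apply: (free (fun k => c (rshift _ k)) w).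
  by rewrite -sum0 hh cons_branch0 hw paramM mulrC.
by move=> k; rewrite -(splitK k); case: (split k) => k'; [apply: c1|apply: c2].
Qed.

End Resolution.

Section Induction.
Variable K : closedFieldType.
Local Notation P := {fps2 K}.
Implicit Types (f : P).

Lemma smooth_neq0 n m d f : smooth n m d f -> f != 0.
Proof.
move=> S; apply/eqP => f0.
have z (i j : nat) : f i j = 0 by rewrite f0 fps20E.
have l0 n' m' a b : lead n' m' d f a b = 0.
  by rewrite /lead big1 // => i _; rewrite big1 // => j _; rewrite z mul0r if_same.
have := S 1 0; rewrite oner_neq0 => /(_ isT (l0 _ _ _ _)).
rewrite /leady /leadx.
by case=> /eqP; apply; rewrite big1 // => i _; rewrite big1 // => j _;
  rewrite ?swapE z mul0rn mul0r if_same.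
Qed.

(** The equation is 2 delta = M(d) + r - 1, with M(d) = (d - n) (d - m) / (n m),
    multiplied by n m. *)
Lemma smooth_resolved n m d f : (0 < n)%N -> (0 < m)%N -> coprime n m ->
  wge n m d f -> smooth n m d f -> exists r delta, resolved f r delta /\
  (2 * delta * (n * m) + d * (n + m) = d * d + r * (n * m))%N.
Proof.
move=> n0 m0 nm; elim/ltn_ind: d f => d IH f hf S.
case: (posnP d) => [d0|d0].
  exists 0%N, 0%N; split; last by rewrite d0.
  apply/resolved_unit/fps2_unit; have := S 1 0; rewrite d0 oner_neq0 /lead /leady /leadx.
  rewrite !big_ord1 /= !mulr0n !mul0r !mulr1 => /(_ isT) h.
  by apply/eqP => /h []; rewrite eqxx.
have [phi [q [g [w [d' [e [delta0 [[h1 h2 h3 h4] [h5 h6 h7 h8 h9]]]]]]]]] :=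
  peel n0 m0 nm hf S d0.
have [|r [delta [hr E]]] := IH d' _ g h5 h6; first by lia.
exists r.+1, (delta + (e + delta0))%N; split.
  exact: resolved_branch (smooth_neq0 S) h2 h1 h7 h8 hr.
rewrite h3; move: E h9; move: (n * m)%N (n + m)%N => A C E h9.
have -> : (2 * (delta + (e + delta0)) * A + (w + d') * C =
  (2 * delta * A + d' * C) + (2 * (e + delta0) * A + w * C))%N by lia.
rewrite E h9; lia.
Qed.

End Induction.
Local Open Scope quotient_scope.

(** * The integral closure *)

Section Fractions.
Variable R : comNzRingType.

Lemma tofraction_inj (a b : R) :
  tofraction a = tofraction b :> total_fraction R -> a = b.
Proof. by rewrite !piE => /eqmodP/eqP /=; rewrite !mulr1. Qed.

Lemma fraction_num_den (z : total_fraction R) :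
  exists a s : R, GRing.lreg s /\ z * tofraction s = tofraction a.
Proof.
elim/quotW: z => -[[a s] rs]; exists a, s; split; first exact/asboolP.
transitivity (fraction_mul (\pi_(total_fraction R) (Prefraction rs)) (tofraction s)) => //.
by rewrite !piE; apply/eqmodP/eqP => /=; rewrite !mulr1.
Qed.

Lemma tofraction_inv (s : R) : GRing.lreg s ->
  exists t : total_fraction R, tofraction s * t = 1.
Proof.
move=> ls; have rs : regular s by apply/asboolP.
exists (\pi_(total_fraction R) (Prefrac 1 rs)).
transitivity (fraction_mul (tofraction s) (\pi_(total_fraction R) (Prefrac 1 rs))) => //.
transitivity (tofraction 1 : total_fraction R) => //.
by rewrite !piE; apply/eqmodP/eqP => /=; rewrite !(mulr1, mul1r).
Qed.

End Fractions.

Section LocalRing.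
Variables (K : fieldType) (f : plane_curve_singularity K).
Local Notation P := {fps2 K}.

Lemma tolocal_eq0 (a : P) : tolocal f a = 0 <-> exists u, a = u * pcs_val f.
Proof.
have E : (tolocal f a == tolocal f 0) = (a \in principal_idealr f).
  by rewrite -[a in RHS]subr0 Quotient.idealrBE.
by rewrite -(rmorph0 (tolocal f)); split=> [/eqP|h];
  [|apply/eqP]; rewrite E => //; [move/asboolP | apply/asboolP].
Qed.

Lemma tolocal_surj (x : local_ring f) : exists a, x = tolocal f a.
Proof. by exists (repr x); rewrite /tolocal reprK. Qed.

Variables (r delta : nat) (Phi : 'I_r -> {lrmorphism P -> series K}).
Variable B : 'I_delta -> 'I_r -> series K.
Hypothesis N : normalization f Phi B.
Local Notation L := (series K).
Local Notation Q := (total_quotient_ring f).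

Definition in_total (a : P) : Q := to_total (tolocal f a).

Lemma in_total0 : in_total 0 = 0. Proof. by rewrite /in_total !rmorph0. Qed.
Lemma in_total1 : in_total 1 = 1. Proof. by rewrite /in_total !rmorph1. Qed.
Lemma in_totalD a b : in_total (a + b) = in_total a + in_total b.
Proof. by rewrite /in_total !rmorphD. Qed.
Lemma in_totalB a b : in_total (a - b) = in_total a - in_total b.
Proof. by rewrite /in_total !rmorphB. Qed.
Lemma in_totalM a b : in_total (a * b) = in_total a * in_total b.
Proof. by rewrite /in_total !rmorphM. Qed.
Lemma in_totalZ c a : in_total (c *: a) = c *: in_total a.
Proof.
rewrite -[a in LHS]mul1r scalerAl in_totalM; congr (_ * _).
rewrite /in_total; congr to_total.
exact: (esym (mulr1 (tolocal f c%:A))).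
Qed.

Lemma in_total_eq0 a : in_total a = 0 <-> exists u, a = u * pcs_val f.
Proof.
rewrite -tolocal_eq0; split=> [|h]; last by rewrite /in_total h rmorph0.
by rewrite -in_total0 /in_total => /tofraction_inj; rewrite rmorph0.
Qed.

Definition nonzerodiv s := forall i, Phi i s <> 0.

(** By [normalization_zerodiv], a series vanishing on some branch is a zero divisor. *)
Lemma nonzerodiv_regular s : nonzerodiv s <-> GRing.lreg (tolocal f s).
Proof.
case: (N) => ker _ _ _; split=> [s0 x y|reg i si].
  have [a ->] := tolocal_surj x; have [b ->] := tolocal_surj y.
  rewrite -!rmorphM => /eqP; rewrite -subr_eq0 -rmorphB -mulrBr => /eqP.
  move=> /tolocal_eq0 /ker h; apply/eqP; rewrite -subr_eq0 -rmorphB; apply/eqP.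
  apply/tolocal_eq0/ker => i; have := h i; rewrite paramM => /seriesM_eq0[/s0 //|//].
have [g ng /tolocal_eq0 sg] := normalization_zerodiv N si.
have : tolocal f g = 0 by apply: reg; rewrite mulr0 -rmorphM.
by move/tolocal_eq0 => [u /ng].
Qed.

Lemma fraction_good (z : Q) :
  exists a s, nonzerodiv s /\ z * in_total s = in_total a.
Proof.
have [x [y [ry e]]] := fraction_num_den z.
have [a ax] := tolocal_surj x; have [s sy] := tolocal_surj y.
by exists a, s; split; [apply/nonzerodiv_regular; rewrite -sy | rewrite /in_total -ax -sy].
Qed.

Lemma in_total_inv s : nonzerodiv s -> exists t : Q, in_total s * t = 1.
Proof. by move=> /nonzerodiv_regular /tofraction_inv. Qed.

(** Graph of the partial isomorphism between the total quotient ring and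
    K((t))^r, restricted to the values in K[[t]]^r. *)
Definition expansion (z : Q) (b : 'I_r -> L) := exists a s,
  [/\ nonzerodiv s, z * in_total s = in_total a & forall i, Phi i a = Phi i s * b i].

Lemma expansion_frac z b a s : expansion z b -> z * in_total s = in_total a ->
  forall i, Phi i a = Phi i s * b i.
Proof.
case: (N) => ker _ _ _ [a' [s' [s0 e hb]]] e' i.
have : in_total (a * s' - a' * s) = 0.
  by rewrite in_totalB !in_totalM -e -e' mulrAC subrr.
move/in_total_eq0/ker/(_ i)/eqP; rewrite paramB !paramM hb subr_eq0 => /eqP h.
apply: (series_mulfI (s0 i)); rewrite mulrC h mulrAC mulrA; ring.
Qed.

Lemma expansion_iota a b : expansion (in_total a) b <-> forall i, b i = Phi i a.
Proof.
split=> [h i|h].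
  by have := expansion_frac (a := a) (s := 1) h; rewrite in_total1 mulr1 => /(_ erefl i) ->;
    rewrite param1 mul1r.
exists a, 1; split=> [i||i]; rewrite ?param1 ?in_total1 ?mulr1 ?mul1r //.
by apply/eqP; rewrite oner_neq0.
Qed.

Lemma nonzerodivM s s' : nonzerodiv s -> nonzerodiv s' -> nonzerodiv (s * s').
Proof. by move=> h h' i; rewrite paramM; apply: series_mulf_neq0. Qed.

Lemma expansionD z z' b b' : expansion z b -> expansion z' b' ->
  expansion (z + z') (fun i => b i + b' i).
Proof.
move=> [a [s [s0 e h]]] [a' [s' [s0' e' h']]].
exists (a * s' + a' * s), (s * s'); split; first exact: nonzerodivM.
  by rewrite in_totalD !in_totalM -e -e'; ring.
by move=> i; rewrite paramD !paramM h h'; ring.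
Qed.

Lemma expansionM z z' b b' : expansion z b -> expansion z' b' ->
  expansion (z * z') (fun i => b i * b' i).
Proof.
move=> [a [s [s0 e h]]] [a' [s' [s0' e' h']]].
exists (a * a'), (s * s'); split; first exact: nonzerodivM.
  by rewrite !in_totalM -e -e'; ring.
by move=> i; rewrite !paramM h h'; ring.
Qed.

Lemma expansionZ c z b : expansion z b -> expansion (c *: z) (fun i => c *: b i).
Proof.
move=> [a [s [s0 e h]]]; exists (c *: a), s; split=> //.
  by rewrite -scalerAl e in_totalZ.
by move=> i; rewrite paramZ h scalerAr.
Qed.

Lemma eq_expansion z b b' : (forall i, b i = b' i) -> expansion z b -> expansion z b'.
Proof.
by move=> bb [a [s [s0 e h]]]; exists a, s; split=> // i; rewrite -bb.
Qed.

Lemma expansion_sum (I : finType) (z : I -> Q) (b : I -> 'I_r -> L) :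
  (forall k, expansion (z k) (b k)) ->
  expansion (\sum_k z k) (fun i => \sum_k b k i).
Proof.
move=> h; rewrite -big_enum; apply: (@eq_expansion _ (fun i => \sum_(k <- enum I) b k i)).
  by move=> i; rewrite big_enum.
elim: (enum I) => [|k e IHe].
  rewrite big_nil -in_total0; apply/expansion_iota => i.
  by rewrite big_nil param0.
rewrite big_cons; apply: eq_expansion (expansionD (h k) IHe) => i.
by rewrite big_cons.
Qed.

(** Multiply by an element of the conductor. *)
Lemma expansion_exists b : exists z, expansion z b.
Proof.
case: (N) => _ [M cond] _ _.
have [s hs] := cond (fun=> sT K ^+ M) (fun=> @oge_Tn K M).
have [a ha] := cond (fun i => sT K ^+ M * b i) (fun i => @oge_TnM K M (b i)).
have s0 : nonzerodiv s.
  move=> i; rewrite hs; apply: (@lead_neq0 K M).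
  by rewrite scoefTn eqxx oner_neq0.
have [t st] := in_total_inv s0.
exists (in_total a * t), a, s; split=> // [|i]; last by rewrite ha hs.
by rewrite -mulrA [t * _]mulrC st mulr1.
Qed.

Lemma expansion_inj z b h : expansion z b -> (forall i, b i = Phi i h) -> z = in_total h.
Proof.
case: (N) => ker _ _ _ hz bh; have [a [s [s0 e ha]]] := hz.
have [t st] := in_total_inv s0.
suff E : z * in_total s = in_total h * in_total s.
  by rewrite -[z]mulr1 -[in_total h]mulr1 -st !mulrA E.
apply/eqP; rewrite e -in_totalM -subr_eq0 -in_totalB; apply/eqP/in_total_eq0/ker => i.
by rewrite paramB paramM ha bh mulrC subrr.
Qed.

(** K[[t]] is integrally closed: if z = a / s is integral and s does not divide a along
    a branch, then s = a t v there, and the equation of integrality, cleared of its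
    denominators, reads a^n (1 + t (...)) = 0. *)
Lemma integral_expansion z : integral_closure z -> exists b, expansion z b.
Proof.
case: (N) => ker _ _ _ [p /monicP lp /rootP pz].
have [a [s [s0 e]]] := fraction_good z.
suff div i : exists v, Phi i a = Phi i s * v.
  by have [b hb] := choice div; exists b, a, s.
pose n := (size p).-1.
(* The coefficients of [p] are lifted to series, the leading one to 1. *)
have [c hc] : exists c : nat -> P, c n = 1 /\ forall k, tolocal f (c k) = p`_k.
  have [c0 hc0] := choice (fun k => tolocal_surj p`_k).
  exists (fun k => if k == n then 1 else c0 k); rewrite eqxx; split=> // k.
  case: eqP => [->|_]; last by rewrite -hc0.
  by rewrite rmorph1 -lead_coefE lp.
case: hc => cn hc.
have sp : size p = n.+1.
  by rewrite prednK // size_poly_gt0 -lead_coef_eq0 lp oner_neq0.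
pose h := \sum_(k < n.+1) c k * a ^+ k * s ^+ (n - k).
have h0 : in_total h = 0.
  rewrite /in_total /h !rmorph_sum /=.
  transitivity ((map_poly (@to_total _ f) p).[z] * in_total s ^+ n); last first.
    by rewrite pz mul0r.
  rewrite (@horner_coef_wide _ n.+1) ?mulr_suml; last first.
    by rewrite -sp; apply: size_poly.
  apply: eq_bigr => k _; rewrite coef_map /= -hc !rmorphM !rmorphXn /=.
  rewrite -/(in_total _) -/(in_total a) -/(in_total s) -e exprMn -!mulrA; congr (_ * (_ * _)).
  by rewrite -exprD subnKC // -ltnS.
have {h0} : Phi i h = 0 by move: h0 => /in_total_eq0/ker/(_ i).
have -> : Phi i h = \sum_(k < n.+1) Phi i (c k) * Phi i a ^+ k * Phi i s ^+ (n - k).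
  by rewrite /h param_sum; apply: eq_bigr => k _; rewrite !paramM !paramX.
case: (series_div_or (Phi i a) (s0 i)) => // -[v hv] h0.
exfalso; apply: (s0 i); suff a0 : Phi i a = 0 by rewrite hv a0 mul0r.
move: h0; set A := Phi i a in hv *; set S := Phi i s in hv *.
have -> : \sum_(k < n.+1) Phi i (c k) * A ^+ k * S ^+ (n - k) =
    A ^+ n * \sum_(k < n.+1) Phi i (c k) * (sT K * v) ^+ (n - k).
  rewrite mulr_sumr; apply: eq_bigr => k _; rewrite hv exprMn.
  have kn : (k <= n)%N by rewrite -ltnS.
  have -> : A ^+ n = A ^+ k * A ^+ (n - k) by rewrite -exprD subnKC.
  by rewrite [RHS]mulrCA !mulrA.
case/seriesM_eq0.
  elim: (n) => [|n' IHn]; first by move/eqP; rewrite oner_eq0.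
  by rewrite exprS => /seriesM_eq0[].
move/(congr1 (fun s => scoef s 0)); rewrite scoef0 scoef_sum big_ord_recr /=.
rewrite subnn cn param1 mulr1 scoef1 eqxx big1 => [|k _].
  by rewrite add0r => /eqP; rewrite oner_eq0.
have kn : (0 < n - k)%N by rewrite subn_gt0.
by rewrite scoefM0 -(prednK kn) exprS -mulrA [X in _ * X]scoefTM mulr0.
Qed.

(** The polynomial X prod_j (X - b_j(0))^M, evaluated at (b_1, ..., b_r), lies in the
    conductor, hence comes from a series [g]; subtracting [g] gives an equation of
    integrality. The factor X ensures that it stays monic even for M = 0. *)
Lemma expansion_integral z b : expansion z b -> integral_closure z.
Proof.
case: (N) => _ [M cond] _ _ hz.
pose c i := scoef (b i) 0.
pose v i := b i * (\prod_(j < r) (b i - (c j)%:A)) ^+ M.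
have hv i : oge M (v i).
  rewrite /v (bigD1 i) //= exprMn mulrCA.
  have [w ->] : exists w, b i - (c i)%:A = sT K ^+ 1 * w.
    apply: oge_split => k; rewrite ltnS leqn0 => /eqP->.
    by rewrite scoefB scoef_const subrr.
  by rewrite exprMn expr1 -mulrA; apply: oge_TnM.
have [g hg] := cond v hv.
pose q : {poly local_ring f} := 'X * (\prod_(j < r) ('X - (tolocal f (c j)%:A)%:P)) ^+ M.
have mq : q \is monic.
  by rewrite monicMl ?monicX // monic_exp // monic_prod_XsubC.
exists (q - (tolocal f g)%:P).
  rewrite monicE lead_coefDl ?(monicP mq) // size_polyN.
  apply: (leq_ltn_trans (size_polyC_leq1 _)).
  rewrite /q mulrC size_mulX ?ltnS ?size_poly_gt0 ?monic_neq0 //.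
    by rewrite monic_exp // monic_prod_XsubC.
  by rewrite monic_exp // monic_prod_XsubC.
apply/rootP; rewrite rmorphB /= map_polyC hornerD hornerN hornerC /=.
apply/eqP; rewrite subr_eq0; apply/eqP.
apply: (@expansion_inj _ v) => [|i]; last by rewrite hg.
have -> : (map_poly (@to_total _ f) q).[z] =
    z * (\prod_(j < r) (z - in_total (c j)%:A)) ^+ M.
  rewrite /q rmorphM /= map_polyX hornerM hornerX rmorphXn horner_exp /=.
  rewrite rmorph_prod horner_prod; congr (_ * _ ^+ _); apply: eq_bigr => j _.
  by rewrite rmorphB /= map_polyX map_polyC hornerXsubC.
have prodE : expansion (\prod_(j < r) (z - in_total (c j)%:A))
    (fun i => \prod_(j < r) (b i - (c j)%:A)).
  elim: (index_enum _) => [|j e IHe].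
    rewrite big_nil -in_total1; apply/expansion_iota => i.
    by rewrite big_nil param1.
  rewrite big_cons; apply: (@eq_expansion _ (fun i =>
    (b i + Phi i (- (c j)%:A)) * \prod_(j <- e) (b i - (c j)%:A))).
    move=> i; rewrite big_cons; congr (_ * _); congr (_ + _).
    by rewrite -scaleNr paramZ param1 scaleNr.
  apply: expansionM => //; apply: expansionD => //.
  by rewrite -sub0r -in_total0 -in_totalB sub0r; apply/expansion_iota.
apply: expansionM => //; elim: M {cond v hv hg q mq g} => [|M IHM].
  by rewrite expr0 -in_total1; apply/expansion_iota => i; rewrite param1 expr0.
rewrite exprS; apply: eq_expansion (expansionM prodE IHM) => i.
by rewrite exprS.
Qed.

Lemma normalization_delta : delta_invariant f delta.
Proof.
case: (N) => ker _ span free.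
have [z hz] := choice (fun k => expansion_exists (B k)).
have hsum (c : 'rV[K]_delta) : expansion (\sum_k c 0 k *: z k)
    (fun i => \sum_k c 0 k *: B k i).
  by apply: (@expansion_sum _ _ (fun k i => c 0 k *: B k i)) => k; apply: expansionZ.
have hsub v b (c : 'rV[K]_delta) : expansion v b ->
    expansion (v - \sum_k c 0 k *: z k) (fun i => b i - \sum_k c 0 k *: B k i).
  move=> hv; have := expansionD hv (expansionZ (-1) (hsum c)).
  by rewrite scaleN1r; apply: eq_expansion => i; rewrite scaleN1r.
exists z => [k|v hv]; first exact: expansion_integral (hz k).
have [b hb] := integral_expansion hv.
have [c [h hc]] := span b.
exists (\row_k c k); split.
  exists (tolocal f h); apply: (expansion_inj (hsub _ _ _ hb)) => i.
  by rewrite -hc; congr (_ - _); apply: eq_bigr => k _; rewrite mxE.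
move=> c' [a ha]; have [h' ah] := tolocal_surj a.
have hh' : forall i, b i - \sum_k c' 0 k *: B k i = Phi i h'.
  by apply/expansion_iota; rewrite /in_total -ah -ha; apply: hsub.
apply/rowP => k; rewrite mxE; apply/eqP; rewrite -subr_eq0; apply/eqP.
apply: (free (fun k => c k - c' 0 k) (h' - h)) => i.
rewrite paramB -hh' -hc; under eq_bigr do rewrite scalerBl.
by rewrite sumrB opprB [RHS]addrC addrA subrK.
Qed.

(** If f = q^2 u, then (q u)^2 vanishes on all branches, so q u does as well and is
    divisible by f. *)
Lemma normalization_reduced : reduced f.
Proof.
case: (N) => ker _ _ _; split=> [|q u [q0 /negP nu _] fqu]; first exact: pcs_neq0.
have f0 := pcs_neq0 f; apply: nu; have [|k hk] := (proj1 (ker (q * u))) _.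
  move=> i; have : Phi i (q * u) * Phi i (q * u) = 0.
    rewrite -paramM; apply: (proj2 (ker _)); exists u; rewrite fqu; ring.
  by case/seriesM_eq0.
have qu0 : q * u != 0.
  by apply: contraNneq f0 => h; rewrite fqu expr2 -mulrA h mulr0.
apply/unitrP; exists k; rewrite [q * k]mulrC; split; apply: (mulIf qu0);
  rewrite mul1r {2}hk fqu; ring.
Qed.

End LocalRing.

(** * Quasihomogeneous complete intersections *)

Section CI.
Variable K : fieldType.
Local Notation P := {fps2 K}.
Implicit Types (f g h q p u v s : P).
Variables n m : nat.
Hypotheses (n0 : (0 < n)%N) (m0 : (0 < m)%N).

(** Complete intersections, with a quasihomogeneous basis of the quotient ring. The
    Koszul condition is what makes dimensions additive. *)
Record graded_ci f g (N : nat) (w : 'I_N -> nat) (b : 'I_N -> P) : Prop :=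
  GradedCI {
    gci_isobaric : forall i, isobaric n m (w i) (b i);
    gci_span : forall h, exists (c : 'I_N -> K) u v,
      h = \sum_i c i *: b i + u * f + v * g;
    gci_free : forall (c : 'I_N -> K) u v,
      \sum_i c i *: b i = u * f + v * g -> forall i, c i = 0;
    gci_koszul : forall u v, u * f + v * g = 0 ->
      exists s, u = s * g /\ v = - s * f }.

Definition has_graded_ci f g N := exists w b, @graded_ci f g N w b.

Lemma has_graded_ci_sym f g N : has_graded_ci f g N -> has_graded_ci g f N.
Proof.
case=> w [b [hw S F Z]]; exists w, b; split=> //.
- move=> h; have [c [u [v ->]]] := S h.
  by exists c, v, u; rewrite addrAC.
- by move=> c u v e; apply: (F c v u); rewrite e addrC.
- move=> u v; rewrite addrC => /Z[s [-> ->]].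
  by exists (- s); rewrite opprK.
Qed.

Lemma has_graded_ci_unit f g : f \is a GRing.unit -> has_graded_ci f g 0.
Proof.
move=> fu; exists (fun=> 0%N), (fun=> 0); split.
- by case.
- by move=> h; exists (fun=> 0), (h / f), 0; rewrite big_ord0 divrK // mul0r addr0 add0r.
- by move=> c u v _ [].
- move=> u v /eqP; rewrite addr_eq0 => /eqP e; exists (- v / f).
  rewrite mulNr opprK divrK //; split=> //; apply: (mulIr fu).
  by rewrite e !mulNr; congr (- _); rewrite [RHS]mulrAC divrK.
Qed.

(** Exact sequence 0 -> R/(f, g) -> R/(q f, g) -> R/(q, g) -> 0, the first map being
    the multiplication by [q]. *)
Lemma has_graded_ci_mul q f g w N1 N2 : isobaric n m w q -> q != 0 ->
  has_graded_ci q g N1 -> has_graded_ci f g N2 -> has_graded_ci (q * f) g (N1 + N2).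
Proof.
move=> hq q0 [w1 [b1 [hw1 S1 F1 Z1]]] [w2 [b2 [hw2 S2 F2 Z2]]].
exists (fun k => match split k with inl i => w1 i | inr i => (w + w2 i)%N end).
exists (fun k => match split k with inl i => b1 i | inr i => q * b2 i end).
have sumE (c : 'I_(N1 + N2) -> K) : \sum_k c k *:
    (match split k with inl i => b1 i | inr i => q * b2 i end) =
    \sum_i c (lshift _ i) *: b1 i + (\sum_i c (rshift _ i) *: b2 i) * q.
  rewrite big_split_ord /=; congr (_ + _).
    by apply: eq_bigr => i _; rewrite (unsplitK (inl i)).
  rewrite mulr_suml; apply: eq_bigr => i _; rewrite (unsplitK (inr i)) /=.
  by rewrite -scalerAl mulrC.
split.
- move=> k; case: (split k) => i; first exact: hw1.
  by apply: isobaricM.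
- move=> h; have [c1 [u1 [v1 ->]]] := S1 h; have [c2 [u2 [v2 ->]]] := S2 u1.
  exists (fun k => match split k with inl i => c1 i | inr i => c2 i end), u2, (v2 * q + v1).
  rewrite sumE.
  under [X in _ = X + _ * q + _ + _]eq_bigr do rewrite (unsplitK (inl _)).
  under [X in _ = _ + X * q + _ + _]eq_bigr do rewrite (unsplitK (inr _)).
  ring.
- move=> c u v; rewrite sumE => e.
  have c1 i : c (lshift _ i) = 0.
    apply: (F1 (fun i => c (lshift _ i)) (u * f - \sum_i c (rshift _ i) *: b2 i) v).
    move: e => /(canRL (addrK _)) ->; ring.
  have : (u * f - \sum_i c (rshift _ i) *: b2 i) * q + v * g = 0.
    move: e; rewrite big1 => [|i _]; last by rewrite c1 scale0r.
    by rewrite add0r mulrBl => ->; ring.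
  case/Z1=> s [s1 s2].
  have c2 i : c (rshift _ i) = 0.
    apply: (F2 (fun i => c (rshift _ i)) u (- s)).
    by rewrite mulNr -s1; ring.
  by move=> k; rewrite -(splitK k); case: (split k) => i; [apply: c1|apply: c2].
move=> u v e; have : u * f * q + v * g = 0 by rewrite -e; ring.
case/Z1=> s [s1 s2]; have : u * f + (- s) * g = 0 by rewrite s1 mulNr subrr.
case/Z2=> t [t1 t2]; exists t; split=> //.
by rewrite s2 t2; ring.
Qed.

Lemma has_graded_ci_add f g t N : has_graded_ci f g N -> has_graded_ci f (g + t * f) N.
Proof.
case=> w [b [hw S F Z]]; exists w, b; split=> //.
- move=> h; have [c [u [v ->]]] := S h.
  by exists c, (u - v * t), v; ring.
- move=> c u v e; apply: (F c (u + v * t) v); rewrite e; ring.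
- move=> u v e; have : (u + v * t) * f + v * g = 0 by rewrite -e; ring.
  case/Z=> s [s1 s2]; exists s; split=> //.
  by rewrite -[u](addrK (v * t)) s1 s2; ring.
Qed.

Lemma has_graded_ci_scale f g a N : a != 0 ->
  has_graded_ci f g N -> has_graded_ci f (a *: g) N.
Proof.
move=> a0 [w [b [hw S F Z]]]; exists w, b; split=> //.
- move=> h; have [c [u [v ->]]] := S h.
  by exists c, u, (a^-1 *: v); rewrite -scalerAl -scalerAr scalerA mulVf // scale1r.
- move=> c u v e; apply: (F c u (a *: v)); rewrite e.
  by rewrite -scalerAl -scalerAr.
- move=> u v e; have : u * f + (a *: v) * g = 0 by rewrite -e -scalerAl -scalerAr.
  case/Z=> s [s1 s2]; exists (a^-1 *: s); rewrite -scalerAl -scalerAr scalerA mulVf //.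
  rewrite scale1r; split=> //.
  by rewrite -[v]scale1r -(mulVf a0) -scalerA s2 scalerAl scalerN.
Qed.

Lemma isobaric_mono i j : isobaric n m (i * n + j * m) (mono K i j).
Proof.
move=> a b; rewrite monoE; case: andP => // -[/eqP-> /eqP->].
by rewrite eqxx.
Qed.

Lemma mono_neq0 i j : mono K i j != 0.
Proof.
apply/eqP => /(congr1 (fun f : P => f i j)); rewrite fps20E monoE !eqxx.
by move/eqP; rewrite oner_eq0.
Qed.

Lemma has_graded_ci_xy : has_graded_ci (mono K 1 0) (mono K 0 1) 1.
Proof.
exists (fun=> 0%N), (fun=> 1); split.
- by move=> _; have := @isobaric_mono 0 0; rewrite mono00.
- move=> h; exists (fun=> h 0%N 0%N), (Fps2 (fun a b => h a.+1 b)),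
    (Fps2 (fun a b => if a == 0%N then h a b.+1 else 0)).
  apply: fps2P => a b; rewrite big_ord1 !fps2DE fps2ZE fps21E.
  rewrite ![_ * mono K _ _]mulrC !mono_mulE /=.
  case: a b => [|a] [|b] //=; rewrite ?subn1 ?subn0 ?mulr1 ?mulr0 ?addr0 ?add0r //.
- move=> c u v; rewrite big_ord1 => /(congr1 (fun f : P => f 0%N 0%N)).
  rewrite fps2DE fps2ZE fps21E ![_ * mono K _ _]mulrC !mono_mulE /= mulr1 addr0.
  by move=> c0 i; rewrite ord1.
move=> u v e; pose s : P := Fps2 (fun a b => u a b.+1).
have us : u = s * mono K 0 1.
  apply: fps2P => a b; rewrite mulrC mono_mulE /=; case: b => [|b]; last by rewrite subn0 subn1.
  have := congr1 (fun f : P => f a.+1 0%N) e.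
  rewrite fps2DE fps20E ![_ * mono K _ _]mulrC !mono_mulE /= subn1 subn0 addr0.
  by [].
exists s; split=> //; apply: (mulIf (mono_neq0 0 1)).
by move: e => /eqP; rewrite addrC addr_eq0 => /eqP->; rewrite us; ring.
Qed.

Lemma has_graded_ci_mono i j : has_graded_ci (mono K i 0) (mono K 0 j) (i * j).
Proof.
have step k : has_graded_ci (mono K 1 0) (mono K 0 k) k.
  elim: k => [|k IHk].
    by rewrite mono00; apply/has_graded_ci_sym/has_graded_ci_unit/unitr1.
  have -> : mono K 0 k.+1 = mono K 0 1 * mono K 0 k by rewrite mono_mul.
  rewrite -[k.+1]add1n.
  apply: has_graded_ci_sym; apply: (has_graded_ci_mul (@isobaric_mono 0 1)).
  - exact: mono_neq0.
  - exact/has_graded_ci_sym/has_graded_ci_xy.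
  - exact: has_graded_ci_sym.
elim: i => [|i IHi]; first by rewrite mono00; apply/has_graded_ci_unit/unitr1.
have -> : mono K i.+1 0 = mono K 1 0 * mono K i 0 by rewrite mono_mul.
rewrite mulSn.
exact: (has_graded_ci_mul (@isobaric_mono 1 0) (mono_neq0 _ _) (step j)).
Qed.

(** * Passing from initial forms to power series *)

Section Transfer.
Variables (al be N : nat) (f g : P) (w : 'I_N -> nat) (b : 'I_N -> P).
Hypotheses (hf : wge n m al f) (hg : wge n m be g).
Hypothesis C : graded_ci (wcomp n m al f) (wcomp n m be g) w b.

Lemma wcomp_sum d (c : 'I_N -> K) : wcomp n m d (\sum_i c i *: b i) =
  \sum_i (if w i == d then c i else 0) *: b i.
Proof.
case: (C) => hw _ _ _.
apply: fps2P => i j; rewrite wcompE !fps2_sumE; case: eqP => [ij|/eqP ij].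
  apply: eq_bigr => k _; rewrite !fps2ZE; case: eqP => // /eqP wk.
  by rewrite hw ?mulr0 // ij eq_sym.
rewrite big1 // => k _; rewrite fps2ZE; case: eqP => wk; last by rewrite mul0r.
by rewrite hw ?mulr0 // wk.
Qed.

Let UT := (P * P * 'rV[K]_N)%type.

Let T (x : UT) : P := x.1.1 * f + x.1.2 * g + \sum_i x.2 0 i *: b i.

Let FU e (x : UT) := [/\ swge n m al e x.1.1, swge n m be e x.1.2 &
  forall i, (w i < e)%N -> x.2 0 i = 0].

Let TB : zmod_morphism T.
Proof.
move=> x y; rewrite /T /=; under eq_bigr do rewrite !mxE scalerBl.
rewrite sumrB; ring.
Qed.

Let FU_complete : complete_filtration FU.
Proof.
move=> u hu.
have [|s1 h1] := @swge_complete K n m al n0 m0 (fun e => (u e).1.1).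
  by move=> e; case: (hu e).
have [|s2 h2] := @swge_complete K n m be n0 m0 (fun e => (u e).1.2).
  by move=> e; case: (hu e).
exists (s1, s2, \row_i (u (w i).+1).2 0 i) => e; split=> //= i we.
rewrite !mxE; elim: e we => // e IHe; rewrite ltnS leq_eqVlt.
case/orP=> [/eqP->|we]; first by rewrite subrr.
have [_ _ /(_ i we)] := hu e; rewrite /= !mxE => /eqP; rewrite subr_eq0 => /eqP->.
exact: IHe.
Qed.

Let sub_swge (e d k : nat) (h p : P) : wge n m d h ->
  swge n m (k + d)%N e p -> (forall i j, (i * n + j * m + (k + d) != e)%N -> p i j = 0) ->
  swge n m k e.+1 (p * (h - wcomp n m d h)).
Proof.
move=> hh hp hp'; apply: swgeM (wge_subcomp hh) => i j ij; apply: hp'.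
by apply/eqP; lia.
Qed.

(** The decomposition of the initial form of [h], lifted to [f] and [g], decomposes
    [h] up to a larger weight. *)
Lemma transfer_step e h : wge n m e h -> exists x : UT, FU e x /\ wge n m e.+1 (h - T x).
Proof.
move=> hh; case: (C) => hw S _ _; have [c [u [v e1]]] := S (wcomp n m e h).
have e2 := congr1 (wcomp n m e) e1.
rewrite (wcomp_isobaric (@isobaric_wcomp _ _ _ _ _)) !wcompD wcomp_sum in e2.
rewrite !(wcompM_isobaric _ _ (@isobaric_wcomp _ _ _ _ _)) in e2.
set u' := swcomp n m al e u in e2; set v' := swcomp n m be e v in e2.
have hu' i j : (i * n + j * m + al != e)%N -> u' i j = 0.
  by rewrite /u' /= => /negPf->.
have hv' i j : (i * n + j * m + be != e)%N -> v' i j = 0.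
  by rewrite /v' /= => /negPf->.
have su : swge n m al e u' by move=> i j ij; apply: hu'; rewrite neq_ltn ij.
have sv : swge n m be e v' by move=> i j ij; apply: hv'; rewrite neq_ltn ij.
exists (u', v', \row_i (if w i == e then c i else 0)); split.
  by split=> //= i we; rewrite mxE ltn_eqF.
rewrite /T /=; under eq_bigr do rewrite mxE.
move: e2; set Sg := \sum_i _ => e2.
have -> : h - (u' * f + v' * g + Sg) = (h - wcomp n m e h)
   - u' * (f - wcomp n m al f) - v' * (g - wcomp n m be g) by rewrite e2; ring.
apply: wgeB; first apply: wgeB.
- exact: wge_subcomp.
- by apply/swge0; apply: (sub_swge (k := 0)).
- by apply/swge0; apply: (sub_swge (k := 0)).
Qed.

Lemma transfer_span h : exists (c : 'rV[K]_N) u v,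
  h - \sum_i c 0 i *: b i = u * f + v * g.
Proof.
have [|||||[[u v] c] _ <-] := @filtered_surj UT P FU (wge n m) (fun=> True) T TB
    FU_complete _ _ _ _ h _ I => //.
- move=> e [[u v] c] [/= hu hv hc]; rewrite /T /=; apply: wgeD.
    by apply: wgeD; [apply: wgeM_sw hf | apply: wgeM_sw hg].
  move=> i j ij; rewrite fps2_sumE big1 // => k _; rewrite fps2ZE.
  case: (leqP e (w k)) => we; last by rewrite hc ?mul0r.
  case: (C) => hw _ _ _; rewrite hw ?mulr0 //.
  by rewrite neq_ltn (leq_trans ij we).
- by move=> e x y; apply: wgeB.
- by move=> x; apply: wge_sep.
- by move=> e x hx _; have [y [y1 y2]] := transfer_step hx; exists y.
by exists c, u, v; rewrite /T /= addrK.
Qed.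

(** In a relation sum c_i b_i = u f + v g, the weights of u f and v g can be increased
    step by step: their lowest forms cancel, so they come from a Koszul syzygy, which is
    subtracted. Eventually the right-hand side has larger weight than all the b_i. *)
Lemma transfer_free (c : 'I_N -> K) u v :
  \sum_i c i *: b i = u * f + v * g -> forall i, c i = 0.
Proof.
move=> e1; case: (C) => hw _ F Z.
have small k u' v' : swge n m al k u' -> swge n m be k v' ->
    \sum_i c i *: b i = u' * f + v' * g -> forall i, (w i < k)%N -> c i = 0.
  move=> hu hv e i wk.
  have := F (fun j => if w j == w i then c j else 0) 0 0 _ i; rewrite eqxx.
  apply; rewrite -wcomp_sum e !mul0r addr0; apply: wcomp_wge0.
  by apply: wge_le wk _; apply: wgeD; [apply: wgeM_sw hf|apply: wgeM_sw hg].
suff all k : exists u' v', [/\ swge n m al k u', swge n m be k v' &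
    \sum_i c i *: b i = u' * f + v' * g].
  by move=> i; have [u' [v' [h1 h2 h3]]] := all (w i).+1; apply: (small _ _ _ h1 h2 h3).
elim: k => [|k [u' [v' [hu hv e]]]]; first by exists u, v.
have : swcomp n m al k u' * wcomp n m al f + swcomp n m be k v' * wcomp n m be g = 0.
  rewrite -!wcompM_sw // -wcompD -e wcomp_sum.
  have ck := F (fun j => if w j == k then c j else 0)
    (swcomp n m al k u') (swcomp n m be k v') _.
  rewrite big1 // => i _; rewrite ck ?scale0r //.
  by rewrite -!wcompM_sw // -wcompD -e wcomp_sum.
case/Z=> s [s1 s2]; pose t := swcomp n m (al + be) k s.
have idem a p : swcomp n m a k (swcomp n m a k p) = swcomp n m a k p.
  by apply: fps2P => i j /=; case: eqP.
have t1 : swcomp n m al k u' = t * wcomp n m be g.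
  by rewrite -idem s1 (swcompM_isobaric _ _ _ (@isobaric_wcomp _ _ _ _ _)).
have t2 : swcomp n m be k v' = - t * wcomp n m al f.
  rewrite -idem s2 mulNr.
  have -> p : swcomp n m be k (- p) = - swcomp n m be k p.
    by apply: fps2P => i j /=; case: eqP => _; rewrite ?oppr0.
  rewrite (swcompM_isobaric _ _ _ (@isobaric_wcomp _ _ _ _ _)) mulNr.
  by rewrite [(be + al)%N]addnC.
have ht i j : (i * n + j * m + (al + be) != k)%N -> t i j = 0.
  by rewrite /t /= => /negPf->.
have st : swge n m (al + be) k t by move=> i j ij; apply: ht; rewrite neq_ltn ij.
have swgeB a d p p' : swge n m a d p -> swge n m a d p' -> swge n m a d (p - p').
  by move=> hp hp' i j ij; rewrite fps2BE hp ?hp' ?subr0.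
have subS a p : swge n m a k p -> swge n m a k.+1 (p - swcomp n m a k p).
  move=> hp i j; rewrite ltnS leq_eqVlt fps2BE /= => /orP[->|ij]; first by rewrite subrr.
  by rewrite hp // ltn_eqF // subrr.
exists (u' - t * g), (v' + t * f); split.
- have -> : u' - t * g = (u' - swcomp n m al k u') - t * (g - wcomp n m be g).
    by rewrite t1; ring.
  by apply: swgeB; [apply: subS|apply: sub_swge].
- have -> : v' + t * f = (v' - swcomp n m be k v') - (- t) * (f - wcomp n m al f).
    by rewrite t2; ring.
  apply: swgeB; first exact: subS.
  apply: sub_swge => //; rewrite 1?[(be + al)%N]addnC.
    by move=> i j ij; rewrite fps2NE st ?oppr0.
  by move=> i j ij; rewrite fps2NE ht ?oppr0.
- by rewrite e; ring.
Qed.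

Lemma transfer_quotient_dim :
  quotient_dim (fun=> True) (fun h => exists u v, h = u * f + v * g) N.
Proof.
exists b => // h _; have [c [u [v e]]] := transfer_span h.
exists c; split; first by exists u, v.
move=> c' [u' [v' e']]; apply/rowP => i; apply/eqP; rewrite -subr_eq0; apply/eqP.
apply: (transfer_free (c := fun i => c 0 i - c' 0 i) (u := u' - u) (v := v' - v)).
under eq_bigr do rewrite scalerBl.
rewrite sumrB; have -> : (u' - u) * f + (v' - v) * g =
  (u' * f + v' * g) - (u * f + v * g) by ring.
by rewrite -e -e' opprB [RHS]addrC addrA subrK.
Qed.

End Transfer.
End CI.

(** * Weighted Bezout theorem *)

Section Bezout.
Variable K : closedFieldType.
Local Notation P := {fps2 K}.
Implicit Types (f g h q p u v s : P).
Variables n m : nat.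
Hypotheses (n0 : (0 < n)%N) (m0 : (0 < m)%N) (nm : coprime n m).

Definition prime_form q w :=
  [\/ q = mono K 1 0 /\ w = n, q = mono K 0 1 /\ w = m |
      exists2 c : K, c != 0 & q = binomial_xy n m c /\ w = (n * m)%N].

Lemma prime_form_isobaric q w : prime_form q w -> [/\ isobaric n m w q, q != 0 & (0 < w)%N].
Proof.
case=> [[-> ->]|[-> ->]|[c c0 [-> ->]]].
- split; rewrite ?mono_neq0 //.
  by have := @isobaric_mono K n m 1 0; rewrite mul1n mul0n addn0.
- split; rewrite ?mono_neq0 //.
  by have := @isobaric_mono K n m 0 1; rewrite mul1n mul0n add0n.
- split; [exact: isobaric_binomial|exact: binomial_neq0|by rewrite muln_gt0 n0].
Qed.

(** A zero of the form other than the origin gives the factor. *)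
Lemma prime_form_divides d f : isobaric n m d f -> f != 0 -> (0 < d)%N ->
  exists q w e g, [/\ prime_form q w, d = (w + e)%N, isobaric n m e g & f = q * g].
Proof.
move=> hf f0 d0.
suff [q [w [g [hq fg]]]] : exists q w g, prime_form q w /\ f = q * g.
  have [iq q0 w0] := prime_form_isobaric hq.
  have wd : (w <= d)%N.
    rewrite leqNgt; apply: contra f0 => dw; apply/eqP.
    rewrite -(wcomp_isobaric hf); apply: wcomp_wge0.
    apply: wge_le dw _; rewrite fg -[w]addn0; apply: wgeM => //.
    exact: isobaric_wge.
  exists q, w, (d - w)%N, (wcomp n m (d - w) g); split=> //.
  - by rewrite subnKC.
  - exact: isobaric_wcomp.
  - rewrite -{1}(wcomp_isobaric hf) fg mulrC (wcompM_isobaric _ _ iq) mulrC.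
    by rewrite -{1}(subnKC wd) swcomp_wcomp.
have [a [b [ab l0]]] := lead_has_zero f n0 m0 d0.
have axis_x j : a = 0 -> f 0%N j = 0.
  move=> a0; have b0 : b != 0 by move: ab; rewrite a0 eqxx.
  have [jd|jd] := eqVneq (j * m)%N d; last by rewrite hf.
  move: l0; rewrite -jd a0 lead_yaxis // => /eqP.
  by rewrite mulf_eq0 (negPf (expf_neq0 _ b0)) orbF => /eqP.
have axis_y i : b = 0 -> f i 0%N = 0.
  move=> b0; have a0 : a != 0 by move: ab; rewrite b0 eqxx orbF.
  have [id|id] := eqVneq (i * n)%N d; last by rewrite hf // addn0.
  move: l0; rewrite -id b0 lead_xaxis // => /eqP.
  by rewrite mulf_eq0 (negPf (expf_neq0 _ a0)) orbF => /eqP.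
have [a0|a0] := eqVneq a 0.
  exists (mono K 1 0), n, (Fps2 (fun i j => f i.+1 j)); split; first by constructor 1.
  apply: fps2P => i j; rewrite mono_mulE /= subn0.
  by case: i => [|i] /=; [rewrite axis_x|rewrite subn1].
have [b0|b0] := eqVneq b 0.
  exists (mono K 0 1), m, (Fps2 (fun i j => f i j.+1)); split; first by constructor 2.
  apply: fps2P => i j; rewrite mono_mulE /= subn0.
  by case: j => [|j] /=; [rewrite axis_y|rewrite subn1].
pose c := a ^+ m / b ^+ n.
have cE : c * b ^+ n = a ^+ m by rewrite divfK // expf_neq0.
exists (binomial_xy n m c), (n * m)%N, (bdiv n m c f); split.
  by constructor 3; exists c; rewrite // mulf_neq0 ?invr_eq0 ?expf_neq0.
have a0' : (a != 0) || (m == 1%N) by rewrite a0.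
have br := brem_lead0 n0 m0 b0 a0' cE nm (isobaric_wge hf) l0.
rewrite {1}(binomial_division n0 m0 c f) mulrC.
suff -> : brem n m c f = 0 by rewrite addr0.
apply: fps2P => i j; rewrite fps20E.
have [ij|ij] := ltnP (i * n + j * m) d.+1; first exact: br.
rewrite /=; case: ifP => // im; rewrite /trade big1 // => l _; case: leqP => // nl.
by rewrite hf ?mulr0 //; apply/eqP; nia.
Qed.

Definition no_common_zero d f e g := forall a b : K, (a != 0) || (b != 0) ->
  lead n m d f a b = 0 -> lead n m e g a b != 0.

Lemma no_common_zero_sym d f e g : no_common_zero d f e g -> no_common_zero e g d f.
Proof. by move=> H a b ab ga; apply/eqP => /(H a b ab); rewrite ga eqxx. Qed.

Lemma no_common_zero_factor w q d f e g : isobaric n m w q -> isobaric n m d f ->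
  no_common_zero (w + d)%N (q * f) e g ->
  no_common_zero w q e g /\ no_common_zero d f e g.
Proof.
move=> hq hf H; have M a b := leadM n0 m0 a b (isobaric_wge hq) (isobaric_wge hf).
by split=> a b ab l0; apply: (H a b ab); rewrite M l0 ?mul0r ?mulr0.
Qed.

Lemma no_common_zero_diag w q : (0 < w)%N -> ~ no_common_zero w q w q.
Proof.
move=> w0 H; have [a [b [ab l0]]] := lead_has_zero q n0 m0 w0.
by have := H a b ab l0; rewrite l0 eqxx.
Qed.

(** All pairs reduce, by invertible changes of generators, to the ideals
    (x^i, y^j). *)
Lemma graded_ci_prime_forms q w q' w' : prime_form q w -> prime_form q' w' ->
  no_common_zero w q w' q' ->
  exists2 N, has_graded_ci n m q q' N & (N * (n * m) = w * w')%N.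
Proof.
have D i j := @has_graded_ci_mono K n m i j.
have negn (c : K) : c != 0 -> - c != 0 by rewrite oppr_eq0.
have xy : has_graded_ci n m (mono K 1 0) (mono K 0 1) 1 by exact: D.
have x_bin (c : K) : c != 0 -> has_graded_ci n m (mono K 1 0) (binomial_xy n m c) n.
  move=> c0; have := has_graded_ci_add (mono K m.-1 0)
    (has_graded_ci_scale (negn _ c0) (D 1%N n)).
  by rewrite mul1n mono_mul addn1 prednK // /binomial_xy scaleNr addrC.
have y_bin (c : K) : c != 0 -> has_graded_ci n m (mono K 0 1) (binomial_xy n m c) m.
  move=> c0; have := has_graded_ci_add (- c *: mono K 0 n.-1)
    (has_graded_ci_sym (D m 1%N)).
  by rewrite muln1 -scalerAl mono_mul addn1 prednK // /binomial_xy scaleNr.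
have bin_bin (c c' : K) : c != 0 -> c' != 0 -> c != c' ->
    has_graded_ci n m (binomial_xy n m c) (binomial_xy n m c') (n * m).
  move=> c0 c'0 cc'.
  have h1 : has_graded_ci n m (mono K m 0) (binomial_xy n m c') (n * m).
    have := has_graded_ci_add 1 (has_graded_ci_scale (negn _ c'0) (D m n)).
    by rewrite mul1r mulnC /binomial_xy scaleNr addrC.
  have k0 : 1 - c / c' != 0.
    rewrite subr_eq0; apply: contra cc' => /eqP e.
    by rewrite -[c](divfK c'0) -e mul1r.
  have := has_graded_ci_add (c / c')%:A
    (has_graded_ci_scale k0 (has_graded_ci_sym h1)).
  suff -> : (1 - c / c') *: mono K m 0 + (c / c')%:A * binomial_xy n m c' =
    binomial_xy n m c by move/has_graded_ci_sym.
  rewrite -scalerAl mul1r /binomial_xy scalerBr scalerA divfK // scalerBl scale1r.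
  by rewrite addrA subrK.
case=> [[-> ->]|[-> ->]|[c c0 [-> ->]]]; case=> [[-> ->]|[-> ->]|[c' c0' [-> ->]]] H.
- by case: (no_common_zero_diag n0 H).
- by exists 1%N; rewrite ?mul1n.
- by exists n => //; exact: x_bin.
- by exists 1%N; rewrite ?mul1n 1?mulnC //; exact: has_graded_ci_sym.
- by case: (no_common_zero_diag m0 H).
- by exists m => //; exact: y_bin.
- by exists n; [exact/has_graded_ci_sym/x_bin | rewrite mulnC].
- by exists m; [exact/has_graded_ci_sym/y_bin | rewrite mulnC].
- exists (n * m)%N => //; apply: bin_bin => //; apply/eqP => cc.
  by move: H; rewrite cc; apply: no_common_zero_diag; rewrite muln_gt0 n0.
Qed.

Lemma isobaric_unit f a b : lead n m 0 f a b != 0 -> f \is a GRing.unit.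
Proof.
rewrite /lead !big_ord1 /= !expr0 !mulr1; exact: fps2_unit.
Qed.

Lemma no_common_zero_pos d f e g : isobaric n m d f -> no_common_zero d f e g ->
  (0 < e)%N -> f != 0.
Proof.
move=> hf H e0; have [a [b [ab l0]]] := lead_has_zero g n0 m0 e0.
have := no_common_zero_sym H ab l0; apply: contraNneq => ->.
by rewrite /lead big1 // => i _; rewrite big1 // => j _; rewrite fps20E mul0r if_same.
Qed.

(** Additivity in each of the two forms, by induction on both weights. *)
Lemma graded_bezout d f e g : isobaric n m d f -> isobaric n m e g ->
  no_common_zero d f e g ->
  exists2 N, has_graded_ci n m f g N & (N * (n * m) = d * e)%N.
Proof.
have unit_case d' f' e' g' : f' \is a GRing.unit -> (d' * e' = 0)%N ->
    exists2 N, has_graded_ci n m f' g' N & (N * (n * m) = d' * e')%N.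
  by move=> fu ->; exists 0%N => //; apply: has_graded_ci_unit.
have zero_case f' e' g' : no_common_zero 0 f' e' g' ->
    exists2 N, has_graded_ci n m f' g' N & (N * (n * m) = 0 * e')%N.
  move=> H; case: (posnP e') => [e0|e0]; last first.
    have [a [b [ab l0]]] := lead_has_zero g' n0 m0 e0.
    by apply: unit_case => //; apply: isobaric_unit (no_common_zero_sym H ab l0).
  rewrite e0 in H *; have [fu|fu] := eqVneq (lead n m 0 f' 1 0) 0; last first.
    by apply: unit_case => //; apply: isobaric_unit fu.
  have := H 1 0; rewrite oner_neq0 => /(_ isT fu) /isobaric_unit gu.
  by exists 0%N => //; apply/has_graded_ci_sym/has_graded_ci_unit.
have prime_case q w e' g' : prime_form q w -> isobaric n m e' g' ->
    no_common_zero w q e' g' ->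
    exists2 N, has_graded_ci n m q g' N & (N * (n * m) = w * e')%N.
  move=> hq; have [iq q0 w0] := prime_form_isobaric hq.
  elim/ltn_ind: e' g' => e' IH g' hg H.
  case: (posnP e') => [e0|e0].
    rewrite e0 in H *.
    have [N h1 h2] := zero_case _ _ _ (no_common_zero_sym H).
    by exists N; [exact: has_graded_ci_sym | rewrite h2 muln0].
  have g0 := no_common_zero_pos hg (no_common_zero_sym H) w0.
  have [q' [w' [e1 [g1 [hq' ee hg1 gg]]]]] := prime_form_divides hg g0 e0.
  have [iq' q'0 w'0] := prime_form_isobaric hq'.
  rewrite ee gg in H *.
  have [H1 H2] := no_common_zero_factor iq' hg1 (no_common_zero_sym H).
  have [N1 D1 E1] := graded_ci_prime_forms hq hq' (no_common_zero_sym H1).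
  have [|N2 D2 E2] := IH e1 _ g1 hg1 (no_common_zero_sym H2).
    by rewrite ee -{1}[e1]add0n ltn_add2r.
  exists (N1 + N2)%N; last by rewrite mulnDl E1 E2 mulnDr.
  apply/has_graded_ci_sym/(has_graded_ci_mul iq' q'0); exact: has_graded_ci_sym.
elim/ltn_ind: d f => d IH f hf hg H.
case: (posnP d) => [d0|d0]; first by rewrite d0 in H *; exact: zero_case.
case: (posnP e) => [e0|e0].
  rewrite e0 in H *; have [N h1 h2] := zero_case _ _ _ (no_common_zero_sym H).
  by exists N; [exact: has_graded_ci_sym | rewrite h2 muln0].
have f0 := no_common_zero_pos hf H e0.
have [q [w [d1 [f1 [hq dd hf1 ff]]]]] := prime_form_divides hf f0 d0.
have [iq q0 w0] := prime_form_isobaric hq.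
rewrite dd ff in H *.
have [H1 H2] := no_common_zero_factor iq hf1 H.
have [N1 D1 E1] := prime_case _ _ _ _ hq hg H1.
have [|N2 D2 E2] := IH d1 _ f1 hf1 hg H2.
  by rewrite dd -{1}[d1]add0n ltn_add2r.
exists (N1 + N2)%N; last by rewrite mulnDl E1 E2 mulnDl.
exact: has_graded_ci_mul iq q0 D1 D2.
Qed.

Lemma bezout d f e g : wge n m d f -> wge n m e g -> no_common_zero d f e g ->
  exists2 N, quotient_dim (fun=> True) (fun h => exists u v, h = u * f + v * g) N &
    (N * (n * m) = d * e)%N.
Proof.
move=> hf hg H.
have [|N [w [b C]] E] := graded_bezout (@isobaric_wcomp K n m d f) (@isobaric_wcomp K n m e g).
  by move=> a b; rewrite !lead_wcomp; exact: H.
by exists N => //; apply: (transfer_quotient_dim n0 m0 hf hg C).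
Qed.

End Bezout.

(** * The Milnor number *)

Section Gradient.
Variable K : closedFieldType.
Local Notation P := {fps2 K}.
Implicit Types (f g h q p u v s : P).

Definition gradient_neq0 n m d f := forall a b : K, (a != 0) || (b != 0) ->
  (leadx n m d f a b != 0) \/ (leady n m d f a b != 0).

Lemma gradient_swap n m d f : gradient_neq0 n m d f -> gradient_neq0 m n d (swap f).
Proof.
move=> G a b ab; rewrite /leady swapK.
by case: (G b a); rewrite 1?orbC //; [right|left].
Qed.

Lemma wge_dx n m d f : wge n m d f -> wge n m (d - n) (fps2_dx f).
Proof. by move=> hf i j ij /=; rewrite hf ?mul0rn //; lia. Qed.

Lemma fps2_dyE f : fps2_dy f = swap (fps2_dx (swap f)).
Proof. exact: fps2P. Qed.

Lemma wge_dy n m d f : wge n m d f -> wge n m (d - m) (fps2_dy f).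
Proof.
by move=> hf; rewrite fps2_dyE; apply/wge_swap/wge_dx/wge_swap.
Qed.

Section Weights.
Variables n m : nat.
Hypotheses (n0 : (0 < n)%N) (m0 : (0 < m)%N).

Lemma leadx_dx d f a b : (n <= d)%N ->
  leadx n m d f a b = lead n m (d - n) (fps2_dx f) a b.
Proof.
move=> nd; rewrite (lead_extend n0 m0 _ _ _ (leq_subr n d)).
rewrite (sum_ord_extend (a := d) (F := fun i => \sum_(j < d.+1)
  if (i * n + j * m == d - n)%N then fps2_dx f i j * (a ^+ i * b ^+ j) else 0)) //;
    last first.
  move=> i /andP[di id]; rewrite big1 // => j _; case: eqP => // e.
  by exfalso; nia.
rewrite /leadx big_ord_recl big1 ?add0r => [|j _]; last by rewrite mulr0n mul0r if_same.
apply: eq_bigr => i _; apply: eq_bigr => j _ /=.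
by rewrite /bump /= add1n mulSn -addnA addnC -[X in _ == X](subnK nd) eqn_add2r.
Qed.

Lemma leadx_small d f a b : (d < n)%N -> leadx n m d f a b = 0.
Proof.
move=> dn; rewrite /leadx big1 // => i _; rewrite big1 // => j _; case: eqP => // e.
by case: (nat_of_ord i) e => [|k] e; [rewrite mulr0n mul0r | exfalso; nia].
Qed.

End Weights.

Lemma leady_dy n m d f a b : (0 < n)%N -> (0 < m)%N -> (m <= d)%N ->
  leady n m d f a b = lead n m (d - m) (fps2_dy f) a b.
Proof.
by move=> n0 m0 md; rewrite /leady leadx_dx // fps2_dyE lead_swap.
Qed.

(** If d < n, the initial form is a power of y, and its y-derivative has a zero other
    than the origin unless that form is linear. *)
Lemma gradient_weight_x n m d f : (0 < n)%N -> (0 < m)%N ->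
  f 0%N 1%N = 0 -> gradient_neq0 n m d f -> (n <= d)%N.
Proof.
move=> n0 m0 f01 G; rewrite leqNgt; apply/negP => dn.
have Gy a b : (a != 0) || (b != 0) -> leady n m d f a b != 0.
  by case/G=> //; rewrite leadx_small ?eqxx.
have md : (m <= d)%N.
  rewrite leqNgt; apply/negP => dm; have := Gy 1 0.
  by rewrite oner_neq0 /leady leadx_small // eqxx => /(_ isT).
case: (posnP (d - m)) => [dm|dm].
  have := Gy 1 0; rewrite oner_neq0 leady_dy // dm => /(_ isT).
  by rewrite /lead !big_ord1 /= f01 mul0rn mul0r eqxx.
have [a [b [ab l0]]] := lead_has_zero (fps2_dy f) n0 m0 dm.
by have := Gy a b ab; rewrite leady_dy // l0 eqxx.
Qed.

(** The equation is mu n m = (d - n) (d - m), without subtractions. *)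
Lemma milnor_number_gradient n m d f : (0 < n)%N -> (0 < m)%N -> coprime n m ->
  wge n m d f -> gradient_neq0 n m d f -> f 1%N 0%N = 0 -> f 0%N 1%N = 0 ->
  exists2 mu, milnor_number f mu &
    (mu * (n * m) + d * (n + m) = d * d + n * m)%N.
Proof.
move=> n0 m0 nm hf G f10 f01.
have nd := gradient_weight_x n0 m0 f01 G.
have md : (m <= d)%N by apply: (gradient_weight_x m0 n0 _ (gradient_swap G)).
have H : no_common_zero n m (d - n) (fps2_dx f) (d - m) (fps2_dy f).
  move=> a b ab; rewrite -leadx_dx // -leady_dy // => l0.
  by case: (G a b ab); rewrite ?l0 ?eqxx.
have [N hN E] := bezout n0 m0 nm (wge_dx hf) (wge_dy hf) H.
by exists N => //; rewrite E; nia.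
Qed.

End Gradient.

(** * Semi-quasihomogeneous singularities are tame *)

Section SemiQuasihomogeneous.
Variable K : closedFieldType.
Variable f : plane_curve_singularity K.

Lemma pcs_coef_small i j : (i + j <= 1)%N -> (f : {fps2 K}) i j = 0.
Proof.
move=> ij; apply/eqP/negPn/negP => fij; have := pcs_ord f; rewrite /ord_w.
case: pselect => // h; case: ex_minnP => d _ /(_ (i + j)%N) le_d.
rewrite ltnNge (leq_trans (le_d _)) //; apply/asboolP; exists i, j.
by rewrite !muln1.
Qed.

Lemma ord_wP n m (d := ord_w n m f) :
  (exists i j, (i * n + j * m)%N = d) /\ wge n m d f.
Proof.
rewrite /d /ord_w; case: pselect => [h|nh]; last first.
  case: nh; have [i [j fij]] := fps2_neq0P (pcs_neq0 f).
  by exists (i * n + j * m)%N; apply/asboolP; exists i, j.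
case: ex_minnP => e /asboolP[i [j [ij _]]] emin; split; first by exists i, j.
move=> i' j' lt; apply/eqP/negPn/negP => fij; move: lt; rewrite ltnNge emin //.
by apply/asboolP; exists i', j'.
Qed.

Lemma mderiv_power (p : {mpoly K[2]}) k t :
  (p ^+ t)^`M(k) = (p ^+ t.-1 * p^`M(k)) *+ t.
Proof.
elim: t => [|t IHt]; first by rewrite expr0 mulr0n -mpolyC1 mderivC.
rewrite exprS mderivM IHt /= mulrS mulrC; congr (_ + _).
by case: t {IHt} => [|t]; rewrite ?mulr0n ?mulr0 // mulrnAr mulrA -exprS.
Qed.

Lemma mderiv_var (k l : 'I_2) : ('X_l : {mpoly K[2]})^`M(k) = (k == l)%:R.
Proof.
rewrite mderivX mnm1E eq_sym; case: eqP => [->|_]; last by rewrite scale0r.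
by rewrite -{1}[U_(l)%MM]add0m addmK mpolyX0 scale1r.
Qed.

Lemma meval_mderiv_sum v k (I : finType) (Q : pred I) (F : I -> {mpoly K[2]}) :
  ((\sum_(i | Q i) F i)^`M(k)).@[v] = \sum_(i | Q i) ((F i)^`M(k)).@[v].
Proof.
by rewrite [(\sum_(i | Q i) F i)^`M(k)](raddf_sum (mderiv k)) (raddf_sum (meval v)).
Qed.

Lemma meval_dx_in n m v : ((in_w n m f)^`M(0)).@[v] =
  leadx n m (ord_w n m f) f (v 0) (v 1).
Proof.
rewrite /in_w /leadx meval_mderiv_sum; apply: eq_bigr => i _.
rewrite meval_mderiv_sum big_mkcond /=; apply: eq_bigr => j _.
case: ifP => // _; rewrite mderivZ mevalZ mderivM !mderiv_power !mderiv_var /=.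
rewrite mulr0 mul0rn mulr0 addr0 mulr1 mulrnAl mevalMn mulrnAr mulrnAl.
by rewrite mevalM !rmorphXn /= !mevalXU.
Qed.

Lemma meval_dy_in n m v : ((in_w n m f)^`M(1)).@[v] =
  leady n m (ord_w n m f) f (v 0) (v 1).
Proof.
rewrite /in_w /leady /leadx [RHS]exchange_big meval_mderiv_sum; apply: eq_bigr => i _.
rewrite meval_mderiv_sum big_mkcond /=; apply: eq_bigr => j _.
rewrite addnC; case: ifP => // _.
rewrite mderivZ mevalZ mderivM !mderiv_power !mderiv_var /=.
rewrite mulr0 mul0rn mul0r add0r mulr1 mulrnAr mevalMn mulrnAr mulrnAl.
by rewrite mevalM !rmorphXn /= !mevalXU [v 0 ^+ _ * _]mulrC.
Qed.

Lemma leadx_scale g n m d (h : {fps2 K}) a b : (0 < g)%N -> (0 < n)%N -> (0 < m)%N ->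
  leadx (g * n) (g * m) (g * d) h a b = leadx n m d h a b.
Proof.
move=> g0 n0 m0; rewrite [RHS](leadx_extend n0 m0 (N := (g * d)%N)) ?leq_pmull //.
apply: eq_bigr => i _; apply: eq_bigr => j _.
by rewrite ![(_ * (g * _))%N]mulnCA -mulnDr eqn_pmul2l.
Qed.

(** Dividing both weights by their greatest common divisor does not change initial
    forms. *)
Lemma sqh_coprime n m : (0 < n)%N -> (0 < m)%N -> semi_quasihomogeneous n m f ->
  exists n' m' d, [/\ (0 < n')%N, (0 < m')%N, coprime n' m', wge n' m' d f &
    gradient_neq0 n' m' d f].
Proof.
move=> n0 m0 S; pose g := gcdn n m.
have g0 : (0 < g)%N by rewrite gcdn_gt0 n0.
have nE : n = (g * (n %/ g))%N by rewrite mulnC divnK ?dvdn_gcdl.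
have mE : m = (g * (m %/ g))%N by rewrite mulnC divnK ?dvdn_gcdr.
have [[i [j ijd]] hd] := ord_wP n m.
pose n' := (n %/ g)%N; pose m' := (m %/ g)%N; rewrite -/n' -/m' in nE mE.
have n'0 : (0 < n')%N by rewrite divn_gt0 // dvdn_leq ?dvdn_gcdl.
have m'0 : (0 < m')%N by rewrite divn_gt0 // dvdn_leq ?dvdn_gcdr.
pose d := (i * n' + j * m')%N.
have dE : ord_w n m f = (g * d)%N.
  by rewrite -ijd {1}nE {1}mE /d mulnDr ![(_ * (g * _))%N]mulnCA.
exists n', m', d; split=> //.
- by rewrite /coprime /n' /m' -(eqn_pmul2l g0) muln1 muln_gcdr -nE -mE.
- move=> a b ab; apply: hd; rewrite dE {1}nE {1}mE ![(_ * (g * _))%N]mulnCA.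
  by rewrite -mulnDr ltn_pmul2l.
move=> a b ab.
pose v (k : 'I_2) : K := if k == 0 then a else b.
have [hv _] := S v; move: hv.
rewrite meval_dx_in meval_dy_in dE /leady {1}nE {1}mE {1}nE {1}mE !leadx_scale //.
rewrite /v /= => hv; have [lx|lx] := eqVneq (leadx n' m' d f a b) 0; last by left.
right; apply/eqP => ly; have [a0 b0] := hv (conj lx ly).
by move: ab; rewrite a0 b0 eqxx.
Qed.

End SemiQuasihomogeneous.

Local Close Scope ring_scope.

Theorem corollary1p6 (K : closedFieldType) (f : plane_curve_singularity K)
    (n m : nat) (hn : 0 < n) (hm : 0 < m) :
  semi_quasihomogeneous n m f -> tame f.
Proof.
move=> /(sqh_coprime hn hm)[n' [m' [d [n0 m0 nm hf G]]]].
have S : smooth n' m' d f by move=> a b ab _; exact: G.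
have [r [delta [[hr [Phi [B N]]] E1]]] := smooth_resolved n0 m0 nm hf S.
have [|| mu hmu E2] := milnor_number_gradient n0 m0 nm hf G; try exact: pcs_coef_small.
split; first exact: normalization_reduced N.
exists mu, delta, r; split=> //; first exact: normalization_delta N.
have nm0 : (0 < n' * m')%N by rewrite muln_gt0 n0.
suff : (mu + r = 2 * delta + 1)%N by lia.
apply/eqP; rewrite -(eqn_pmul2r nm0); apply/eqP.
rewrite !mulnDl mul1n; lia.
Qed.
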